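(* Let $k\ge3$ and let $V\subset\mathbb{C}^k$ be an algebraic variety of codimension $2$. Then there exist a Short $\mathbb{C}^k$ $\Omega$ and a Fatou–Bieberbach domain $D$ such that $D\subset\Omega\subset\mathbb{C}^k\setminus V$.
   Context: A Short $\mathbb{C}^k$ is a domain $\Omega\subset\mathbb{C}^k$ such that: (1) $\Omega=\bigcup_{j\ge1}\Omega_j$ with $\Omega_j\subset\Omega_{j+1}$ and each $\Omega_j$ biholomorphic to the unit ball of $\mathbb{C}^k$; (2) the infinitesimal Kobayashi pseudometric of $\Omega$ vanishes identically; (3) $\Omega$ carries a non-constant plurisubharmonic function that is bounded above. A Fatou–Bieberbach domain is a proper subdomain of $\mathbb{C}^k$ that is biholomorphic to $\mathbb{C}^k$. *)

(* Defs.v *)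
From HB Require Import structures.
From mathcomp Require Import all_boot all_order all_algebra.
From mathcomp Require Import all_classical all_reals all_analysis.
From mathcomp Require Import complex.
Set Implicit Arguments.
Unset Printing Implicit Defensive.
Import Order.TTheory GRing.Theory Num.Theory.
Import numFieldNormedType.Exports.
Local Open Scope ring_scope.
Local Open Scope classical_set_scope.

Definition Cplx (R : realType) : normedModType R[i] := R[i]^o.

(** C^k, as a normed C-vector space (the norm is the max norm, which
    induces the standard topology of C^k). *)
Definition Ck (R : realType) (k : nat) : normedModType R[i] := 'rV[R[i]]_k.

(** Holomorphic on an open set: complex (Frechet) differentiable at every point
    (the differential in mathcomp-analysis is R[i]-linear). *)
Definition holomorphic_on {R : realType} {V W : normedModType R[i]}
  (U : set V) (f : V -> W) : Prop :=
  open U /\ forall x, U x -> differentiable f x.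

Definition biholomorphic (R : realType) (k : nat) (U W : set (Ck R k)) : Prop :=
  exists f g : Ck R k -> Ck R k,
    [/\ holomorphic_on U f, holomorphic_on W g,
        (forall x, U x -> W (f x) /\ g (f x) = x) &
        (forall y, W y -> U (g y) /\ f (g y) = y)].

Definition unit_ball (R : realType) (k : nat) : set (Ck R k) :=
  [set z : Ck R k | \sum_(i < k) `|z 0 i| ^+ 2 < 1].

Definition unit_disc (R : realType) : set (Cplx R) := [set z : Cplx R | `|z| < 1].
Arguments unit_ball R k : clear implicits.
Arguments unit_disc R : clear implicits.

Definition domain (R : realType) (k : nat) (U : set (Ck R k)) : Prop :=
  [/\ open U, connected U & U !=set0].

Definition kobayashi (R : realType) (k : nat) (O : set (Ck R k))
  (p v : Ck R k) : \bar R :=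
  ereal_inf [set (a%:E)%E | a in
    [set a : R | 0 < a /\
      exists f : Cplx R -> Ck R k,
        [/\ holomorphic_on (unit_disc R) f, f @` unit_disc R `<=` O,
            f 0 = p & f^`() 0 = ((a^-1)%:C)%C *: v]]].

Definition plurisubharmonic (R : realType) (k : nat) (O : set (Ck R k))
  (u : Ck R k -> \bar R) : Prop :=
  [/\ (forall x, O x -> (u x < +oo)%E),
      (forall x, O x -> forall c : R, (u x < c%:E)%E ->
          \forall y \near x, (u y < c%:E)%E) &
      (forall a b : Ck R k, (forall z : Cplx R, `|z| <= 1 -> O (a + z *: b)) ->
         (u a <= ((2 * pi)^-1)%:E *
            \int[@lebesgue_measure R]_(t in `[0%R, (2 * pi)%R])
               u (a + ((cos t +i* sin t)%C : R[i]) *: b)%R)%E)].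

Definition short_Ck (R : realType) (k : nat) (O : set (Ck R k)) : Prop :=
  [/\ domain O,
      (exists Om : nat -> set (Ck R k),
         [/\ forall j, Om j `<=` Om j.+1,
             O = \bigcup_j Om j &
             forall j, biholomorphic (Om j) (unit_ball R k)]),
      (forall p v, O p -> kobayashi O p v = 0%E) &
      (exists u : Ck R k -> \bar R,
         [/\ plurisubharmonic O u,
             (exists M : R, forall x, O x -> (u x <= M%:E)%E) &
             (exists x y, [/\ O x, O y & u x <> u y])])].

Definition fatou_bieberbach (R : realType) (k : nat) (D : set (Ck R k)) : Prop :=
  [/\ domain D, D <> setT & biholomorphic setT D].

Inductive polyfun (R : realType) (k : nat) : (Ck R k -> R[i]) -> Prop :=
  | polyfun_const (c : R[i]) : polyfun (fun _ => c)
  | polyfun_coord (i : 'I_k) : polyfun (fun z => z 0 i)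
  | polyfun_add p q : polyfun p -> polyfun q -> polyfun (fun z => p z + q z)
  | polyfun_mul p q : polyfun p -> polyfun q -> polyfun (fun z => p z * q z).

Definition algebraic_set (R : realType) (k : nat) (V : set (Ck R k)) : Prop :=
  exists S : set (Ck R k -> R[i]),
    (forall p, S p -> polyfun p) /\ V = [set z : Ck R k | forall p, S p -> p z = 0].

Definition irreducible_alg (R : realType) (k : nat) (Z : set (Ck R k)) : Prop :=
  [/\ algebraic_set Z, Z !=set0 &
      forall A B, algebraic_set A -> algebraic_set B -> Z `<=` A `|` B ->
        Z `<=` A \/ Z `<=` B].

Definition alg_dim_ge (R : realType) (k : nat) (V : set (Ck R k)) (n : nat) : Prop :=
  exists Z : nat -> set (Ck R k),
    [/\ forall i, (i <= n)%N -> irreducible_alg (Z i),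
        forall i, (i < n)%N -> Z i `<` Z i.+1 &
        Z n `<=` V].

Definition alg_dim (R : realType) (k : nat) (V : set (Ck R k)) (n : nat) : Prop :=
  alg_dim_ge V n /\ ~ alg_dim_ge V n.+1.

(* Main.v *)
(* Since [V] has codimension [2], for every coordinate axis [i] there is a nonzero
   polynomial [g i] that vanishes on [V] and does not depend on [z_i]; let [p] be a
   common non-zero of the [g i].  The overshears [z_i -> z_i exp (- s i z)], with
   [s i] the multiple of [g i] equal to [1] at [p], are automorphisms that fix [V]
   pointwise, and their composition is, to first order, the contraction by [1 / e]
   at [p].  Its basin at [p] is therefore the image of an injective entire map
   [Psi] and avoids [V].
   Inside [C^k], the Henon-type automorphism
   [H z = (z_max + z_0 ^ 2, z_0, z_1, ...) / 4] yields a Short [C^k]: the union of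
   the preimages of the unit ball under [b_j H^j], with [b_j = 32 ^ - 2 ^ j].  These
   are nested biholomorphic balls on which the derivatives of the [b_j H^j] tend to
   zero, so that the Kobayashi metric vanishes; the Green function
   [lim 2 ^ - j log+ |H^j|] is plurisubharmonic, at most [log 32], and not constant.
   This domain contains the basin of [0] under [H], a Fatou-Bieberbach domain.
   [Psi] transports both domains to the complement of [V]. *)

Require Import Defs.
From HB Require Import structures.
From mathcomp Require Import all_boot all_order all_algebra.
From mathcomp Require Import all_classical all_reals all_analysis.
From mathcomp Require Import complex ring lra zify.
Import Order.TTheory GRing.Theory Num.Theory.
Import numFieldNormedType.Exports.
Local Open Scope ring_scope.
Local Open Scope classical_set_scope.
Set Implicit Arguments.
Unset Strict Implicit.
Unset Printing Implicit Defensive.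

(** * Real-valued norms and polynomial functions *)

(** The linear parts at both fixed points are multiples of isometries of the max norm: [1 / e] times
    the identity, and [1 / 4] times a cyclic shift. With a single rate [lam] there is a contraction
    rate [mu] with [mu ^ 2 < lam], so [A^-n F^n] converges on the basin without any discussion of
    resonances. Holomorphy is handled as uniform approximation by polynomials on balls; Cauchy
    estimates, compositions and Jensen's inequality thereby reduce to polynomials in one variable.
    The [g i] exist because the projection of [V] along an axis has dimension at most [k - 2] in
    [C^(k-1)] and cannot be dense; in algebraic terms, without [g i] a strict chain of [k]
    irreducible sets would fit into [V]. A basin contains no fixed point other than its centre, and
    this is what keeps [V] out of it. The scales [b_j] are squared at each step because [H] is
    quadratic. The constant 32 is twice 16: the point [(16, 0, ..., 0)] then lies in the first ball
    while its orbit escapes, so the Green function is not constant and the basin of [H] is a proper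
    subset. *)

Section RealNorm.
Variable R : realType.
Local Notation C := R[i].

(* The norms of [Ck R k] and [R[i]] take values in the partially ordered field
   [R[i]]; [rn] is the same norm with values in [R]. *)
Definition rn (V : normedZmodType C) (x : V) : R := complex.Re `|x|.

Lemma rnE (V : normedZmodType C) (x : V) : `|x| = ((rn x)%:C)%C.
Proof. by apply/esym/RRe_real/ger0_real; exact: normr_ge0. Qed.

Lemma rn_ge0 (V : normedZmodType C) (x : V) : 0 <= rn x.
Proof. by rewrite -lecR -rnE normr_ge0. Qed.

Lemma rn0 (V : normedZmodType C) : rn (0 : V) = 0.
Proof. by rewrite /rn normr0. Qed.

Lemma rn_eq0 (V : normedZmodType C) (x : V) : (rn x == 0) = (x == 0).
Proof. by rewrite -[RHS]normr_eq0 rnE eq_complex /= eqxx andbT. Qed.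

Lemma rnN (V : normedZmodType C) (x : V) : rn (- x) = rn x.
Proof. by rewrite /rn normrN. Qed.

Lemma rnBC (V : normedZmodType C) (x y : V) : rn (x - y) = rn (y - x).
Proof. by rewrite /rn distrC. Qed.

Lemma rnD (V : normedZmodType C) (x y : V) : rn (x + y) <= rn x + rn y.
Proof. by rewrite -lecR rmorphD /= -!rnE ler_normD. Qed.

Lemma rnB (V : normedZmodType C) (x y : V) : rn (x - y) <= rn x + rn y.
Proof. by rewrite -(rnN y) rnD. Qed.

Lemma rn_triB (V : normedZmodType C) (y x z : V) : rn (x - z) <= rn (x - y) + rn (y - z).
Proof. by rewrite -[x - z](subrKA y) rnD. Qed.

Lemma rn_leD (V : normedZmodType C) (x y : V) : rn x <= rn (x - y) + rn y.
Proof. by rewrite -{1}[x](subrK y) rnD. Qed.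

Lemma rn_sum (V : normedZmodType C) I (s : seq I) (P : pred I) (F : I -> V) :
  rn (\sum_(i <- s | P i) F i) <= \sum_(i <- s | P i) rn (F i).
Proof.
elim/big_ind2 : _ => // [|x a y b xa yb]; first by rewrite rn0.
exact: le_trans (rnD _ _) (lerD xa yb).
Qed.

Lemma rnZ (V : normedModType C) (c : C) (x : V) : rn (c *: x) = rn c * rn x.
Proof. by apply: (@complexI R); rewrite rmorphM /= -!rnE normrZ. Qed.

Lemma rnM (x y : C) : rn (x * y) = rn x * rn y.
Proof. by apply: (@complexI R); rewrite rmorphM /= -!rnE normrM. Qed.

Lemma rn1 : rn (1 : C) = 1.
Proof. by rewrite /rn normr1. Qed.

Lemma rnX (x : C) n : rn (x ^+ n) = rn x ^+ n.
Proof. by elim: n => [|n IH]; rewrite ?rn1 // !exprS rnM IH. Qed.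

Lemma rnV (x : C) : rn x^-1 = (rn x)^-1.
Proof. by apply: (@complexI R); rewrite fmorphV /= -!rnE normfV. Qed.

Lemma rn_real (r : R) : rn ((r%:C)%C) = `|r|.
Proof.
apply: (@complexI R); rewrite -rnE normc_def /= expr0n /= addr0.
by rewrite sqrtr_sqr.
Qed.

Lemma rn_nat n : rn (n%:R : C) = n%:R.
Proof. by rewrite /rn normr_nat -(rmorph_nat (real_complex R)). Qed.

Lemma rn_Re (x : C) : `|complex.Re x| <= rn x.
Proof.
rewrite -(ler_pXn2r (ltn0Sn 1)) ?nnegrE ?rn_ge0 //.
rewrite /rn normc_def /= sqr_sqrtr ?addr_ge0 ?sqr_ge0 // real_normK ?num_real //.
by rewrite lerDl sqr_ge0.
Qed.

Lemma rn_Im (x : C) : `|complex.Im x| <= rn x.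
Proof.
rewrite -(ler_pXn2r (ltn0Sn 1)) ?nnegrE ?rn_ge0 //.
rewrite /rn normc_def /= sqr_sqrtr ?addr_ge0 ?sqr_ge0 // real_normK ?num_real //.
by rewrite lerDr sqr_ge0.
Qed.

Lemma rn_le_ReIm (x : C) : rn x <= `|complex.Re x| + `|complex.Im x|.
Proof.
have -> : rn x = rn (((complex.Re x)%:C)%C + 'i%C * ((complex.Im x)%:C)%C).
  by rewrite -complexE.
rewrite (le_trans (rnD _ _)) // rnM !rn_real.
suff -> : rn ('i%C : C) = 1 by rewrite mul1r.
by rewrite /rn normc_def /= expr0n expr1n add0r sqrtr1.
Qed.

(** Balls have radii in [R[i]]; positivity in its partial order forces the imaginary part to vanish,
    so real radii suffice. *)
Lemma nbhs_rn (V : normedModType C) (x : V) (P : set V) :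
  nbhs x P <-> exists2 e : R, 0 < e & forall y, rn (y - x) < e -> P y.
Proof.
split.
  case/nbhs_ballP => -[e f]; rewrite /= ltcE /= => /andP[/eqP f0 e0] sub; exists e => // y yx.
  by apply: sub; rewrite -ball_normE /= distrC rnE f0 -[ltRHS]/((e%:C)%C) ltcR.
case=> e e0 sub; apply/nbhs_ballP; exists (e%:C)%C; first by rewrite /= ltcR.
by move=> y; rewrite -ball_normE /= distrC rnE ltcR; exact: sub.
Qed.

Variable k : nat.

Lemma rn_le_coord (z : Ck R k) (M : R) : 0 <= M ->
  (forall i, rn (z 0 i) <= M) -> rn z <= M.
Proof.
move=> M0 zM; rewrite -lecR -rnE [X in X <= _]/Num.norm /=.
have M0' : (0 : C) <= (M%:C)%C by rewrite ler0c.
rewrite mx_normE -[leRHS]/((NngNum M0')%:num) num_le.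
apply/bigmax_leP; split=> [|[a b] _ /=]; rewrite -num_le //=.
by rewrite (ord1 a) rnE lecR.
Qed.

Lemma coord_le_rn (z : Ck R k) i : rn (z 0 i) <= rn z.
Proof.
rewrite -lecR -!rnE [leRHS]/Num.norm /= mx_normE.
have H : (`|z 0 i|%:nng : {nonneg C}) <=
    \big[Order.max/0%:nng]_ij `|z ij.1 ij.2|%:nng.
  by apply/bigmax_geP; right; exists (0, i).
by move: H; rewrite -num_le.
Qed.

End RealNorm.

(** * Closure properties of polynomial functions *)

Section PolyFun.
Variables (R : realType) (k : nat).
Local Notation C := R[i].
Implicit Types (f g p : Ck R k -> C).

Lemma polyfunB f g : polyfun f -> polyfun g -> polyfun (fun z => f z - g z).
Proof.
move=> fp gp; have -> : (fun z => f z - g z) = (fun z => f z + -1 * g z).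
  by apply/funext => z; rewrite mulN1r.
by apply: polyfun_add => //; apply: polyfun_mul => //; exact: polyfun_const.
Qed.

Lemma polyfunX f n : polyfun f -> polyfun (fun z => f z ^+ n).
Proof.
move=> fp; elim: n => [|n IH].
  rewrite (_ : (fun _ => _) = fun=> 1); first exact: polyfun_const.
  by apply/funext => z; rewrite expr0.
rewrite (_ : (fun _ => _) = fun z => f z * f z ^+ n); first exact: polyfun_mul.
by apply/funext => z; rewrite exprS.
Qed.

Lemma polyfun_sum I (s : seq I) (F : I -> Ck R k -> C) :
  (forall i, polyfun (F i)) -> polyfun (fun z => \sum_(i <- s) F i z).
Proof.
move=> Fp; elim: s => [|i s IH].
  rewrite (_ : (fun _ => _) = fun=> 0); first exact: polyfun_const.
  by apply/funext => z; rewrite big_nil.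
rewrite (_ : (fun _ => _) = fun z => F i z + \sum_(j <- s) F j z).
  exact: polyfun_add.
by apply/funext => z; rewrite big_cons.
Qed.

Lemma polyfun_horner f (q : {poly C}) : polyfun f -> polyfun (fun z => q.[f z]).
Proof.
move=> fp; rewrite (_ : (fun _ => _) =
   fun z => \sum_(i <- index_enum 'I_(size q)) q`_i * f z ^+ i).
  apply: polyfun_sum => i; apply: polyfun_mul; first exact: polyfun_const.
  exact: polyfunX.
by apply/funext => z; rewrite horner_coef.
Qed.

Lemma polyfun_comp m p (F : Ck R m -> Ck R k) : polyfun p ->
  (forall i, polyfun (fun z => F z 0 i)) -> polyfun (fun z => p (F z)).
Proof.
move=> pp Fp; elim: pp => [c|i|f g _ fF _ gF|f g _ fF _ gF] //.
- exact: polyfun_const.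
- exact: polyfun_add.
- exact: polyfun_mul.
Qed.

(** Restriction to complex lines reduces the estimates in several variables to univariate
    polynomials. *)
Lemma polyfun_line p a h : polyfun p ->
  exists q : {poly C}, forall t : C, p (a + t *: h) = q.[t].
Proof.
elim=> [c|i|f g _ [q fq] _ [r gr]|f g _ [q fq] _ [r gr]].
- by exists c%:P => t; rewrite hornerC.
- by exists ((a 0 i)%:P + h 0 i *: 'X) => t; rewrite !hornerE !mxE mulrC.
- by exists (q + r) => t; rewrite fq gr hornerD.
- by exists (q * r) => t; rewrite fq gr hornerM.
Qed.

End PolyFun.

(** * Continuity and differentiability in terms of the real norm *)

Section Differentials.
Variable R : realType.
Local Notation C := R[i].

Lemma continuous_rnP (V W : normedModType C) (f : V -> W) (x : V) :
  {for x, continuous f} <-> forall e : R, 0 < e ->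
    exists2 d : R, 0 < d & forall y, rn (y - x) < d -> rn (f y - f x) < e.
Proof.
split=> [fx e e0|fx P].
  have /fx : nbhs (f x) [set z | rn (z - f x) < e] by apply/nbhs_rn; exists e.
  by move=> /nbhs_rn.
move/nbhs_rn => [e /fx [d d0 df] eP]; apply/nbhs_rn.
by exists d => // y /df /eP.
Qed.

Lemma continuous_lip (V W : normedModType C) (f : V -> W) (B : R) :
  (forall x y, rn (f x - f y) <= B * rn (x - y)) -> continuous f.
Proof.
move=> fB x; apply/continuous_rnP => e e0.
have B0 : 0 < `|B| + 1 by rewrite ltr_pwDr.
exists (e / (`|B| + 1)) => [|y]; first by rewrite divr_gt0.
rewrite ltr_pdivlMr // mulrC => yx; apply: le_lt_trans (fB _ _) _.
apply: le_lt_trans yx; rewrite ler_wpM2r ?rn_ge0 //.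
by rewrite (le_trans (ler_norm _)) // lerDl.
Qed.

Lemma differentiable_rn (V W : normedModType C) (f : V -> W) (x : V)
    (df : {linear V -> W}) : continuous df ->
  (forall e : R, 0 < e -> exists2 d : R, 0 < d &
     forall h, rn h < d -> rn (f (x + h) - f x - df h) <= e * rn h) ->
  differentiable f x.
Proof.
move=> dfc fx.
have E : f \o shift x = cst (f x) + df +o_ 0 id.
  apply/eqaddoP => -[e e']; rewrite ltcE /= => /andP[/eqP -> e0].
  have [d d0 H] := fx _ e0; apply/nbhs_rn; exists d => // h.
  rewrite subr0 => /H; rewrite !fctE /= !rnE complexr0.
  by rewrite -rmorphM lecR opprD addrA [h + x]addrC.
by apply/diff_locallyP; rewrite (diff_unique dfc E).
Qed.

Lemma diff_rn (V W : normedModType C) (f : V -> W) (x : V) (e : R) :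
  differentiable f x -> 0 < e -> exists2 d : R, 0 < d &
     forall h, rn h < d -> rn (f (x + h) - f x - 'd f x h) <= e * rn h.
Proof.
move=> /diff_locallyP [_ /eqaddoP E] e0.
have /E /nbhs_rn [d d0 H] : (0 : C) < (e%:C)%C by rewrite ltcR.
exists d => // h hd.
have : `|f (h + x) - (f x + 'd f x h)| <= (e%:C)%C * `|h| by apply: H; rewrite subr0.
by rewrite !rnE -rmorphM lecR opprD addrA [h + x]addrC.
Qed.

End Differentials.

(** * Cauchy estimates and locally uniform limits of polynomials *)

Section Cauchy.
Variable R : realType.
Local Notation C := R[i].

Lemma exists_root_N1 s : exists2 z : C, z ^+ (2 ^ s) = -1 & rn z = 1.
Proof.
have [z zE] : exists z : C, z ^+ (2 ^ s) = -1.
  elim: s => [|s [z zE]]; first by exists (-1); rewrite expr1.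
  by exists (sqrtc z); rewrite expnS exprM sqr_sqrtc.
exists z => //; apply/eqP; rewrite -(@pexpr_eq1 _ _ (2 ^ s)) ?rn_ge0 ?expn_gt0 //.
by rewrite -rnX zE rnN rn1.
Qed.

(* Averaging [q] over the rotations by successive square roots of [-1] kills
   all the coefficients but the [j]-th one. *)
Lemma coef_cauchy (q : {poly C}) (M : R) j :
  (forall t, rn t = 1 -> rn q.[t] <= M) -> rn q`_j <= M.
Proof.
move=> qM.
have avg s : exists2 p : {poly C}, (forall t, rn t = 1 -> rn p.[t] <= M) &
    forall m, p`_m = if (m == j %[mod 2 ^ s])%N then q`_m else 0.
  elim: s => [|s [p pM pE]].
    by exists q => // m; rewrite !modn1 eqxx.
  have [z zE z1] := exists_root_N1 s.
  (* The rotated copy is weighted by [z ^ -j]: as [z ^ (2 ^ s) = -1], a surviving index [m] gets the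
     factor 1 or -1 according to whether it agrees with [j] modulo [2 ^ s.+1]. *)
  exists (2^-1 *: (p + z^-1 ^+ j *: \poly_(m < size p) (z ^+ m * p`_m))).
    move=> t t1.
    have pz : (\poly_(m < size p) (z ^+ m * p`_m)).[t] = p.[z * t].
      rewrite horner_poly horner_coef; apply: eq_bigr => m _.
      by rewrite exprMn mulrA [p`_m * _]mulrC.
    rewrite hornerZ hornerD hornerZ pz rnM rnV rn_nat.
    rewrite ler_pdivrMl // (le_trans (rnD _ _)) // mulrDl mul1r lerD ?pM //.
    by rewrite rnM rnX rnV z1 invr1 expr1n mul1r pM // rnM z1 t1 mul1r.
  move=> m; rewrite coefZ coefD coefZ coef_poly.
  have -> : (if (m < size p)%N then z ^+ m * p`_m else 0) = z ^+ m * p`_m.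
    by case: ltnP => // /(nth_default 0) ->; rewrite mulr0.
  have z0 : z != 0 by rewrite -rn_eq0 z1 oner_eq0.
  have half (x : C) : 2^-1 * (x + x) = x.
    by rewrite -mulr2n -[x *+ 2]mulr_natl mulKf // pnatr_eq0.
  rewrite pE; have [mj|mj] := eqVneq (m %% 2 ^ s)%N (j %% 2 ^ s)%N; last first.
    rewrite !mulr0 addr0 mulr0; case: eqP => // mj'; case/eqP: mj.
    by rewrite -(@modn_dvdm (2 ^ s.+1) m) ?dvdn_exp2l // mj' modn_dvdm // dvdn_exp2l.
  have zz : z ^+ m * z^-1 ^+ j = if (m == j %[mod 2 ^ s.+1])%N then 1 else -1.
    have zm a : z ^+ a = z ^+ (a %% 2 ^ s) * (-1) ^+ (a %/ 2 ^ s).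
      by rewrite {1}(divn_eq a (2 ^ s)) exprD mulnC exprM zE mulrC.
    rewrite exprVn (zm m) (zm j) mj invfM mulrACA divff ?expf_neq0 // mul1r.
    rewrite -exprVn invrN invr1 -exprD -signr_odd oddD.
    rewrite {2}(divn_eq m (2 ^ s)%N) {2}(divn_eq j (2 ^ s)%N) mj !(mulnC _ (2 ^ s)%N) expnSr.
    set a := (m %/ _)%N; set b := (j %/ _)%N; set c := (j %% _)%N.
    rewrite eqn_modDr -!muln_modr eqn_pmul2l ?expn_gt0 // !modn2.
    by case: (odd a); case: (odd b).
  rewrite mulrA [z^-1 ^+ j * _]mulrC zz.
  by case: ifP => _; rewrite ?mul1r ?half // mulN1r subrr mulr0.
(* The modulus [2 ^ (size q + j)] exceeds [j] and every degree in [q], so the average is the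
   monomial of degree [j]. *)
have [p pM pE] := avg (size q + j)%N.
have lt2 m : (m <= size q + j -> m %% 2 ^ (size q + j) = m)%N.
  by move=> mle; rewrite modn_small // (leq_ltn_trans mle) // ltn_expl.
suff pj : p.[1] = q`_j by rewrite -pj pM // rn1.
have -> : p = q`_j *: 'X^j.
  apply/polyP => m; rewrite pE coefZ coefXn.
  have [sm|ms] := leqP (size q) m.
    rewrite (nth_default 0 sm) if_same; case: eqP => [mj|]; last by rewrite mulr0.
    by rewrite -mj nth_default // mul0r.
  rewrite !lt2 ?leq_addl //; last by rewrite (leq_trans (ltnW ms)) // leq_addr.
  by case: eqP => [->|]; rewrite ?mulr1 ?mulr0.
by rewrite hornerZ hornerXn expr1n mulr1.
Qed.

(** The geometric series of ratio [1 / 2] in Horner form: the recursion closes because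
    [2 * M * 2^-1 + M = 2 * M]. *)
Lemma horner_coef_bound (q : {poly C}) (M : R) t :
  (forall j, rn q`_j <= M) -> rn t <= 2^-1 -> rn q.[t] <= 2 * M.
Proof.
elim/poly_ind: q => [|p c IH] qM t2.
  by rewrite horner0 rn0 mulr_ge0 // (le_trans (rn_ge0 _) (qM 0)).
rewrite hornerD hornerMX hornerC (le_trans (rnD _ _)) //.
have pM : rn p.[t] <= 2 * M.
  by apply: IH => // j; have := qM j.+1; rewrite coefD coefMX coefC addr0.
have cM : rn c <= M by have := qM 0; rewrite coefD coefMX coefC add0r.
rewrite rnM mulr2n mulrDl mul1r lerD //.
have -> : M = (2 * M) * 2^-1 by rewrite mulrC mulKf // pnatr_eq0.
by rewrite ler_pM ?rn_ge0.
Qed.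

(** [q - q.[0]] is [X] times a polynomial with the same coefficients shifted, which still satisfy
    the Cauchy bound; [horner_cauchy2] splits off one more coefficient. *)
Lemma horner_cauchy1 (q : {poly C}) (M : R) t :
  (forall t, rn t <= 1 -> rn q.[t] <= M) -> rn t <= 2^-1 ->
  rn (q.[t] - q.[0]) <= 2 * M * rn t.
Proof.
move=> qM t2; have cM j : rn q`_j <= M.
  by apply: coef_cauchy => u u1; rewrite qM // u1.
elim/poly_ind: q {qM} cM => [|p c _] cM.
  by rewrite !horner0 subrr rn0 !mulr_ge0 ?rn_ge0 // (le_trans (rn_ge0 _) (cM 0)).
rewrite !hornerD !hornerMX mulr0 !hornerC add0r addrK rnM.
rewrite ler_wpM2r ?rn_ge0 // horner_coef_bound // => j.
by have := cM j.+1; rewrite coefD coefMX coefC addr0.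
Qed.

Lemma horner_cauchy2 (q : {poly C}) (M : R) t :
  (forall t, rn t <= 1 -> rn q.[t] <= M) -> rn t <= 2^-1 ->
  rn (q.[t] - q.[0] - q`_1 * t) <= 2 * M * rn t ^+ 2.
Proof.
move=> qM t2; have cM j : rn q`_j <= M.
  by apply: coef_cauchy => u u1; rewrite qM // u1.
have M0 : 0 <= M := le_trans (rn_ge0 _) (cM 0).
have bound0 : 0 <= 2 * M * rn t ^+ 2 by rewrite !mulr_ge0 ?exprn_ge0 ?rn_ge0.
elim/poly_ind: q {qM} cM => [|p c _] cM.
  by rewrite !horner0 coef0 mul0r !subrr rn0.
rewrite !hornerD !hornerMX mulr0 !hornerC add0r addrK coefD coefMX coefC addr0 /=.
rewrite -mulrBl rnM.
elim/poly_ind: p cM => [|p d _] cM.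
  by rewrite horner0 coef0 subr0 rn0 mul0r.
rewrite hornerD hornerMX hornerC coefD coefMX coefC add0r addrK /= rnM -mulrA -expr2.
rewrite ler_wpM2r ?exprn_ge0 ?rn_ge0 // horner_coef_bound // => j.
by have := cM j.+2; rewrite coefD coefMX coefC addr0 /= coefD coefMX coefC addr0.
Qed.

(** The intervals of radius [K / (1 - q) * q ^ n] around [v n] are nested; the limit is the supremum
    of their lower ends. *)
Lemma real_geometric_limit (v : nat -> R) (K q : R) : 0 <= K -> 0 <= q -> q < 1 ->
  (forall n, `|v n.+1 - v n| <= K * q ^+ n) ->
  exists l, forall n, `|v n - l| <= K / (1 - q) * q ^+ n.
Proof.
move=> K0 q0 q1 vK; pose L := K / (1 - q).
have q1' : 0 < 1 - q by rewrite subr_gt0.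
have L0 : 0 <= L by rewrite divr_ge0 // ltW.
have LE n : L * q ^+ n = K * q ^+ n + L * q ^+ n.+1.
  rewrite exprS mulrA -mulrDl; congr (_ * _).
  by rewrite -{1}[K](mulfK (lt0r_neq0 q1')) -/L mulrAC -/L; rewrite /L; field; lra.
have lo n m : (n <= m)%N -> v n - L * q ^+ n <= v m - L * q ^+ m.
  elim: m => [|m IH]; first by rewrite leqn0 => /eqP ->.
  rewrite leq_eqVlt => /orP[/eqP -> //|]; rewrite ltnS => /IH /le_trans; apply.
  by have := vK m; rewrite ler_norml (LE m) => /andP[]; lra.
have hi n m : (n <= m)%N -> v m + L * q ^+ m <= v n + L * q ^+ n.
  elim: m => [|m IH]; first by rewrite leqn0 => /eqP ->.
  rewrite leq_eqVlt => /orP[/eqP -> //|]; rewrite ltnS => /IH; apply: le_trans.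
  by have := vK m; rewrite ler_norml (LE m) => /andP[]; lra.
pose E : set R := [set v n - L * q ^+ n | n in setT].
have ub n : ubound E (v n + L * q ^+ n).
  move=> _ [m _ <-].
  have Lq j : 0 <= L * q ^+ j by rewrite mulr_ge0 // exprn_ge0.
  have [nm|/ltnW mn] := leqP n m.
    by apply: le_trans (hi _ _ nm); have := Lq m; lra.
  by apply: le_trans (lo _ _ mn) _; have := Lq n; lra.
have E0 : E !=set0 by exists (v 0%N - L * q ^+ 0); exists 0%N.
exists (sup E) => n; rewrite ler_norml; apply/andP; split.
  by have := ge_sup E0 (ub n); rewrite -/L; lra.
have : v n - L * q ^+ n <= sup E.
  by apply: ub_le_sup; [exists (v 0%N + L * q ^+ 0)|exists n].
by rewrite -/L; lra.
Qed.

Lemma geometric_limit (u : nat -> C) (K q : R) : 0 <= K -> 0 <= q -> q < 1 ->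
  (forall n, rn (u n.+1 - u n) <= K * q ^+ n) ->
  exists l, forall n, rn (u n - l) <= 2 * K / (1 - q) * q ^+ n.
Proof.
move=> K0 q0 q1 uK.
have ReB (x y : C) : complex.Re (x - y) = complex.Re x - complex.Re y.
  by case: x; case: y.
have ImB (x y : C) : complex.Im (x - y) = complex.Im x - complex.Im y.
  by case: x; case: y.
have [|a aP] := @real_geometric_limit (fun n => complex.Re (u n)) K q K0 q0 q1.
  by move=> n; rewrite -ReB (le_trans (rn_Re _)).
have [|b bP] := @real_geometric_limit (fun n => complex.Im (u n)) K q K0 q0 q1.
  by move=> n; rewrite -ImB (le_trans (rn_Im _)).
exists (a +i* b)%C => n; rewrite (le_trans (rn_le_ReIm _)) // ReB ImB.
apply: le_trans (lerD (aP n) (bP n)) _.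
by rewrite -mulrDl -mulrDl -mulr2n -[K *+ 2]mulr_natl.
Qed.

End Cauchy.

(** * Uniform limits of polynomials on balls *)

Section Approximation.
Variable R : realType.
Local Notation C := R[i].

Definition cball k (a : Ck R k) (s : R) : set (Ck R k) := [set z | rn (z - a) <= s].

(** Stands in for holomorphy: it passes to uniform limits and compositions, and polynomial estimates
    extend to it. *)
Definition approx k (B : set (Ck R k)) (f : Ck R k -> C) : Prop :=
  forall e : R, 0 < e ->
    exists2 p : Ck R k -> C, polyfun p & forall z, B z -> rn (f z - p z) <= e.

(** Equivalent to being entire, since Taylor polynomials converge uniformly on balls. *)
Definition entire1 k (f : Ck R k -> C) : Prop := forall r, approx (cball 0 r) f.

Definition entire k m (F : Ck R k -> Ck R m) : Prop :=
  forall i, entire1 (fun z => F z 0 i).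

Lemma polyfun_bounded k (p : Ck R k -> C) (r : R) : polyfun p ->
  exists2 M : R, 0 <= M & forall z, rn z <= r -> rn (p z) <= M.
Proof.
elim=> [c|i|f g _ [M M0 fM] _ [N N0 gN]|f g _ [M M0 fM] _ [N N0 gN]].
- by exists (rn c); rewrite ?rn_ge0.
- exists `|r| => [|z zr]; first exact: normr_ge0.
  by rewrite (le_trans (coord_le_rn _ _)) // (le_trans zr) // ler_norm.
- exists (M + N) => [|z zr]; first exact: addr_ge0.
  by rewrite (le_trans (rnD _ _)) // lerD ?fM ?gN.
- exists (M * N) => [|z zr]; first exact: mulr_ge0.
  by rewrite rnM ler_pM ?rn_ge0 ?fM ?gN.
Qed.

Lemma polyfun_lip k (p : Ck R k -> C) (r : R) : polyfun p ->
  exists2 L : R, 0 <= L & forall x y, rn x <= r -> rn y <= r ->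
    rn (p x - p y) <= L * rn (x - y).
Proof.
elim=> [c|i|f g fp [M M0 fM] gp [N N0 gN]|f g fp [M M0 fM] gp [N N0 gN]].
- by exists 0 => // x y _ _; rewrite subrr rn0 mul0r.
- exists 1 => // x y _ _; rewrite mul1r.
  by have := coord_le_rn (x - y) i; rewrite !mxE.
- exists (M + N) => [|x y xr yr]; first exact: addr_ge0.
  by rewrite opprD addrACA (le_trans (rnD _ _)) // mulrDl lerD ?fM ?gN.
- have [A A0 fA] := polyfun_bounded r fp.
  have [B B0 gB] := polyfun_bounded r gp.
  exists (A * N + M * B) => [|x y xr yr]; first by rewrite addr_ge0 ?mulr_ge0.
  have -> : f x * g x - f y * g y = f x * (g x - g y) + (f x - f y) * g y by ring.
  rewrite (le_trans (rnD _ _)) // [leRHS]mulrDl lerD // rnM.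
    by rewrite -mulrA ler_pM ?rn_ge0 ?fA ?gN.
  by rewrite mulrAC ler_pM ?rn_ge0 ?fM ?gB.
Qed.

Lemma cball0 k (z : Ck R k) r : cball 0 r z = (rn z <= r) :> Prop.
Proof. by rewrite /cball /= subr0. Qed.

Lemma polyfun_approx k (B : set (Ck R k)) p : polyfun p -> approx B p.
Proof. by move=> pp e e0; exists p => // z _; rewrite subrr rn0 ltW. Qed.

Lemma approx_lim k (B : set (Ck R k)) f :
  (forall e : R, 0 < e -> exists2 g, approx B g & forall z, B z -> rn (f z - g z) <= e) ->
  approx B f.
Proof.
move=> fB e e0; have e2 : 0 < e / 2 by rewrite divr_gt0.
have [g gB fg] := fB _ e2; have [p pp gp] := gB _ e2.
exists p => // z Bz; rewrite (le_trans (rn_triB (g z) _ _)) //.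
by rewrite [leRHS]splitr lerD ?fg ?gp.
Qed.

Lemma approx_sub k (A B : set (Ck R k)) f : A `<=` B -> approx B f -> approx A f.
Proof.
by move=> AB fB e /fB [p pp fp]; exists p => // z /AB; exact: fp.
Qed.

Lemma approx_eq k (B : set (Ck R k)) f g : (forall z, B z -> f z = g z) ->
  approx B f -> approx B g.
Proof.
by move=> fg fB e /fB [p pp fp]; exists p => // z Bz; rewrite -fg ?fp.
Qed.

Lemma cball_bounded k (a : Ck R k) s z : cball a s z -> rn z <= s + rn a.
Proof. by move=> za; rewrite (le_trans (rn_leD _ a)) // lerD2r. Qed.

Lemma approx_bounded k (a : Ck R k) s f : approx (cball a s) f ->
  exists2 M : R, 0 <= M & forall z, cball a s z -> rn (f z) <= M.
Proof.
move=> /(_ 1 ltr01) [p pp fp]; have [M M0 pM] := polyfun_bounded (s + rn a) pp.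
exists (1 + M) => [|z az]; first by rewrite addr_ge0.
by rewrite (le_trans (rn_leD _ (p z))) // lerD ?fp ?pM ?(cball_bounded az).
Qed.

(** The outer function is replaced by a polynomial [p] on a ball that contains the image, then the
    coordinates of [F] by polynomials; the Lipschitz constant of [p] controls the second error. *)
Lemma approx_comp k m (a : Ck R m) s f (F : Ck R m -> Ck R k) :
  (forall i, approx (cball a s) (fun z => F z 0 i)) -> entire1 f ->
  approx (cball a s) (fun z => f (F z)).
Proof.
move=> Fa fe.
have /choice [M MP] : forall i, exists M : R, 0 <= M /\
    forall z, cball a s z -> rn (F z 0 i) <= M.
  by move=> i; have [M M0 MP] := approx_bounded (Fa i); exists M.
(* The extra 1 leaves room for the approximants of [F], which stay within distance 1 of it. *)
pose r := 1 + \sum_i M i.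
have r0 : 0 <= r by rewrite addr_ge0 // sumr_ge0 // => i _; case: (MP i).
have Mr i : 1 + M i <= r.
  rewrite lerD2l (bigD1 i) //= lerDl sumr_ge0 // => j _; by case: (MP j).
have Fr z : cball a s z -> rn (F z) <= r.
  move=> az; apply: rn_le_coord => // i; apply: le_trans (Mr i).
  by rewrite (le_trans ((MP i).2 _ az)) // lerDr.
apply: approx_lim => e e0; have [p pp fp] := fe r e e0.
exists (fun z => p (F z)) => [|z /Fr zr]; last by apply: fp; rewrite cball0.
have [L L0 pL] := polyfun_lip r pp.
move=> d d0; have L1 : 0 < L + 1 by rewrite ltr_wpDl.
pose d' := Num.min 1 (d / (L + 1)).
have d'0 : 0 < d' by rewrite lt_min ltr01 divr_gt0.
have /choice [P PP] : forall i, exists P : Ck R m -> C, polyfun P /\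
    forall z, cball a s z -> rn (F z 0 i - P z) <= d'.
  by move=> i; have [P ? ?] := Fa i _ d'0; exists P.
pose G z : Ck R k := \row_i P i z.
exists (fun z => p (G z)).
  apply: polyfun_comp => // i; rewrite (_ : (fun _ => _) = P i); first exact: (PP i).1.
  by apply/funext => z; rewrite mxE.
move=> z az; have FG : rn (F z - G z) <= d'.
  by apply: rn_le_coord (ltW d'0) _ => i; rewrite !mxE; apply: (PP i).2.
have Gr : rn (G z) <= r.
  apply: rn_le_coord => // i; rewrite mxE; apply: le_trans (Mr i).
  rewrite (le_trans (rn_leD _ (F z 0 i))) // lerD ?(MP i).2 // rnBC.
  by rewrite (le_trans ((PP i).2 _ az)) // ge_min lexx.
rewrite (le_trans (pL _ _ (Fr _ az) Gr)) // (le_trans (ler_wpM2l L0 FG)) //.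
rewrite (@le_trans _ _ ((L + 1) * (d / (L + 1)))) //.
  apply: ler_pM => //; [exact: ltW|by rewrite lerDl|by rewrite ge_min lexx orbT].
by rewrite mulrC divfK // gt_eqF.
Qed.

Lemma entire1_polyfun k p : @polyfun R k p -> entire1 p.
Proof. by move=> pp r; exact: polyfun_approx. Qed.

Lemma entire1_comp k m f (F : Ck R m -> Ck R k) :
  entire F -> entire1 f -> entire1 (fun z => f (F z)).
Proof. by move=> Fe fe r; apply: approx_comp => // i; exact: Fe. Qed.

Lemma entire_comp k m l (G : Ck R k -> Ck R l) (F : Ck R m -> Ck R k) :
  entire F -> entire G -> entire (G \o F).
Proof. by move=> Fe Ge i; exact: (entire1_comp Fe (Ge i)). Qed.

(** A product is the polynomial [w_0 * w_1] composed with the entire map [(f, g)]. *)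
Lemma entire1M k (f g : Ck R k -> C) :
  entire1 f -> entire1 g -> entire1 (fun z => f z * g z).
Proof.
move=> fe ge.
pose F z : Ck R 2 := \row_i (if i == 0 then f z else g z).
pose mul2 (w : Ck R 2) : C := w 0 0 * w 0 1.
rewrite (_ : (fun _ => _) = fun z => mul2 (F z)).
  apply: (@entire1_comp 2 k mul2 F).
    move=> i; rewrite /F; have [->|i0] := eqVneq i 0.
      by rewrite (_ : (fun _ => _) = f) //; apply/funext => z; rewrite mxE.
    by rewrite (_ : (fun _ => _) = g) //; apply/funext => z; rewrite mxE (negbTE i0).
  by apply: entire1_polyfun; apply: polyfun_mul; exact: polyfun_coord.
by apply/funext => z; rewrite /mul2 !mxE.
Qed.

Lemma entire1_lim k (f : Ck R k -> C) :
  (forall r e : R, 0 < e -> exists2 g, entire1 g & forall z, rn z <= r -> rn (f z - g z) <= e) ->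
  entire1 f.
Proof.
move=> fl r; apply: approx_lim => e /(fl r) [g ge fg].
by exists g => [|z]; [exact: ge|rewrite cball0; exact: fg].
Qed.

(** The line from [a] towards [h] is parametrised so that the unit disc fills the ball of radius
    [s]; the point [a + h] then has parameter [rn h / s]. *)
Lemma approx_line k (a : Ck R k) s p (M : R) h : polyfun p -> 0 < s ->
  (forall z, cball a s z -> rn (p z) <= M) -> h != 0 ->
  exists q : {poly C}, [/\ (forall t, rn t <= 1 -> rn q.[t] <= M), p a = q.[0] &
    p (a + h) = q.[((rn h / s)%:C)%C]].
Proof.
move=> pp s0 pM h0; have hn : rn h != 0 by rewrite rn_eq0.
have h0' : 0 < rn h by rewrite lt_neqAle eq_sym hn rn_ge0.
have [q qE] := polyfun_line a (((s / rn h)%:C)%C *: h) pp.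
exists q; split=> [t t1||].
- rewrite -qE; apply: pM; rewrite /cball /= addrAC subrr add0r !rnZ rn_real.
  rewrite ger0_norm ?divr_ge0 ?rn_ge0 ?(ltW s0) // divfK //.
  by rewrite ler_piMl // ltW.
- by rewrite -qE scale0r addr0.
- rewrite -qE scalerA -rmorphM /= mulrA divfK ?divff ?gt_eqF //.
  by rewrite scale1r.
Qed.

(** The one-variable estimate is applied on the line through [a] and [a + h] to a polynomial within
    [e / 3] of [f]. Two approximation errors and the enlargement of [M] by [e / 3] cost at most [e]
    altogether. *)
Lemma approx_cauchy1 k (a : Ck R k) s f (M : R) : 0 < s -> approx (cball a s) f ->
  (forall z, cball a s z -> rn (f z) <= M) ->
  forall h, rn h <= s / 2 -> rn (f (a + h) - f a) <= 2 * M / s * rn h.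
Proof.
move=> s0 fa fM h hs; have [->|h0] := eqVneq h 0.
  by rewrite addr0 subrr !rn0 mulr0.
apply/ler_addgt0Pr => e e0; have e3 : 0 < e / 3 by rewrite divr_gt0.
have [p pp fp] := fa _ e3.
have pM z : cball a s z -> rn (p z) <= e / 3 + M.
  by move=> az; rewrite (le_trans (rn_leD _ (f z))) // rnBC lerD ?fp ?fM.
have [q [qM pa pE]] := approx_line pp s0 pM h0.
have cah : cball a s (a + h).
  by rewrite /cball /= addrAC subrr add0r (le_trans hs) //; lra.
have ca : cball a s a by rewrite /cball /= subrr rn0 ltW.
have tE : rn (((rn h / s)%:C)%C : C) = rn h / s.
  by rewrite rn_real ger0_norm // divr_ge0 ?rn_ge0 ?(ltW s0).
have t2 : rn h / s <= 2^-1 by rewrite ler_pdivrMr // mulrC.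
have := horner_cauchy1 qM (t := ((rn h / s)%:C)%C); rewrite tE => /(_ t2).
rewrite -pE; set q0 := q.[0] => H.
have -> : f (a + h) - f a = (f (a + h) - p (a + h)) + (p (a + h) - q0) + (p a - f a).
  by rewrite pa -/q0; ring.
have H1 := fp _ cah; have := fp _ ca; rewrite rnBC => H2.
rewrite (le_trans (rnD _ _)) // (le_trans (lerD (rnD _ _) H2)) //.
rewrite (le_trans (lerD (lerD H1 H) (lexx _))) //.
have -> : 2 * (e / 3 + M) * (rn h / s) = 2 * M / s * rn h + 2 * (e / 3) * (rn h / s).
  by field; rewrite gt_eqF.
have : 2 * (e / 3) * (rn h / s) <= e / 3.
  rewrite -[leRHS]mulr1 -mulrA mulrCA ler_wpM2l ?(ltW e3) // -ler_pdivlMl //.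
  by rewrite mulr1.
by set A := _ / s * _; set B := _ * (_ / s); lra.
Qed.

(** The linear coefficients along all lines through [a] come from one column, the gradient, built by
    the sum and Leibniz rules. *)
Lemma polyfun_gradient k (p : Ck R k -> C) a : polyfun p ->
  exists G : 'cV[C]_k, forall h, exists2 q : {poly C},
    forall t : C, p (a + t *: h) = q.[t] & q`_1 = (h *m G) 0 0.
Proof.
elim=> [c|i|f g _ [F fF] _ [G gG]|f g _ [F fF] _ [G gG]].
- exists 0 => h; exists c%:P => [t|]; first by rewrite hornerC.
  by rewrite mulmx0 mxE coefC.
- exists (delta_mx i 0) => h; exists ((a 0 i)%:P + h 0 i *: 'X) => [t|].
    by rewrite !hornerE !mxE mulrC.
  rewrite coefD coefC coefZ coefX mulr1 add0r mxE (bigD1 i) //= mxE !eqxx mulr1.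
  by rewrite big1 ?addr0 // => j ji; rewrite mxE (negbTE ji) mulr0.
- exists (F + G) => h; have [q fq q1] := fF h; have [r gr r1] := gG h.
  exists (q + r) => [t|]; first by rewrite fq gr hornerD.
  by rewrite coefD q1 r1 mulmxDr [RHS]mxE.
- exists (g a *: F + f a *: G) => h.
  have [q fq q1] := fF h; have [r gr r1] := gG h.
  exists (q * r) => [t|]; first by rewrite fq gr hornerM.
  have := fq 0; have := gr 0; rewrite scale0r addr0 !horner_coef0 => -> ->.
  rewrite coefM !big_ord_recl big_ord0 /= /bump /= subnn subn0 addr0 q1 r1.
  rewrite mulmxDr -!scalemxAr !mxE; ring.
Qed.

(** Lets a bound on a limit be proved on approximants whose errors decay geometrically. *)
Lemma le_geometric (x B A q : R) : 0 <= q -> q < 1 ->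
  (forall n, x <= B + A * q ^+ n) -> x <= B.
Proof.
move=> q0 q1 xB; apply/ler_addgt0Pr => e e0.
have [A0|A0] := leP A 0.
  have := xB 0%N; rewrite expr0 mulr1 => H; apply: le_trans H _.
  by rewrite lerD2l (le_trans A0) // ltW.
have : (fun n => A * q ^+ n) @ \oo --> A * 0.
  by apply: cvgMr; apply: cvg_expr; rewrite ger0_norm.
rewrite mulr0 => /cvgrPdist_lt /(_ e e0) [N _ /(_ N (leqnn N))].
rewrite /= sub0r normrN => H; apply: le_trans (xB N) _; rewrite lerD2l ltW //.
exact: le_lt_trans (ler_norm _) H.
Qed.

(** Cauchy estimates along lines: direction [s e_i] for the entries of [G], and [h] rescaled to
    length [s] for the remainder. *)
Lemma gradient_bound k (a : Ck R k) s p (M : R) (G : 'cV[C]_k) : 0 < s ->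
  (forall z, cball a s z -> rn (p z) <= M) ->
  (forall h, exists2 q : {poly C},
    forall t : C, p (a + t *: h) = q.[t] & q`_1 = (h *m G) 0 0) ->
  (forall i, rn (G i 0) <= M / s) /\
  (forall h, rn h <= s / 2 ->
     rn (p (a + h) - p a - (h *m G) 0 0) <= 2 * (M / s ^+ 2) * rn h ^+ 2).
Proof.
move=> s0 pM pG.
have sn0 : ((s%:C)%C : C) != 0 by rewrite (@fmorph_eq0 _ _ (real_complex R)) gt_eqF.
have key h : rn h <= s -> exists q : {poly C}, [/\ (forall t, rn t <= 1 -> rn q.[t] <= M),
    forall t, p (a + t *: h) = q.[t] & q`_1 = (h *m G) 0 0].
  move=> hs; have [q qE q1] := pG h; exists q; split=> // t t1.
  rewrite -qE; apply: pM; rewrite /cball /= addrAC subrr add0r rnZ.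
  by rewrite (le_trans _ hs) // ler_piMl // rn_ge0.
split=> [i|h hs].
  have [|q [qM qE q1]] := key ((s%:C)%C *: (delta_mx 0 i : Ck R k)).
    rewrite rnZ rn_real gtr0_norm // ler_piMr ?(ltW s0) //.
    apply: rn_le_coord => // j; rewrite mxE eqxx /=.
    by case: (j == i); rewrite ?rn1 ?rn0.
  have : rn q`_1 <= M by apply: coef_cauchy => t t1; rewrite qM ?t1.
  rewrite q1 -scalemxAl mxE rnM rn_real gtr0_norm // ler_pdivlMr // mulrC.
  rewrite mxE (bigD1 i) //= mxE !eqxx mul1r big1 ?addr0 // => j ji.
  by rewrite mxE (negbTE ji) andbF mul0r.
have [->|h0] := eqVneq h 0.
  by rewrite addr0 subrr mul0mx mxE subrr !rn0 expr0n mulr0.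
have hn : rn h != 0 by rewrite rn_eq0.
have h0' : 0 < rn h by rewrite lt_neqAle eq_sym hn rn_ge0.
have [|q [qM qE q1]] := key (((s / rn h)%:C)%C *: h).
  by rewrite rnZ rn_real ger0_norm ?divr_ge0 ?rn_ge0 ?(ltW s0) // divfK.
pose t : C := ((rn h / s)%:C)%C.
have tr : rn t = rn h / s.
  by rewrite rn_real ger0_norm // divr_ge0 ?rn_ge0 ?(ltW s0).
have th : t *: (((s / rn h)%:C)%C *: h) = h.
  by rewrite scalerA -rmorphM /= mulrA divfK ?divff ?gt_eqF // scale1r.
have := horner_cauchy2 qM (t := t).
have -> : q`_1 * t = (h *m G) 0 0.
  by rewrite q1 mulrC -[in RHS]th -[in RHS]scalemxAl [RHS]mxE.
have -> : q.[0] = p a by rewrite -qE scale0r addr0.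
rewrite -qE th tr exprMn exprVn => H.
rewrite (le_trans (H _)) //; first by rewrite ler_pdivrMr // mulrC.
by rewrite [rn h ^+ 2 / _]mulrC !mulrA.
Qed.

(** Let [p n] be within [2 ^ -n] of [f]. The Cauchy bound on [p n.+1 - p n] makes the gradients of
    the [p n] converge geometrically; their quadratic remainders are bounded uniformly in [n], so
    the expansion survives in the limit. *)
Lemma approx_expansion k (a : Ck R k) s f : 0 < s -> approx (cball a s) f ->
  exists (G : 'cV[C]_k) (K : R), 0 <= K /\ forall h, rn h <= s / 2 ->
    rn (f (a + h) - f a - (h *m G) 0 0) <= K * rn h ^+ 2.
Proof.
move=> s0 fa; have [M M0 fM] := approx_bounded fa.
have half0 : (0 : R) <= 2^-1 by [].
have half1 : (2^-1 : R) < 1 by lra.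
have /choice [p pP] : forall n, exists p : Ck R k -> C, polyfun p /\
    forall z, cball a s z -> rn (f z - p z) <= 2^-1 ^+ n.
  by move=> n; have [|p ? ?] := fa (2^-1 ^+ n); [rewrite exprn_gt0|exists p].
have /choice [G GP] := fun n => polyfun_gradient a (pP n).1.
have cauchy i n : rn (G n.+1 i 0 - G n i 0) <= 2 / s * 2^-1 ^+ n.
  have [||H _] := @gradient_bound k a s (fun z => p n.+1 z - p n z) (2 * 2^-1 ^+ n)
      (G n.+1 - G n) s0.
  - move=> z az; rewrite (le_trans (rn_triB (f z) _ _)) // mulr2n mulrDl mul1r.
    rewrite lerD ?(pP n).2 // rnBC (le_trans ((pP n.+1).2 _ az)) //.
    by rewrite ler_wiXn2l // ltW.
  - move=> h; have [q qE q1] := GP n.+1 h; have [r rE r1] := GP n h.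
    exists (q - r) => [t|]; first by rewrite qE rE hornerD hornerN.
    by rewrite coefB q1 r1 mulmxBr !mxE.
  by have := H i; rewrite !mxE mulrAC.
have /choice [g gP] := fun i => geometric_limit
  (divr_ge0 (ler0n R 2) (ltW s0)) half0 half1 (cauchy i).
pose A := 2 * (2 / s) / (1 - 2^-1).
exists (\col_i g i), (2 * ((1 + M) / s ^+ 2)); split.
  by rewrite !mulr_ge0 ?invr_ge0 ?exprn_ge0 ?addr_ge0 // ltW.
move=> h hs.
apply: (@le_geometric _ _ (2 + \sum_(i < k) rn (h 0 i) * A) 2^-1) => // n.
have cah : cball a s (a + h).
  by rewrite /cball /= addrAC subrr add0r (le_trans hs) //; lra.
have ca : cball a s a by rewrite /cball /= subrr rn0 ltW.
have pM z : cball a s z -> rn (p n z) <= 1 + M.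
  move=> az; rewrite (le_trans (rn_leD _ (f z))) // rnBC lerD ?fM //.
  by rewrite (le_trans ((pP n).2 _ az)) // exprn_ile1 // ltW.
have [_ /(_ _ hs) H] := gradient_bound s0 pM (GP n).
have Hg : rn ((h *m G n) 0 0 - (h *m \col_i g i) 0 0) <=
    (\sum_(i < k) rn (h 0 i) * A) * 2^-1 ^+ n.
  rewrite !mxE -sumrB (le_trans (rn_sum _ _ _)) // mulr_suml ler_sum // => i _.
  by rewrite mxE -mulrBr rnM -mulrA ler_wpM2l ?rn_ge0 // gP.
have -> : f (a + h) - f a - (h *m \col_i g i) 0 0 =
  (f (a + h) - p n (a + h)) + (p n a - f a) + (p n (a + h) - p n a - (h *m G n) 0 0)
   + ((h *m G n) 0 0 - (h *m \col_i g i) 0 0) by ring.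
apply: le_trans (rnD _ _) _; apply: le_trans (lerD (rnD _ _) (lexx _)) _.
apply: le_trans (lerD (lerD (rnD _ _) (lexx _)) (lexx _)) _.
have := (pP n).2 _ ca; rewrite rnBC => pa; have pah := (pP n).2 _ cah.
have := lerD (lerD (lerD pah pa) H) Hg; move/le_trans; apply.
by rewrite (mulrDl 2) [leRHS]addrCA addrA; lra.
Qed.

Lemma approx_differentiable k m (F : Ck R k -> Ck R m) a s : 0 < s ->
  (forall i, approx (cball a s) (fun z => F z 0 i)) -> differentiable F a.
Proof.
move=> s0 Fa.
have /choice [G /choice [K GK]] := fun i => approx_expansion s0 (Fa i).
pose J : 'M[C]_(k, m) := \matrix_(i, j) G j i 0.
have JE h j : (h *m J) 0 j = (h *m G j) 0 0.
  by rewrite !mxE; apply: eq_bigr => i _; rewrite mxE.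
pose df : {linear Ck R k -> Ck R m} := mulmxr J.
have K0 : 0 <= \sum_j K j by rewrite sumr_ge0 // => j _; case: (GK j).
apply: (@differentiable_rn _ _ _ _ _ df).
  apply: (@continuous_lip _ _ _ _ (\sum_i \sum_j rn (J i j))) => x y.
  rewrite /= -mulmxBl; apply: rn_le_coord => [|j].
    by rewrite mulr_ge0 ?rn_ge0 // !sumr_ge0 // => i _; rewrite sumr_ge0 // => *; rewrite rn_ge0.
  rewrite mxE (le_trans (rn_sum _ _ _)) // mulr_suml ler_sum // => i _.
  rewrite rnM mulrC ler_pM ?rn_ge0 ?coord_le_rn //.
  by rewrite (bigD1 j) //= lerDl sumr_ge0 // => *; rewrite rn_ge0.
move=> e e0; exists (Num.min (s / 2) (e / (\sum_j K j + 1))).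
  by rewrite lt_min !divr_gt0 // ltr_wpDl.
move=> h; rewrite lt_min => /andP [hs he].
apply: rn_le_coord => [|j]; first by rewrite mulr_ge0 ?rn_ge0 // ltW.
have := (GK j).2 h (ltW hs); rewrite -JE !mxE => /le_trans; apply.
rewrite expr2 mulrA ler_wpM2r ?rn_ge0 //.
apply: (@le_trans _ _ ((\sum_j K j + 1) * rn h)).
  rewrite ler_wpM2r ?rn_ge0 // (bigD1 j) //= -addrA lerDl addr_ge0 // sumr_ge0 // => l _.
  by case: (GK l).
by rewrite mulrC -ler_pdivlMr ?ltr_wpDl // ltW.
Qed.

Lemma entire_differentiable k m (F : Ck R k -> Ck R m) a :
  entire F -> differentiable F a.
Proof.
move=> Fe; apply: (@approx_differentiable _ _ _ _ 1) => // i.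
apply: approx_sub (Fe i (1 + rn a)) => z /cball_bounded; by rewrite cball0.
Qed.

End Approximation.

(** * Basins of attracting fixed points *)

Section Limits.
Variables (R : realType) (k : nat).
Local Notation C := R[i].
Local Notation X := (Ck R k).

Definition conv (u : nat -> X) (l : X) : Prop :=
  forall e : R, 0 < e -> exists N, forall n, (N <= n)%N -> rn (u n - l) <= e.

Lemma conv_unique u l l' : conv u l -> conv u l' -> l = l'.
Proof.
move=> ul ul'; apply/eqP; rewrite -subr_eq0 -rn_eq0 eq_le rn_ge0 andbT.
apply/ler_addgt0Pr => e e0; have e2 : 0 < e / 2 by rewrite divr_gt0.
have [N NP] := ul _ e2; have [N' NP'] := ul' _ e2.
rewrite add0r (le_trans (rn_triB (u (N + N')%N) _ _)) // rnBC [leRHS]splitr.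
by rewrite lerD ?NP ?NP' ?leq_addr ?leq_addl.
Qed.

Lemma geometric_small (A q e : R) : 0 <= q -> q < 1 -> 0 < e ->
  exists N, forall n, (N <= n)%N -> A * q ^+ n <= e.
Proof.
move=> q0 q1 e0.
have : (fun n => A * q ^+ n) @ \oo --> A * 0.
  by apply: cvgMr; apply: cvg_expr; rewrite ger0_norm.
rewrite mulr0 => /cvgrPdist_lt /(_ e e0) [N _ NP]; exists N => n /NP.
by rewrite /= sub0r normrN => /ltW; apply: le_trans; rewrite ler_norm.
Qed.

Lemma conv_geometric (u : nat -> X) l (A q : R) : 0 <= q -> q < 1 ->
  (forall n, rn (u n - l) <= A * q ^+ n) -> conv u l.
Proof.
move=> q0 q1 uA e e0; have [N NP] := geometric_small A q0 q1 e0.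
by exists N => n /NP; apply: le_trans.
Qed.

Lemma conv_shift u l m : conv (fun n => u (n + m)%N) l <-> conv u l.
Proof.
split=> ul e /ul [N NP].
  exists (N + m)%N => n Nn; have := NP (n - m)%N; rewrite subnK; last by lia.
  by apply; lia.
by exists N => n Nn; apply: NP; lia.
Qed.

Lemma conv_comp (f : X -> X) u l :
  (forall e : R, 0 < e -> exists2 d : R, 0 < d &
     forall y, rn (y - l) < d -> rn (f y - f l) < e) ->
  conv u l -> conv (fun n => f (u n)) (f l).
Proof.
move=> fl ul e /fl [d d0 H]; have d2 : 0 < d / 2 by rewrite divr_gt0.
have [N NP] := ul _ d2; exists N => n /NP un; apply/ltW/H.
by apply: le_lt_trans un _; lra.
Qed.

Lemma conv_le u l (B : R) : conv u l -> (forall n, rn (u n) <= B) -> rn l <= B.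
Proof.
move=> ul uB; apply/ler_addgt0Pr => e /ul [N /(_ N (leqnn N)) uN].
rewrite (le_trans (rn_leD _ (u N))) // addrC lerD // rnBC.
exact: uN.
Qed.

Lemma vec_geometric_limit (u : nat -> X) (K q : R) : 0 <= K -> 0 <= q -> q < 1 ->
  (forall n, rn (u n.+1 - u n) <= K * q ^+ n) ->
  exists l, forall n, rn (u n - l) <= 2 * K / (1 - q) * q ^+ n.
Proof.
move=> K0 q0 q1 uK.
have /choice [l lP] : forall i, exists l : C, forall n,
    rn (u n 0 i - l) <= 2 * K / (1 - q) * q ^+ n.
  move=> i; apply: geometric_limit => // n.
  by have := le_trans (coord_le_rn _ i) (uK n); rewrite !mxE.
exists (\row_i l i) => n; apply: rn_le_coord => [|i]; last by rewrite !mxE.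
by rewrite !mulr_ge0 ?exprn_ge0 // invr_ge0 subr_ge0 ltW.
Qed.

Lemma approx_continuous m (F : X -> Ck R m) (a : X) s : 0 < s ->
  (forall i, approx (cball a s) (fun z => F z 0 i)) ->
  forall e : R, 0 < e -> exists2 d : R, 0 < d &
     forall y, rn (y - a) < d -> rn (F y - F a) < e.
Proof.
move=> s0 Fa; apply/continuous_rnP; apply: differentiable_continuous.
exact: approx_differentiable Fa.
Qed.

Lemma entire_continuous m (F : X -> Ck R m) a : entire F ->
  forall e : R, 0 < e -> exists2 d : R, 0 < d &
     forall y, rn (y - a) < d -> rn (F y - F a) < e.
Proof.
move=> Fe; apply/continuous_rnP; apply: differentiable_continuous.
exact: entire_differentiable.
Qed.

Lemma entire_id : entire (id : X -> X).
Proof. by move=> i; apply: entire1_polyfun; exact: polyfun_coord. Qed.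

Lemma entire_iter (F : X -> X) n : entire F -> entire (iter n F).
Proof. by move=> Fe; elim: n => [|n IH]; [exact: entire_id|exact: entire_comp IH Fe]. Qed.

(** A map vanishing to second order has a Lipschitz constant proportional to the radius. On the ball
    of radius [4 * rho] around [y] the norm is at most [5 * rho], so [M] is at most
    [25 * K * rho ^ 2]; the Cauchy estimate gives [25 / 2 * K * rho], rounded up to 13. *)
Lemma approx_lipschitz (M : X -> X) (K s : R) : entire M -> 0 <= K ->
  (forall z, rn z <= s -> rn (M z) <= K * rn z ^+ 2) ->
  forall rho, 0 <= rho -> 5 * rho <= s -> forall x y, rn x <= rho -> rn y <= rho ->
    rn (M x - M y) <= 13 * K * rho * rn (x - y).
Proof.
move=> Me s0 MK rho; rewrite le_eqVlt => /orP[/eqP <- _ x y|rho0 rs x y xr yr].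
  move=> x0 y0; have -> : x = y.
    have zz z : rn z <= 0 -> z = 0 :> X.
      by move=> z0; apply/eqP; rewrite -rn_eq0 eq_le z0 rn_ge0.
    by rewrite (zz _ x0) (zz _ y0).
  by rewrite !subrr !rn0 mulr0.
have near z : cball y (4 * rho) z -> rn (M z) <= 25 * K * rho ^+ 2.
  move=> /cball_bounded zy; have z5 : rn z <= 5 * rho by lra.
  rewrite (le_trans (MK _ (le_trans z5 rs))) //.
  have -> : 25 * K * rho ^+ 2 = K * (5 * rho) ^+ 2 by ring.
  by rewrite ler_wpM2l // ler_pXn2r ?nnegrE ?rn_ge0 ?mulr_ge0 // ltW.
have xy : rn (x - y) <= 4 * rho / 2 by rewrite (le_trans (rnB _ _)) //; lra.
apply: rn_le_coord => [|i]; first by rewrite !mulr_ge0 ?rn_ge0 // ltW.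
have r4 : 0 < 4 * rho by rewrite mulr_gt0.
have Mi : approx (cball y (4 * rho)) (fun z => M z 0 i).
  apply: approx_sub (Me i (4 * rho + rn y)) => z; rewrite cball0.
  exact: cball_bounded.
have := approx_cauchy1 r4 Mi (M := 25 * K * rho ^+ 2) _ xy.
rewrite (addrC y) subrK => H; rewrite !mxE; apply: le_trans (H _) _.
  by move=> z /near; apply: le_trans; exact: coord_le_rn.
rewrite ler_wpM2r ?rn_ge0 //.
have -> : 2 * (25 * K * rho ^+ 2) / (4 * rho) = 25 / 2 * K * rho.
  by field; rewrite gt_eqF.
by rewrite !ler_wpM2r ?(ltW rho0) //; lra.
Qed.

End Limits.

(** [mu ^ 2 < lam] is what makes [A^-n F^n] converge. The witness avoids a square root: [16 - lam (5
    - lam)^2 = (1 - lam)(16 - 9 lam + lam^2)] is positive. *)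
Lemma contraction_rate (R : realType) (lam : R) : 0 < lam -> lam < 1 ->
  exists2 mu, mu ^+ 2 < lam & lam < mu.
Proof.
move=> l0 l1; exists (lam * (5 - lam) / 4); last by nra.
have -> : (lam * (5 - lam) / 4) ^+ 2 = lam * (lam * (5 - lam) ^+ 2 / 16) by field.
rewrite -[ltRHS]mulr1 ltr_pM2l //.
have : 0 < (1 - lam) * (16 - 9 * lam + lam ^+ 2).
  by rewrite mulr_gt0 ?subr_gt0 // ltr_pwDr ?exprn_gt0 //; lra.
by nra.
Qed.

Lemma entireB (R : realType) k m (F G : Ck R k -> Ck R m) :
  entire F -> entire G -> entire (fun z => F z - G z).
Proof.
move=> Fe Ge i r e e0; have e2 : 0 < e / 2 by rewrite divr_gt0.
have [p pp fp] := Fe i r _ e2; have [q qp gq] := Ge i r _ e2.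
exists (fun z => p z - q z) => [|z rz]; first exact: polyfunB.
rewrite !mxE opprD addrACA -opprD (le_trans (rnB _ _)) // [leRHS]splitr.
by rewrite lerD ?fp ?gq.
Qed.

(** * Linearisation on the basin and its entire inverse *)

Section FatouBieberbach.
Variables (R : realType) (k : nat).
Local Notation C := R[i].
Local Notation X := (Ck R k).

(* [psi] maps [C^k] onto the basin of attraction of the fixed point [0] of [F],
   exhausted by the sets of points that [iter m F] sends to the ball of radius
   [r].  The inverse [Phi] is holomorphic on the basin, in the strong sense that
   it is a uniform limit of entire maps on each of these sets. *)
Record fb_map (F psi Phi : X -> X) (r mu : R) : Prop := FBMap {
  fb_r : 0 < r;
  fb_mu0 : 0 <= mu;
  fb_mu1 : mu < 1;
  fb_contr : forall z, rn z <= r -> rn (F z) <= mu * rn z;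
  fb_entire : entire psi;
  fb_approx : forall m (e : R), 0 < e -> exists2 G : X -> X, entire G &
    forall z, rn (iter m F z) < r -> rn (Phi z - G z) <= e;
  fb_basin : forall w, exists m, rn (iter m F (psi w)) < r;
  fb_PhiK : forall w, Phi (psi w) = w;
  fb_psiK : forall z m, rn (iter m F z) < r -> psi (Phi z) = z }.

Variables (F Fi A Ai : X -> X) (lam c s : R).
Hypotheses (lam0 : 0 < lam) (lam1 : lam < 1) (c0 : 0 <= c) (s0 : 0 < s).
Hypotheses (Fe : entire F) (Fie : entire Fi) (Ae : entire A) (Aie : entire Ai).
Hypotheses (FK : cancel F Fi) (FiK : cancel Fi F) (AK : cancel A Ai) (AiK : cancel Ai A).
Hypothesis AB : {morph A : x y / x - y}.
Hypothesis AiB : {morph Ai : x y / x - y}.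
Hypothesis An : forall x, rn (A x) = lam * rn x.
Hypothesis FA : forall z, rn z <= s -> rn (F z - A z) <= c * rn z ^+ 2.
Hypothesis FiAi : forall z, rn z <= s -> rn (Fi z - Ai z) <= c * rn z ^+ 2.

Let Ain x : rn (Ai x) = lam^-1 * rn x.
Proof. by rewrite -{2}(AiK x) An mulKf // gt_eqF. Qed.

Let AnI n x y : rn (iter n A x - iter n A y) = lam ^+ n * rn (x - y).
Proof.
elim: n => [|n IH]; first by rewrite mul1r.
by rewrite !iterS -AB An IH exprS mulrA.
Qed.

Let AinI n x y : rn (iter n Ai x - iter n Ai y) = lam ^- n * rn (x - y).
Proof.
elim: n => [|n IH]; first by rewrite expr0 invr1 mul1r.
by rewrite !iterS -AiB Ain IH exprS invfM mulrA.
Qed.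

Let A0 : A 0 = 0. Proof. by rewrite -{1}(subrr 0) AB subrr. Qed.
Let F0 : F 0 = 0.
Proof.
have := FA (z := 0); rewrite rn0 A0 subr0 expr0n mulr0 => /(_ (ltW s0)) H.
by apply/eqP; rewrite -rn_eq0 eq_le rn_ge0 H.
Qed.
Let Fi0 : Fi 0 = 0. Proof. by rewrite -{1}F0 FK. Qed.

Let iterK n : cancel (iter n F) (iter n Fi).
Proof. by elim: n => // n IH x; rewrite iterSr iterS FK IH. Qed.
Let iteriK n : cancel (iter n Fi) (iter n F).
Proof. by elim: n => // n IH x; rewrite iterSr iterS FiK IH. Qed.
Let iterAK n : cancel (iter n A) (iter n Ai).
Proof. by elim: n => // n IH x; rewrite iterSr iterS AK IH. Qed.
Let iterAiK n : cancel (iter n Ai) (iter n A).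
Proof. by elim: n => // n IH x; rewrite iterSr iterS AiK IH. Qed.
Let iter0 (G : X -> X) n : G 0 = 0 -> iter n G 0 = 0.
Proof. by move=> G0; elim: n => //= n ->. Qed.
Let AnI0 n x : rn (iter n A x) = lam ^+ n * rn x.
Proof. by have := AnI n x 0; rewrite (iter0 _ A0) !subr0. Qed.

Variables (mu r : R).
Hypotheses (mu_sqr : mu ^+ 2 < lam) (lam_mu : lam < mu).
Hypotheses (r0 : 0 < r) (rs : r <= s) (rc : c * r <= mu - lam).
Let mu0 : 0 < mu. Proof. exact: lt_trans lam0 lam_mu. Qed.
Let mu1 : mu < 1.
Proof. by have := mu_sqr; have := lam1; have := lam_mu; have := lam0; nra. Qed.

Let contr z : rn z <= r -> rn (F z) <= mu * rn z.
Proof.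
move=> zr; rewrite (le_trans (rn_leD _ (A z))) // An.
have := FA (le_trans zr rs); have := rc; have := ler_wpM2r (rn_ge0 z) (ler_wpM2l c0 zr).
by have := rn_ge0 z; nra.
Qed.

Let contrI z n : rn z <= r -> rn (iter n F z) <= mu ^+ n * rn z.
Proof.
move=> zr; elim: n => [|n IH]; first by rewrite mul1r.
have zr' : rn (iter n F z) <= r.
  by rewrite (le_trans IH) // (le_trans _ zr) // ler_piMl ?rn_ge0 // exprn_ile1 // ltW.
by rewrite iterS (le_trans (contr zr')) // exprS -mulrA ler_pM2l.
Qed.

Let q := mu ^+ 2 / lam.
Let q0 : 0 <= q. Proof. by rewrite divr_ge0 ?exprn_ge0 ?ltW. Qed.
Let q1 : q < 1. Proof. by rewrite ltr_pdivrMr // mul1r. Qed.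

(** The classical linearising sequence [A^-n F^n]; its limit [Phi] satisfies
    [Phi (F z) = A (Phi z)]. *)
Let phi n z := iter n Ai (iter n F z).
Let K := lam^-1 * c * r ^+ 2.
Let K0 : 0 <= K. Proof. by rewrite !mulr_ge0 ?invr_ge0 ?exprn_ge0 ?(ltW lam0) ?(ltW r0). Qed.

(** With [w = F^n z], the difference is [A^-n] applied to [A^-1 (F w) - A^-1 (A w)]. The error
    [c * rn w ^ 2] has order [mu ^ (2 n)], the expansion is [lam ^ -(n+1)], and the ratio of the two
    is [q < 1]. *)
Let phi_step z n : rn z <= r -> rn (phi n.+1 z - phi n z) <= K * q ^+ n.
Proof.
move=> zr; rewrite /phi iterSr iterS; set w := iter n F z.
have wr : rn w <= mu ^+ n * r.
  by rewrite (le_trans (contrI _ zr)) // ler_wpM2l // exprn_ge0 // ltW.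
have ws : rn w <= s.
  by rewrite (le_trans wr) // (le_trans _ rs) // ler_piMl ?(ltW r0) // exprn_ile1 // ltW.
rewrite AinI -{2}(AK w) -AiB Ain /K /q.
have -> : lam^-1 * c * r ^+ 2 * (mu ^+ 2 / lam) ^+ n =
   c * (mu ^+ n * r) ^+ 2 * (lam ^- n * lam^-1).
  rewrite (exprMn n (mu ^+ 2)) exprVn (exprMn 2) (exprAC _ _ 2); ring.
rewrite mulrA [leLHS]mulrC.
rewrite ler_wpM2r ?mulr_ge0 ?invr_ge0 ?exprn_ge0 ?(ltW lam0) //.
rewrite (le_trans (FA ws)) // ler_wpM2l // ler_pXn2r // ?nnegrE ?rn_ge0 //.
by rewrite mulr_ge0 ?exprn_ge0 ?ltW.
Qed.

Let phiD n m z : phi (n + m) z = iter m Ai (phi n (iter m F z)).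
Proof. by rewrite /phi -iterD -iterD addnC. Qed.

Let phi_limit z m : rn (iter m F z) <= r -> exists l, forall n,
  rn (phi (n + m) z - l) <= 2 * (lam ^- m * K) / (1 - q) * q ^+ n.
Proof.
move=> zr; apply: (vec_geometric_limit (u := fun n => phi (n + m) z)) => //.
  by rewrite mulr_ge0 // invr_ge0 exprn_ge0 // ltW.
move=> n; rewrite !phiD AinI -mulrA ler_wpM2l ?phi_step //.
by rewrite invr_ge0 exprn_ge0 // ltW.
Qed.

Let phi_ex z : exists l, (exists m, rn (iter m F z) <= r) -> conv (phi ^~ z) l.
Proof.
(* Off the basin the value 0 is a placeholder, which makes [Phi] a total function. *)
have [[m zr]|nz] := pselect (exists m, rn (iter m F z) <= r); last by exists 0.
have [l lP] := phi_limit zr; exists l => _.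
by apply/(conv_shift _ _ m); exact: conv_geometric q0 q1 lP.
Qed.

Let Phi := projT1 (choice phi_ex).
Let PhiP z m : rn (iter m F z) <= r -> conv (phi ^~ z) (Phi z).
Proof. by move=> zr; apply: (projT2 (choice phi_ex) z); exists m. Qed.

Let Phi_geo z m n : rn (iter m F z) <= r ->
  rn (phi (n + m) z - Phi z) <= 2 * (lam ^- m * K) / (1 - q) * q ^+ n.
Proof.
move=> zr; have [l lP] := phi_limit zr.
suff <- : l = Phi z by [].
apply: conv_unique (PhiP zr); apply/(conv_shift _ _ m).
exact: conv_geometric q0 q1 lP.
Qed.

Let phi_entire n : entire (phi n).
Proof. by apply: (entire_comp (F := iter n F)); exact: entire_iter. Qed.

Let Phi_approx m (e : R) : 0 < e -> exists2 G : X -> X, entire G &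
  forall z, rn (iter m F z) < r -> rn (Phi z - G z) <= e.
Proof.
move=> e0; have [N /(_ N (leqnn N)) NP] :=
  geometric_small (2 * (lam ^- m * K) / (1 - q)) q0 q1 e0.
exists (phi (N + m)) => [|z /ltW zr]; first exact: phi_entire.
by rewrite rnBC (le_trans (Phi_geo _ zr)).
Qed.

Let Phi_F z m : rn (iter m F z) <= r -> Phi (F z) = A (Phi z).
Proof.
move=> zr; have Fzr : rn (iter m F (F z)) <= r.
  rewrite -iterSr iterS (le_trans (contr zr)) // (le_trans _ zr) // ler_piMl ?rn_ge0 //.
  exact: ltW.
apply: conv_unique (PhiP Fzr) _.
have H1 := (conv_shift (phi ^~ z) (Phi z) 1).2 (PhiP zr).
move=> e /(conv_comp (entire_continuous (Phi z) Ae) H1) [N NP]; exists N => n /NP.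
by rewrite /phi addn1 [iter _ Ai _]iterS AiK iterSr.
Qed.

Let Phi_FI n z m : rn (iter m F z) <= r -> Phi (iter n F z) = iter n A (Phi z).
Proof.
move=> zr; elim: n => //= n <-; apply: (@Phi_F _ m).
rewrite -iterD addnC iterD (le_trans (contrI _ zr)) // (le_trans _ zr) //.
by rewrite ler_piMl ?rn_ge0 // exprn_ile1 // ltW.
Qed.

Variable sg : R.
Hypotheses (sg0 : 0 < sg) (sgs : 10 * sg <= s) (sgc : 52 * c * sg <= 1 - lam).
Hypothesis (sgr : 2 * sg < r).

Let Lip rho x y : 0 <= rho -> 5 * rho <= s -> rn x <= rho -> rn y <= rho ->
  rn (Fi x - Fi y) <= (lam^-1 + 13 * c * rho) * rn (x - y).
Proof.
move=> rho0 rhos xr yr.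
have := approx_lipschitz (entireB Fie Aie) c0 FiAi rho0 rhos xr yr => H.
have -> : Fi x - Fi y = (Fi x - Ai x - (Fi y - Ai y)) + (Ai x - Ai y).
  by rewrite opprB addrACA subrK [Ai y - _]addrC addrK.
by rewrite (le_trans (rnD _ _)) // -AiB Ain [leRHS]mulrDl addrC lerD2l.
Qed.

(** In other terms, [Fi] has Lipschitz constant at most [lam^-1 * (1 + t) / (1 + lam * t)] on the
    ball of radius [lam * t * sg * (1 + lam * t)]. For [t = lam ^ i] these constants telescope, so
    any number of inverse steps distorts the factor [lam ^ -j] by at most 2. The 52 in the choice of
    [sg] is 13 times the bound 4 on [(1 + lam * t) ^ 2]. *)
Let step_le t : 0 <= t -> t <= 1 ->
  (lam^-1 + 13 * c * (lam * t * sg * (1 + lam * t))) * lam * (1 + lam * t) <= 1 + t.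
Proof.
move=> t0 t1; have l0 := lam0; have l1 := lam1; have cs := sgc; have s0' := sg0.
rewrite mulrDl mulVf ?gt_eqF //; set u := lam * t.
have u0 : 0 <= u by rewrite mulr_ge0 // ltW.
have ut : u <= t by rewrite ler_piMl // ltW.
have cs0 : 0 <= c * sg by rewrite mulr_ge0 // ltW.
have u1 : u <= 1 by exact: le_trans t1.
have H1 : (1 + u) ^+ 2 <= 4 by nra.
have H2 : 13 * c * (u * sg * (1 + u)) * lam * (1 + u) <= (13 * (c * sg) * 4) * (lam * u).
  have -> : 13 * c * (u * sg * (1 + u)) * lam * (1 + u) =
     (13 * (c * sg) * (1 + u) ^+ 2) * (lam * u) by ring.
  rewrite ler_wpM2r //; first by rewrite mulr_ge0 // ltW.
  by rewrite ler_wpM2l // mulr_ge0.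
have H3 : (13 * (c * sg) * 4) * (lam * u) <= (1 - lam) * t.
  apply: ler_pM.
  - by lra.
  - by rewrite mulr_ge0 // ltW.
  - by lra.
  - by rewrite (le_trans _ ut) // ler_piMl // ltW.
by rewrite mulrDl mul1r; have : u = lam * t by []; lra.
Qed.

Let lamn n : 0 <= lam ^+ n <= 1.
Proof. by rewrite exprn_ge0 ?exprn_ile1 // ltW. Qed.

Let ball_step t : 0 <= t -> t <= 1 ->
  0 <= lam * t * sg * (1 + lam * t) /\ 5 * (lam * t * sg * (1 + lam * t)) <= s.
Proof.
move=> t0 t1; have l0 := lam0; have l1 := lam1; have s0' := sg0; have ss := sgs.
have u0 : 0 <= lam * t by rewrite mulr_ge0 // ltW.
have u1 : lam * t <= 1 by rewrite -[leRHS]mulr1 ler_pM // ltW.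
split; first by rewrite !mulr_ge0 ?addr_ge0 // ltW.
have : lam * t * (1 + lam * t) <= 2 by nra.
by nra.
Qed.

Let Fi_step2 t x y : 0 <= t -> t <= 1 ->
  rn x <= lam * t * sg * (1 + lam * t) -> rn y <= lam * t * sg * (1 + lam * t) ->
  rn (Fi x - Fi y) * lam * (1 + lam * t) <= (1 + t) * rn (x - y).
Proof.
move=> t0 t1 xt yt; have [b0 b5] := ball_step t0 t1.
have lt0 : 0 <= lam * (1 + lam * t) by rewrite mulr_ge0 ?addr_ge0 ?mulr_ge0 // ltW.
rewrite -mulrA (le_trans (ler_wpM2r lt0 (Lip b0 b5 xt yt))) //.
by rewrite mulrAC ler_wpM2r ?rn_ge0 //; have := step_le t0 t1; rewrite -(mulrA _ lam).
Qed.

Let Fi_step t x : 0 <= t -> t <= 1 -> rn x <= lam * t * sg * (1 + lam * t) ->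
  rn (Fi x) <= t * sg * (1 + t).
Proof.
move=> t0 t1 xt; have [b0 b5] := ball_step t0 t1.
have := Fi_step2 t0 t1 xt (y := 0); rewrite rn0 Fi0 !subr0 => /(_ b0) H.
have u0 : 0 < lam * (1 + lam * t).
  by rewrite mulr_gt0 // ltr_pwDl // mulr_ge0 // ltW.
rewrite -(ler_pM2r u0) mulrA (le_trans H) //.
rewrite (le_trans (ler_wpM2l _ xt)) ?addr_ge0 //.
by rewrite le_eqVlt; apply/orP; left; apply/eqP; ring.
Qed.

Let orbit_le j i x : rn x <= lam ^+ (j + i) * sg * (1 + lam ^+ (j + i)) ->
  rn (iter j Fi x) <= lam ^+ i * sg * (1 + lam ^+ i).
Proof.
elim: j x => // j IH x; rewrite addSn exprS => xt; rewrite iterSr; apply: IH.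
by have /andP[? ?] := lamn (j + i); exact: Fi_step.
Qed.

Let orbit_lip j i x y : rn x <= lam ^+ (j + i) * sg * (1 + lam ^+ (j + i)) ->
  rn y <= lam ^+ (j + i) * sg * (1 + lam ^+ (j + i)) ->
  rn (iter j Fi x - iter j Fi y) * (1 + lam ^+ (j + i)) * lam ^+ j <=
  (1 + lam ^+ i) * rn (x - y).
Proof.
elim: j x y => [|j IH] x y; first by move=> _ _; rewrite add0n expr0 mulr1 mulrC.
rewrite addSn !iterSr !exprS => xt yt; have /andP[T0 T1] := lamn (j + i).
have := IH _ _ (Fi_step T0 T1 xt) (Fi_step T0 T1 yt).
have := Fi_step2 T0 T1 xt yt; set T := lam ^+ (j + i).
set D := rn (_ - iter j _ _); set d := rn (Fi x - Fi y); set d0 := rn (x - y).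
move=> H1 H2; have T0' : 0 <= T := T0; have T1' : 0 < 1 + T by rewrite ltr_pwDl.
have l1T : 0 <= lam * (1 + lam * T) by rewrite mulr_ge0 ?addr_ge0 ?mulr_ge0 // ltW.
have li : 0 <= 1 + lam ^+ i by have /andP[? _] := lamn i; rewrite addr_ge0.
have := ler_wpM2r l1T H2; have := ler_wpM2l li H1 => H1' H2'.
rewrite -(ler_pM2l T1').
apply: (@le_trans _ _ ((1 + lam ^+ i) * (d * lam * (1 + lam * T)))).
  by move: H2'; move: (lam ^+ j) (lam ^+ i) => a b; lra.
by apply: le_trans H1' _; rewrite mulrA mulrA [(1 + T) * _]mulrC.
Qed.

Let psin n w := iter n Fi (iter n A w).

Let psin_le n w : rn w <= sg -> rn (psin n w) <= 2 * sg.
Proof.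
move=> ws; have /andP[t0 t1] := lamn n.
have := @orbit_le n 0 (iter n A w); rewrite addn0 expr0 mul1r => H.
rewrite mulrC (le_trans (H _)) // AnI0 -mulrA ler_wpM2l // (le_trans ws) //.
by rewrite ler_peMr ?(ltW sg0) // lerDl.
Qed.

(** With [v = A^(n+1) w], the two terms are [Fi^n] at [Fi v] and at [Ai v], points at distance at
    most [c * rn v ^ 2], of order [lam ^ (2 n)]. By [orbit_lip] the factor [Fi^n] costs only
    [2 * lam ^ -n]. *)
Let psin_step n w : rn w <= sg ->
  rn (psin n.+1 w - psin n w) <= 2 * c * sg ^+ 2 * lam ^+ n.
Proof.
move=> ws; have /andP[t0 t1] := lamn n.
pose v := iter n.+1 A w.
have Av : iter n A w = Ai v by rewrite /v iterS AK.
have vs : rn v <= lam * lam ^+ n * sg.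
  by rewrite /v AnI0 exprS ler_wpM2l // mulr_ge0 // ltW.
have vs' : rn v <= lam * lam ^+ n * sg * (1 + lam * lam ^+ n).
  by rewrite (le_trans vs) // ler_peMr ?lerDl // ?mulr_ge0 // ltW.
have xs := Fi_step t0 t1 vs'.
have ys : rn (iter n A w) <= lam ^+ n * sg * (1 + lam ^+ n).
  rewrite AnI0 -mulrA ler_wpM2l // (le_trans ws) //.
  by rewrite ler_peMr ?(ltW sg0) // lerDl.
have := @orbit_lip n 0 (Fi v) (iter n A w); rewrite addn0 expr0 => /(_ xs ys).
rewrite /psin iterSr -/v; set D := rn (_ - _) => H.
have vs1 : rn v <= s.
  rewrite (le_trans vs) // -[lam * _]exprS; have /andP[? ?] := lamn n.+1.
  by have := sg0; have := sgs; nra.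
have Fv := FiAi vs1; rewrite Av in H.
have ln0 : 0 < lam ^+ n by rewrite exprn_gt0.
have D0 : 0 <= D by exact: rn_ge0.
have H' : D * lam ^+ n <= 2 * (c * rn v ^+ 2).
  apply: (@le_trans _ _ (D * (1 + lam ^+ n) * lam ^+ n)).
    by rewrite ler_wpM2r // ler_peMr // lerDl.
  by rewrite (le_trans H) // -[1 + 1]/(2 : R) ler_wpM2l.
rewrite -(ler_pM2r ln0) (le_trans H') //.
have v2 : rn v ^+ 2 <= (lam ^+ n * sg) ^+ 2.
  rewrite ler_pXn2r ?nnegrE ?rn_ge0 ?mulr_ge0 // ?(ltW sg0) //.
  by rewrite (le_trans vs) // -mulrA ler_piMl ?mulr_ge0 // ltW.
rewrite -!mulrA ler_wpM2l // ler_wpM2l // (le_trans v2) //.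
by rewrite le_eqVlt; apply/orP; left; apply/eqP; ring.
Qed.

Let K2 := 2 * c * sg ^+ 2.
Let K20 : 0 <= K2. Proof. by rewrite !mulr_ge0 ?exprn_ge0 // ltW. Qed.

Let psis_ex w : exists l, rn w <= sg -> forall n,
  rn (psin n w - l) <= 2 * K2 / (1 - lam) * lam ^+ n.
Proof.
have [ws|] := pselect (rn w <= sg); last by exists 0.
have [l lP] := vec_geometric_limit K20 (ltW lam0) lam1 (fun n => psin_step n ws).
by exists l.
Qed.

Let psis := projT1 (choice psis_ex).
Let psis_geo w n : rn w <= sg ->
  rn (psin n w - psis w) <= 2 * K2 / (1 - lam) * lam ^+ n.
Proof. by move=> ws; apply: (projT2 (choice psis_ex)). Qed.

Let psis_conv w : rn w <= sg -> conv (psin ^~ w) (psis w).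
Proof.
by move=> ws; apply: (conv_geometric (ltW lam0) lam1) => n; exact: psis_geo.
Qed.

Let psis_le w : rn w <= sg -> rn (psis w) <= 2 * sg.
Proof. by move=> ws; apply: conv_le (psis_conv ws) _ => n; exact: psin_le. Qed.

Let psin_entire n : entire (psin n).
Proof. by apply: (entire_comp (F := iter n A)); exact: entire_iter. Qed.

Let psis_approx i : approx (cball 0 sg) (fun w => psis w 0 i).
Proof.
apply: approx_lim => e e0.
have [N /(_ N (leqnn N)) NP] := geometric_small (2 * K2 / (1 - lam)) (ltW lam0) lam1 e0.
exists (fun w => psin N w 0 i) => [|w]; first exact: psin_entire.
rewrite cball0 => /(psis_geo N) H.
by have := coord_le_rn (psin N w - psis w) i; rewrite !mxE rnBC; lra.
Qed.

Let Asg w : rn w <= sg -> rn (A w) <= sg.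
Proof. by rewrite An; apply: le_trans; rewrite ler_piMl ?rn_ge0 // ltW. Qed.

Let psis_A w : rn w <= sg -> psis (A w) = F (psis w).
Proof.
move=> ws; apply: conv_unique (psis_conv (Asg ws)) _.
have H1 := (conv_shift (psin ^~ w) (psis w) 1).2 (psis_conv ws).
move=> e /(conv_comp (entire_continuous (psis w) Fe) H1) [N NP]; exists N => n /NP.
by rewrite /psin addn1 [iter _ Fi _]iterS FiK iterSr.
Qed.

Let psis_AI n w : rn w <= sg -> psis (iter n A w) = iter n F (psis w).
Proof.
move=> ws; elim: n => //= n IH; rewrite psis_A ?IH // AnI0 (le_trans _ ws) //.
by rewrite ler_piMl ?rn_ge0 // exprn_ile1 // ltW.
Qed.

Let small_ex (w : X) : exists m, lam ^+ m * rn w <= sg.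
Proof.
have [N /(_ N (leqnn N)) NP] := geometric_small (rn w) (ltW lam0) lam1 sg0.
by exists N; rewrite mulrC.
Qed.

(** The local inverse [psis] is extended to the whole space by its functional equation; [psiE] shows
    that any large enough [m] gives the same value. *)
Let psi w := let m := projT1 (cid (small_ex w)) in iter m Fi (psis (iter m A w)).

Let psiE m w : lam ^+ m * rn w <= sg -> psi w = iter m Fi (psis (iter m A w)).
Proof.
have add j n : lam ^+ n * rn w <= sg ->
    iter (j + n) Fi (psis (iter (j + n) A w)) = iter n Fi (psis (iter n A w)).
  by move=> nw; rewrite addnC iterD [(n + j)%N]addnC iterD psis_AI ?AnI0 // iterK.
rewrite /psi => mw; case: cid => m0 /= m0w.
by rewrite -(add m _ m0w) addnC add.
Qed.

Let psi_entire : entire psi.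
Proof.
move=> i rad.
have [N /(_ N (leqnn N)) NP] := geometric_small rad (ltW lam0) lam1 sg0.
pose g w := psis (iter N A w).
have Nrad w : cball 0 rad w -> lam ^+ N * rn w <= sg.
  rewrite cball0 => wr; apply: le_trans NP; rewrite mulrC.
  by rewrite ler_wpM2r // exprn_ge0 // ltW.
have gi j : approx (cball 0 rad) (fun w => g w 0 j).
  apply: approx_lim => e e0; have [n /(_ n (leqnn n)) nP] :=
    geometric_small (2 * K2 / (1 - lam)) (ltW lam0) lam1 e0.
  exists (fun w => psin n (iter N A w) 0 j).
    exact: (entire_comp (entire_iter N Ae) (psin_entire n)).
  move=> w /Nrad wr; have wr' : rn (iter N A w) <= sg by rewrite AnI0.
  have := le_trans (coord_le_rn _ j) (psis_geo n wr'); rewrite !mxE rnBC => H.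
  exact: le_trans H nP.
apply: approx_eq (approx_comp gi (entire_iter N Fie i)) => w /Nrad wr /=.
by rewrite (psiE wr).
Qed.

Let psi_basin w : exists m, rn (iter m F (psi w)) < r.
Proof.
have [m mw] := small_ex w; exists m; rewrite (psiE mw) iteriK.
by apply: le_lt_trans sgr; apply: psis_le; rewrite AnI0.
Qed.

Let Phi_continuous z m : rn (iter m F z) < r ->
  forall e : R, 0 < e -> exists2 d : R, 0 < d &
     forall y, rn (y - z) < d -> rn (Phi y - Phi z) < e.
Proof.
move=> zr; have d0 : 0 < r - rn (iter m F z) by rewrite subr_gt0.
have [d d1 Fd] := entire_continuous z (entire_iter m Fe) d0.
have near y : rn (y - z) < d -> rn (iter m F y) < r.
  by move=> /Fd H; rewrite (le_lt_trans (rn_leD _ (iter m F z))) // -ltrBrDr.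
apply: (@approx_continuous _ _ _ _ z (d / 2)); first by rewrite divr_gt0.
move=> i; apply: approx_lim => e /(Phi_approx m) [G Ge GP].
exists (fun z => G z 0 i) => [|y yz].
  by apply: approx_sub (Ge i (d / 2 + rn z)) => y; rewrite cball0; exact: cball_bounded.
have := coord_le_rn (Phi y - G y) i; rewrite !mxE => /le_trans; apply.
by apply: GP; apply: near; apply: le_lt_trans yz _; lra.
Qed.

(** [phi n] and [psin n] are exact inverses. [Phi (psin n w)] tends to [Phi (psis w)] by continuity,
    and to [w] because [Phi] is uniformly close to [phi n]. *)
Let Phi_psis w : rn w <= sg -> Phi (psis w) = w.
Proof.
move=> ws; have pr : rn (iter 0 F (psis w)) < r by exact: le_lt_trans (psis_le ws) sgr.
have := conv_comp (Phi_continuous pr) (psis_conv ws) => H1.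
apply: conv_unique H1 _.
apply: (conv_geometric (A := 2 * (lam ^- 0 * K) / (1 - q)) q0 q1) => n.
have pr' : rn (iter 0 F (psin n w)) <= r.
  by apply: ltW; exact: le_lt_trans (psin_le n ws) sgr.
have phiK : phi n (psin n w) = w by rewrite /phi /psin iteriK iterAK.
by have := Phi_geo n pr'; rewrite addn0 rnBC phiK.
Qed.

Let phi_AI n y : iter n A (phi n y) = iter n F y.
Proof. by rewrite /phi iterAiK. Qed.

Let psi_r m w : lam ^+ m * rn w <= sg -> rn (iter m F (psi w)) < r.
Proof.
move=> mw; rewrite (psiE mw) iteriK.
by apply: le_lt_trans sgr; apply: psis_le; rewrite AnI0.
Qed.

Let PhiK w : Phi (psi w) = w.
Proof.
have [m mw] := small_ex w.
have := Phi_FI m (ltW (psi_r mw)); rewrite {1}(psiE mw) iteriK Phi_psis ?AnI0 //.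
by move=> /(congr1 (iter m Ai)); rewrite !iterAK.
Qed.

(** The mirror image of [Phi_psis]; the bound [sg / 2] leaves room for [phi n x] to lie in the ball
    where [psin] converges. *)
Let psis_Phi x : rn x <= r -> rn (Phi x) <= sg / 2 -> psis (Phi x) = x.
Proof.
move=> xr Px; have Px' : rn (Phi x) < sg by apply: le_lt_trans Px _; have := sg0; lra.
have phis : conv (phi ^~ x) (Phi x) by exact: (PhiP (m := 0) xr).
have psc : forall e : R, 0 < e -> exists2 d : R, 0 < d &
    forall y, rn (y - Phi x) < d -> rn (psis y - psis (Phi x)) < e.
  apply: (@approx_continuous _ _ _ _ _ (sg / 2)); first by rewrite divr_gt0.
  move=> i; apply: approx_sub (psis_approx i) => y /cball_bounded; rewrite cball0.
  by have := sg0; lra.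
apply: conv_unique (conv_comp psc phis) _ => e e0.
have [N NP] := geometric_small (2 * K2 / (1 - lam)) (ltW lam0) lam1 e0.
have s2 : 0 < sg / 2 by rewrite divr_gt0.
have [N' NP'] := phis _ s2.
exists (N + N')%N => n Nn.
have ps : rn (phi n x) <= sg.
  rewrite (le_trans (rn_leD _ (Phi x))) //.
  by have := NP' n; rewrite (leq_trans (leq_addl _ _) Nn) => /(_ isT); lra.
have := psis_geo n ps; rewrite {1}/psin phi_AI iterK rnBC => /le_trans; apply.
by apply: NP; rewrite (leq_trans (leq_addr _ _) Nn).
Qed.

Let psiK z m : rn (iter m F z) < r -> psi (Phi z) = z.
Proof.
move=> zr; have s2 : 0 < sg / 2 by rewrite divr_gt0.
have [N NP] := geometric_small (rn (Phi z)) (ltW lam0) lam1 s2.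
(* [n >= m] puts [F^n z] in the ball of radius [r]; [n >= N] makes its image under [Phi] small
   enough for [psis_Phi]. *)
pose n := (N + m)%N.
have Pn : rn (iter n A (Phi z)) <= sg / 2.
  by rewrite AnI0 mulrC NP // /n leq_addr.
have nr : rn (iter n F z) <= r.
  rewrite /n iterD (le_trans (contrI N (ltW zr))) // (le_trans _ (ltW zr)) //.
  by rewrite ler_piMl ?rn_ge0 // exprn_ile1 // ltW.
rewrite (@psiE n) -?AnI0; last by have := s2; lra.
by rewrite -(Phi_FI n (ltW zr)) psis_Phi ?iterK // (Phi_FI n (ltW zr)).
Qed.

Lemma fb_map_section : exists psi Phi, fb_map F psi Phi r mu.
Proof.
exists psi, Phi; split=> //; exact: ltW.
Qed.

End FatouBieberbach.

Theorem fb_map_exists (R : realType) k (F Fi A Ai : Ck R k -> Ck R k) (lam c s : R) :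
  0 < lam -> lam < 1 -> 0 <= c -> 0 < s ->
  entire F -> entire Fi -> entire A -> entire Ai ->
  cancel F Fi -> cancel Fi F -> cancel A Ai -> cancel Ai A ->
  {morph A : x y / x - y} -> {morph Ai : x y / x - y} ->
  (forall x, rn (A x) = lam * rn x) ->
  (forall z, rn z <= s -> rn (F z - A z) <= c * rn z ^+ 2) ->
  (forall z, rn z <= s -> rn (Fi z - Ai z) <= c * rn z ^+ 2) ->
  exists psi Phi r mu, fb_map F psi Phi r mu.
Proof.
move=> l0 l1 c0 s0 Fe Fie Ae Aie FK FiK AK AiK AB AiB An FA FiAi.
have [mu mu2 lmu] := contraction_rate l0 l1.
have c1 : 0 < c + 1 by rewrite ltr_wpDl.
(* On this ball [lam * rn z + c * rn z ^ 2 <= mu * rn z]; the denominator [c + 1] covers the case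
   [c = 0]. *)
pose r := Num.min s ((mu - lam) / (c + 1)).
have r0 : 0 < r by rewrite lt_min s0 divr_gt0 ?subr_gt0.
have rs : r <= s by rewrite ge_min lexx.
have rc : c * r <= mu - lam.
  have : r <= (mu - lam) / (c + 1) by rewrite ge_min lexx orbT.
  by rewrite ler_pdivlMr //; have := ltW r0; nra.
pose sg := Num.min (r / 10) ((1 - lam) / (52 * (c + 1))).
have c52 : 0 < 52 * (c + 1) by rewrite mulr_gt0.
have sg0 : 0 < sg by rewrite lt_min !divr_gt0 // subr_gt0.
have sgr : 10 * sg <= r.
  have : sg <= r / 10 by rewrite ge_min lexx.
  by lra.
have sgc : 52 * c * sg <= 1 - lam.
  have : sg <= (1 - lam) / (52 * (c + 1)) by rewrite ge_min lexx orbT.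
  by rewrite ler_pdivlMr //; nra.
have [||psi [Phi H]] := fb_map_section l0 l1 c0 s0 Fe Fie Ae Aie FK FiK AK AiK AB AiB An
  FA FiAi mu2 lmu r0 rs rc sg0 _ sgc; [by lra|by lra|].
by exists psi, Phi, r, mu.
Qed.

(** * Elimination in codimension two *)

(** The ring [F[x_0]...[x_(n-1)]]. A further variable [w] is kept apart, in [{poly iterpoly F n}],
    because division is carried out with respect to [w] over the fraction field of this ring. *)
Fixpoint iterpoly (F : idomainType) (n : nat) : idomainType :=
  if n is m.+1 then {poly (iterpoly F m)} else F.

Fixpoint iterev (F : idomainType) n (x : nat -> F) : {rmorphism iterpoly F n -> F} :=
  match n return {rmorphism iterpoly F n -> F} with
  | 0 => idfun
  | m.+1 => horner_eval (x m) \o map_poly (iterev m x)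
  end.

Fixpoint iterC (F : idomainType) n : {rmorphism F -> iterpoly F n} :=
  match n return {rmorphism F -> iterpoly F n} with
  | 0 => idfun
  | m.+1 => polyC \o iterC F m
  end.

Definition lastev (F : idomainType) n (x : nat -> F) (w : F) :
    {rmorphism {poly iterpoly F n} -> F} :=
  horner_eval w \o map_poly (iterev n x).

(** Restriction to the hyperplane [x_n = c]; the variable [w] is untouched. *)
Definition slice (F : idomainType) n (c : F) :
    {rmorphism {poly iterpoly F n.+1} -> {poly iterpoly F n}} :=
  map_poly (horner_eval (iterC F n c)).

Arguments lastev {F} n x w.
Arguments slice {F} n c.

Definition upd (T : Type) (x : nat -> T) n c : nat -> T :=
  fun j => if j == n then c else x j.

Section IterPoly.
Variable F : numFieldType.

Lemma iterevC n (x : nat -> F) c : iterev n x (iterC F n c) = c.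
Proof. by elim: n => //= n IH; rewrite /horner_eval map_polyC hornerC. Qed.

Lemma iterev_eq n (x y : nat -> F) p :
  (forall j, (j < n)%N -> x j = y j) -> iterev n x p = iterev n y p.
Proof.
elim: n p => //= n IH p xy; rewrite /horner_eval xy //.
congr (_.[_]); apply/polyP => i; rewrite !coef_map /=.
by apply: IH => j jn; apply: xy; rewrite ltnS ltnW.
Qed.

Lemma iterevS n (x : nat -> F) (p : iterpoly F n.+1) :
  iterev n.+1 x p = (map_poly (iterev n x) p).[x n].
Proof. by []. Qed.

Lemma map_iterev_upd n (x : nat -> F) c (p : {poly iterpoly F n}) :
  map_poly (iterev n (upd x n c)) p = map_poly (iterev n x) p.
Proof.
apply/polyP => i; rewrite !coef_map /=; apply: iterev_eq => j jn.
by rewrite /upd ltn_eqF.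
Qed.

Lemma iterev_horner n (x : nat -> F) (p : iterpoly F n.+1) c :
  iterev n x (p : {poly _}).[iterC F n c] = iterev n.+1 (upd x n c) p.
Proof.
rewrite iterevS map_iterev_upd -horner_map /= iterevC.
by rewrite /upd eqxx.
Qed.

Lemma poly_nonroot (p : {poly F}) : p != 0 -> exists x, p.[x] != 0.
Proof.
move=> p0; apply/not_existsP => H.
have := @max_poly_roots F p [seq i%:R | i <- iota 0 (size p)] p0.
rewrite size_map size_iota ltnn => /(_ _ _)/negP []//.
  by apply/allP => x _; have /negP := H x; rewrite negbK.
by rewrite map_inj_uniq ?iota_uniq // => i j /eqP; rewrite eqr_nat => /eqP.
Qed.

(** Induction on the leading coefficient in the outermost variable; the remaining univariate
    polynomial is nonzero over an infinite field. *)
Lemma iterev_neq0 n (p : iterpoly F n) : p != 0 -> exists x, iterev n x p != 0.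
Proof.
elim: n p => [p p0|n IH p p0]; first by exists (fun=> 0).
have /IH [x lx] : lead_coef (p : {poly _}) != 0 by rewrite lead_coef_eq0.
have /poly_nonroot [w pw] : map_poly (iterev n x) p != 0.
  by rewrite map_poly_eq0_id0.
by exists (upd x n w); rewrite iterevS map_iterev_upd /upd eqxx.
Qed.

Lemma lastev_slice n (x : nat -> F) w c (P : {poly iterpoly F n.+1}) :
  lastev n x w (slice n c P) = lastev n.+1 (upd x n c) w P.
Proof.
apply: (congr1 (horner_eval w)); apply/polyP => i; rewrite !coef_map.
exact: (iterev_horner x P`_i c).
Qed.

End IterPoly.

(* The divisibility of [polydiv] over an integral domain is divisibility over
   its field of fractions, so [q] is an irreducible factor over that field. *)
Lemma common_irreducible_factor (A : idomainType) (I : {poly A} -> Prop) :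
  (forall P Q, I P -> I Q -> I (P - Q)) -> (forall P Q, I P -> I (Q * P)) ->
  (forall P, I P -> (size P <= 1)%N -> P = 0) ->
  exists q : {poly A}, [/\ (1 < size q)%N, (forall P, I P -> q %| P) &
    forall P, ~~ (q %| P) -> coprimep q P].
Proof.
move=> IB IM I1.
pose good (q : {poly A}) := (1 < size q)%N /\ forall P, I P -> q %| P.
(* [I] is principal over the fraction field: pseudo-division by an element of least size leaves
   remainders in [I]. When [I] is zero, any nonconstant polynomial such as ['X] serves. *)
have [q0 gq0] : exists q, good q.
  have [[f [If f0]]|noI] := pselect (exists f, I f /\ f != 0); last first.
    exists 'X; split=> [|P IP]; first by rewrite size_polyX.
    by have [->|P0] := eqVneq P 0; [rewrite dvdp0|case: noI; exists P].
  pose s n := `[< exists f, [/\ I f, f != 0 & size f = n] >].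
  have exs : exists n, s n by exists (size f); apply/asboolP; exists f.
  case: (ex_minnP exs) => n /asboolP [g [Ig g0 gn]] nmin.
  exists g; split.
    by rewrite ltnNge; apply: contraNN g0 => /(I1 _ Ig) ->.
  move=> P IP; apply/modp_eq0P/eqP; apply: contraT => r0.
  have Ir : I (P %% g).
    have -> : P %% g = (lead_coef g ^+ scalp P g)%:P * P - (P %/ g) * g.
      by rewrite mul_polyC Pdiv.Idomain.divp_eq addrAC subrr add0r.
    by apply: IB; apply: IM.
  have /nmin : s (size (P %% g)) by apply/asboolP; exists (P %% g).
  by rewrite -gn leqNgt ltn_modp g0.
(* A common divisor of least size is irreducible: a nonconstant gcd of [q] with some [P] is again a
   common divisor, hence associate to [q]. *)
pose s n := `[< exists q, good q /\ size q = n >].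
have exs : exists n, s n by exists (size q0); apply/asboolP; exists q0.
case: (ex_minnP exs) => n /asboolP [q [[q1 Iq] qn]] nmin.
exists q; split=> // P; apply: contraNT => ncop.
have q_neq0 : q != 0 by rewrite -size_poly_gt0 ltnW.
have g0 : gcdp q P != 0 by rewrite gcdp_eq0 negb_and q_neq0.
have sg : (1 < size (gcdp q P))%N.
  rewrite ltn_neqAle size_poly_gt0 g0 andbT eq_sym; exact: ncop.
have /nmin : s (size (gcdp q P)).
  apply/asboolP; exists (gcdp q P); split=> //; split=> // Q IQ.
  exact: dvdp_trans (dvdp_gcdl _ _) (Iq _ IQ).
rewrite -qn => le_q.
have : gcdp q P %= q.
  by rewrite -dvdp_size_eqp ?dvdp_gcdl // eqn_leq le_q dvdp_leq // dvdp_gcdl.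
by move=> /eqp_dvdl <-; rewrite dvdp_gcdr.
Qed.

Lemma lastevC (F : numFieldType) n (x : nat -> F) w (d : iterpoly F n) :
  lastev n x w d%:P = iterev n x d.
Proof. by rewrite /lastev /= /horner_eval map_polyC hornerC. Qed.

Lemma lastevZ (F : numFieldType) n (x : nat -> F) w d (P : {poly iterpoly F n}) :
  lastev n x w (d *: P) = iterev n x d * lastev n x w P.
Proof. by rewrite -mul_polyC rmorphM /= -(lastevC x w). Qed.

(** Bezout over the fraction field gives a combination of [q] and [h] equal to a nonzero [d] free of
    [w]. At an [x] where [d] and the leading coefficient of [q] do not vanish, [q] has a root [w],
    and [h] cannot vanish there. Pseudo-division only multiplies by powers of that leading
    coefficient, so all multiples of [q] vanish. *)
Lemma generic_zero (F : numClosedFieldType) n (q h : {poly iterpoly F n}) :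
  (1 < size q)%N -> coprimep q h ->
  exists x w, lastev n x w h != 0 /\
    forall P, q %| P -> lastev n x w P = 0.
Proof.
move=> q1 /Pdiv.Idomain.Bezout_coprimepP [u].
rewrite -size_poly_eq1 => /size_poly1P [d d0 Ed].
have /iterev_neq0 [x] : d * lead_coef q != 0.
  by rewrite mulf_neq0 // lead_coef_eq0 -size_poly_gt0 ltnW.
rewrite rmorphM mulf_eq0 negb_or => /andP [xd xq].
have [w qw] : exists w, root (map_poly (iterev n x) q) w.
  by apply/closed_rootP; rewrite size_map_poly_id0 // gtn_eqF.
have qw0 : lastev n x w q = 0 by apply/eqP; exact: qw.
exists x, w; split.
  apply: contraNneq xd => hw.
  by rewrite -(lastevC x w) -Ed rmorphD !rmorphM hw qw0 !mulr0 addr0.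
move=> P /modp_eq0P r0.
have := Pdiv.Idomain.divp_eq P q; rewrite r0 addr0 => /(congr1 (lastev n x w)).
rewrite lastevZ rmorphM qw0 mulr0 rmorphXn => /eqP.
by rewrite mulf_eq0 expf_eq0 (negbTE xq) andbF => /eqP.
Qed.

(** * Chains of irreducible sets from polynomial ideals *)

Section AlgebraicChains.
Variables (R : realType) (k : nat).
Local Notation C := (R[i] : numClosedFieldType).

(** A polynomial parametrisation by [n] parameters and [w]. That the parameters come from polynomial
    functions on [C^k] serves to tell a slice from the set it cuts. *)
Definition chart n (pt : (nat -> C) -> C -> Ck R k) : Prop :=
  (forall f : Ck R k -> R[i], polyfun f -> exists P : {poly iterpoly C n},
    forall x w, f (pt x w) = lastev n x w P) /\
  (forall j, (j < n)%N -> exists2 f : Ck R k -> R[i], polyfun f &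
    forall x w, f (pt x w) = x j).

(** The Zariski closure of the generic part of [q = 0]: divisibility over the fraction field
    discards components on which only coefficients vanish. *)
Definition zeros n (pt : (nat -> C) -> C -> Ck R k) (q : {poly iterpoly C n}) :
    set (Ck R k) :=
  [set z | forall f, polyfun f -> forall P,
     (forall x w, f (pt x w) = lastev n x w P) -> q %| P -> f z = 0].

Lemma zeros_chart n pt (q : {poly iterpoly C n}) x w :
  (forall P, q %| P -> lastev n x w P = 0) -> zeros pt q (pt x w).
Proof. by move=> qP f fp P fP /qP; rewrite fP. Qed.

(** If neither algebraic set contained [zeros pt q], each would have an equation not divisible by
    [q], hence coprime to it; a generic zero of [q] at which the product of the two is nonzero lies
    in neither. *)
Lemma irreducible_zeros n pt (q : {poly iterpoly C n}) : chart n pt ->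
  (1 < size q)%N -> (forall P, ~~ (q %| P) -> coprimep q P) ->
  irreducible_alg (zeros pt q).
Proof.
move=> [cpt _] q1 qprime; split.
- exists [set f | polyfun f /\ exists2 P,
     (forall x w, f (pt x w) = lastev n x w P) & q %| P]; split.
    by move=> f [].
  apply/seteqP; split=> z zz f.
    by move=> [fp [P fP qP]]; apply: (zz _ fp P).
  by move=> fp P fP qP; apply: zz; split=> //; exists P.
- have [|x [w [_ xw]]] := @generic_zero C n q 1 q1; first exact: coprimep1.
  by exists (pt x w); apply: zeros_chart.
move=> _ _ [SA [SAp ->]] [SB [SBp ->]] zAB.
apply: contrapT => /not_orP [nA nB].
have wit S : (forall p, S p -> polyfun p) ->
    ~ zeros pt q `<=` [set z | forall p : Ck R k -> R[i], S p -> p z = 0] ->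
    exists2 f : Ck R k -> R[i], S f & exists2 P,
      (forall x w, f (pt x w) = lastev n x w P) & coprimep q P.
  move=> Sp /existsNP [z /not_implyP [zz /existsNP [f /not_implyP [Sf fz]]]].
  exists f => //; have [P fP] := cpt _ (Sp _ Sf).
  exists P => //; apply: qprime; apply/negP => qP; apply: fz.
  exact: (zz _ (Sp _ Sf) P).
have [f Sf [P fP qP]] := wit _ SAp nA.
have [g Sg [Q gQ qQ]] := wit _ SBp nB.
have [|x [w [PQ xw]]] := @generic_zero C n q (P * Q) q1.
  by rewrite coprimepMr qP.
move: PQ; rewrite rmorphM mulf_eq0 negb_or => /andP[].
have [/(_ _ Sf) A0|/(_ _ Sg) B0] := zAB _ (zeros_chart (pt := pt) xw).
- by rewrite -fP A0 eqxx.
- by rewrite -gQ B0 eqxx.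
Qed.

Lemma chart_slice n pt c :
  chart n.+1 pt -> chart n (fun x w => pt (upd x n c) w).
Proof.
move=> [cpt xpt]; split=> [f /cpt [P fP]|j jn].
  by exists (slice n c P) => x w; rewrite fP lastev_slice.
have [|f fp fx] := xpt j; first by rewrite ltnS ltnW.
by exists f => // x w; rewrite fx /upd ltn_eqF.
Qed.

Lemma slice_polyC n (c : C) (d : iterpoly C n.+1) :
  slice n c d%:P = ((d : {poly _}).[iterC C n c])%:P.
Proof. by rewrite /slice /= map_polyC. Qed.

(* An ideal with no nonzero constants keeps this property on almost every slice. *)
Lemma irreducible_chain n pt (I : {poly iterpoly C n} -> Prop) : chart n pt ->
  (forall P Q, I P -> I Q -> I (P - Q)) -> (forall P Q, I P -> I (Q * P)) ->
  (forall P, I P -> (size P <= 1)%N -> P = 0) ->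
  exists Z : nat -> set (Ck R k),
    [/\ forall i, (i <= n)%N -> irreducible_alg (Z i),
        forall i, (i < n)%N -> Z i `<` Z i.+1 &
        forall f, polyfun f -> forall P, (forall x w, f (pt x w) = lastev n x w P) ->
          I P -> Z n `<=` [set z | f z = 0]].
Proof.
elim: n pt I => [|n IH] pt I cpt IB IM I1;
  have [q [q1 qI qprime]] := common_irreducible_factor IB IM I1.
  exists (fun=> zeros pt q); split=> //.
  - by move=> i _; apply: irreducible_zeros.
  - by move=> f fp P fP IP z /(_ f fp P fP (qI _ IP)).
have q0 : q != 0 by rewrite -size_poly_gt0 ltnW.
(* The slice must keep the degree of [q] in [w], so that its multiples include no nonzero
   constant. *)
have [c lc] : exists c, (lead_coef q : {poly _}).[iterC C n c] != 0.
  have /iterev_neq0 [x] : (lead_coef q : iterpoly C n.+1) != 0.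
    by rewrite lead_coef_eq0.
  move=> lx; exists (x n); apply: contraNneq lx => l0.
  have -> : x = upd x n (x n).
    by apply/funext => j; rewrite /upd; case: eqP => [->|].
  by rewrite -iterev_horner l0 rmorph0.
pose pt' x w := pt (upd x n c) w.
(* The induction runs on the ideal of the hypersurface [q = 0] restricted to the slice, which puts
   the smaller chain inside [zeros pt q]. *)
pose I' P := exists2 Q, q %| Q & P = slice n c Q.
have cpt' : chart n pt' by exact: chart_slice.
have slice_dvd Q : q %| Q -> slice n c q %| slice n c Q.
  move=> /modp_eq0P r0; have := Pdiv.Idomain.divp_eq Q q.
  rewrite r0 addr0 => /(congr1 (slice n c)).
  rewrite -mul_polyC !rmorphM slice_polyC mul_polyC => /(esym) E.
  apply: (Pdiv.Idomain.eq_dvdp _ (esym E)).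
  by rewrite horner_exp expf_neq0.
have sq : size (slice n c q) = size q by rewrite /slice size_map_poly_id0.
have [|||Z [Zirr Zlt Ztop]] := IH pt' I' cpt'.
- move=> _ _ [P qP ->] [Q qQ ->]; exists (P - Q); last by rewrite rmorphB.
  by rewrite dvdp_sub.
- move=> _ Q [P qP ->]; exists (map_poly polyC Q * P); first by rewrite dvdp_mull.
  rewrite rmorphM; congr (_ * _); apply/polyP => i.
  by rewrite !coef_map /= /horner_eval hornerC.
- move=> _ [P /slice_dvd qP ->] P1; apply/eqP; apply: contraTT P1 => P0.
  by rewrite -ltnNge (leq_trans q1) // -sq dvdp_leq.
exists (fun i => if (i <= n)%N then Z i else zeros pt q); split.
- move=> i _; case: leqP => [/Zirr //|_]; exact: irreducible_zeros.
- move=> i; rewrite ltnS => ile; have : i = n \/ (i < n)%N by lia.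
  case=> [->|iltn]; last by rewrite (ltnW iltn) iltn; apply: Zlt.
  rewrite /= leqnn ltnn; split.
    move=> z Zz f fp P fP qP.
    apply: (Ztop f fp (slice n c P)) => //; last by exists P.
    by move=> x w; rewrite /pt' fP lastev_slice.
  (* The inclusion is strict: [x_n - c] vanishes on the slice but, being nonzero and free of [w], is
     not divisible by [q]. *)
  move=> zZ; have [f fp fx] := cpt.2 n (leqnn _).
  pose g := fun z : Ck R k => f z + (- c).
  have gp : polyfun g by apply: polyfun_add => //; exact: polyfun_const.
  pose Xc : iterpoly C n.+1 := ('X - (iterC C n c)%:P).
  have gE x w : g (pt x w) = lastev n.+1 x w (Xc%:P).
    rewrite /g fx lastevC iterevS /Xc rmorphB /= map_polyX map_polyC /= iterevC.
    by rewrite hornerXsubC.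
  have [|x [w [xc xw]]] := @generic_zero C n.+1 q Xc%:P q1.
    apply: qprime; apply/negP => /(dvdp_leq _).
    rewrite polyC_eq0 polyXsubC_eq0 /= => /(_ isT); rewrite leqNgt.
    by rewrite (leq_ltn_trans _ q1) // size_polyC_leq1.
  move: xc; rewrite -gE => /eqP; apply.
  apply: (Ztop g gp (slice n c Xc%:P)) => //.
  - by move=> y v; rewrite /pt' gE lastev_slice.
  - exists 0; rewrite ?dvdp0 // rmorph0 slice_polyC hornerXsubC subrr.
    by rewrite polyC0.
  - exact/zZ/zeros_chart.
- by rewrite /= ltnn => f fp P fP IP z /(_ f fp P fP (qI _ IP)).
Qed.

End AlgebraicChains.

Lemma iterpoly_var (F : numFieldType) n j : (j < n)%N ->
  exists v : iterpoly F n, forall x, iterev n x v = x j.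
Proof.
elim: n => // n IH; rewrite ltnS leq_eqVlt => /orP[/eqP ->|/IH [v vE]].
  by exists 'X => x; rewrite iterevS map_polyX hornerX.
by exists (v%:P) => x; rewrite iterevS map_polyC hornerC /= vE.
Qed.

(** * Eliminating one coordinate *)

Section Elimination.
Variables (R : realType) (n : nat) (i : 'I_n.+1).
Local Notation C := R[i].

Definition cons_coord (x : nat -> C) (w : C) : Ck R n.+1 :=
  \row_j (if unlift i j is Some l then x l else w).

Definition drop_coord (z : Ck R n.+1) (j : nat) : C :=
  if insub j is Some l then z 0 (lift i l) else 0.

Definition upd_coord (z : Ck R n.+1) (w : C) : Ck R n.+1 :=
  \row_j (if j == i then w else z 0 j).

Lemma cons_drop z : cons_coord (drop_coord z) (z 0 i) = z.
Proof.
apply/rowP => j; rewrite mxE; case: unliftP => [l ->|-> //].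
by rewrite /drop_coord valK.
Qed.

Lemma drop_upd z w : drop_coord (upd_coord z w) = drop_coord z.
Proof.
apply/funext => j; rewrite /drop_coord; case: insubP => //= l _ _.
by rewrite mxE eq_sym (negbTE (neq_lift _ _)).
Qed.

Lemma drop_cons x w j : (j < n)%N -> drop_coord (cons_coord x w) j = x j.
Proof. by move=> jn; rewrite /drop_coord insubT mxE liftK. Qed.

Lemma chart_cons : chart n cons_coord.
Proof.
split=> [f|j jn]; last first.
  exists (fun z : Ck R n.+1 => z 0 (lift i (Ordinal jn))).
    exact: polyfun_coord.
  by move=> x w; rewrite mxE liftK.
elim=> [c|j|f1 f2 _ [P1 E1] _ [P2 E2]|f1 f2 _ [P1 E1] _ [P2 E2]].
- by exists (iterC (C : numFieldType) n c)%:P => x w; rewrite lastevC iterevC.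
- case: (unliftP i j) => [l ->|->].
    have [v vE] := iterpoly_var C (ltn_ord l).
    by exists v%:P => x w; rewrite lastevC mxE liftK vE.
  by exists 'X => x w; rewrite mxE unlift_none /lastev /= map_polyX /horner_eval hornerX.
- by exists (P1 + P2) => x w; rewrite E1 E2 rmorphD.
- by exists (P1 * P2) => x w; rewrite E1 E2 rmorphM.
Qed.

Lemma polyfun_iterev m (y : nat -> Ck R n.+1 -> C) (p : iterpoly C m) :
  (forall j, polyfun (y j)) -> polyfun (fun z => iterev m (fun j => y j z) p).
Proof.
move=> yp; elim: m p => [p|m IH p]; first exact: polyfun_const.
elim/poly_ind: p => [|p c IHp].
  rewrite (_ : (fun _ => _) = fun=> 0); first exact: polyfun_const.
  by apply/funext => z; rewrite rmorph0.
rewrite (_ : (fun _ => _) = fun z =>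
  iterev m.+1 (fun j => y j z) p * y m z + iterev m (fun j => y j z) c).
  by apply: polyfun_add => //; apply: polyfun_mul.
apply/funext => z; rewrite rmorphD rmorphM.
congr (_ * _ + _); rewrite iterevS; first by rewrite map_polyX hornerX.
by rewrite map_polyC hornerC.
Qed.

(** In the ideal of [V], viewed as polynomials in [w = z_i] over the other coordinates, a nonzero
    element of degree 0 is the polynomial sought. Without one, [irreducible_chain] produces [n + 1]
    nested irreducible sets inside [V], against the dimension. *)
Lemma elimination_polynomial (V : set (Ck R n.+1)) : algebraic_set V ->
  ~ alg_dim_ge V n ->
  exists r : Ck R n.+1 -> C, [/\ polyfun r, (exists z, r z != 0),
    (forall z, V z -> r z = 0) & (forall z w, r (upd_coord z w) = r z)].
Proof.
move=> [S [Sp VE]] nV.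
pose I (P : {poly iterpoly (C : numClosedFieldType) n}) :=
  forall x w, V (cons_coord x w) -> lastev n x w P = 0.
have IB P Q : I P -> I Q -> I (P - Q).
  by move=> IP IQ x w Vx; rewrite rmorphB IP ?IQ ?subrr.
have IM P Q : I P -> I (Q * P).
  by move=> IP x w Vx; rewrite rmorphM IP ?mulr0.
have [|noconst] := pselect (exists P, [/\ I P, (size P <= 1)%N & P != 0]); last first.
  exfalso; apply: nV.
  have [|Z [Zirr Zlt Ztop]] := irreducible_chain chart_cons IB IM.
    move=> P IP P1; apply/eqP; apply: contra_notT noconst => P0.
    by exists P.
  exists Z; split=> // z Zz; rewrite VE => f Sf.
  have [P fP] := chart_cons.1 _ (Sp _ Sf).
  apply: (Ztop f (Sp _ Sf) P fP) => // x w; rewrite VE => /(_ _ Sf).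
  by rewrite fP.
case=> P [IP /size1_polyC PE P0]; rewrite {}PE in IP P0.
move: (P`_0) IP P0 => d; rewrite polyC_eq0 => Id /iterev_neq0 [x dx].
exists (fun z => iterev n (drop_coord z) d); split.
- apply: (polyfun_iterev (y := fun j z => drop_coord z j)) => j.
  rewrite /drop_coord; case: insubP => [l _ _|_]; first exact: polyfun_coord.
  exact: polyfun_const.
- exists (cons_coord x 0); apply: contraNneq dx => <-; apply/eqP.
  by apply: iterev_eq => j jn; rewrite drop_cons.
- by move=> z Vz; rewrite -(lastevC _ (z 0 i)) Id // cons_drop.
- by move=> z w; rewrite drop_upd.
Qed.

End Elimination.

(** On the line through two points where [f], respectively [g], is nonzero, both become nonzero
    univariate polynomials. *)
Lemma polyfun_common_nonzero (R : realType) k (f g : Ck R k -> R[i]) :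
  polyfun f -> polyfun g -> (exists z, f z != 0) -> (exists z, g z != 0) ->
  exists z, f z * g z != 0.
Proof.
move=> fp gp [a fa] [b gb].
have [p pE] := polyfun_line a (b - a) fp.
have [q qE] := polyfun_line a (b - a) gp.
have p0 : p != 0.
  by apply: contraNneq fa => p0; rewrite -[a]addr0 -(scale0r (b - a)) pE p0 horner0.
have q0 : q != 0.
  apply: contraNneq gb => q0.
  by rewrite -[b](subrK a) addrC -(scale1r (b - a)) qE q0 horner0.
have [t tpq] := poly_nonroot (mulf_neq0 p0 q0).
by exists (a + t *: (b - a)); rewrite pE qE -hornerM.
Qed.

Lemma codim2_elimination (R : realType) n (V : set (Ck R n.+1)) :
  algebraic_set V -> ~ alg_dim_ge V n ->
  exists (r : 'I_n.+1 -> Ck R n.+1 -> R[i]) (p : Ck R n.+1), forall i,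
    [/\ polyfun (r i), r i p != 0, (forall z, V z -> r i z = 0) &
      (forall z w, r i (upd_coord i z w) = r i z)].
Proof.
move=> Valg Vdim.
have /choice [r rP] := fun i => elimination_polynomial i Valg Vdim.
suff [p pP] : exists p, forall i, r i p != 0.
  by exists r, p => i; have [? ? ? ?] := rP i.
suff H (s : seq 'I_n.+1) : exists2 g : Ck R n.+1 -> R[i], polyfun g & (exists z, g z != 0) /\
    forall z, g z != 0 -> forall i, i \in s -> r i z != 0.
  have [g _ [[z gz] gr]] := H (enum 'I_n.+1).
  by exists z => i; apply: gr; rewrite ?mem_enum.
elim: s => [|i s [g gp [gz gr]]].
  exists (fun=> 1); first exact: polyfun_const.
  by split=> //; exists 0; exact: oner_neq0.
have [rp rz _ _] := rP i.
exists (fun z => r i z * g z); first exact: polyfun_mul.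
split; first exact: polyfun_common_nonzero.
move=> z; rewrite mulf_eq0 negb_or => /andP[riz /gr gs] j.
by rewrite inE => /orP[/eqP ->|/gs].
Qed.

(** * Overshears *)

Section ComplexExponential.
Variable R : realType.
Local Notation C := R[i].

Lemma one_plus_pow_le (x : R) N : 0 <= x -> (0 < N)%N -> (1 + x / N%:R) ^+ N <= expR x.
Proof.
move=> x0 N0; have -> : expR x = expR (x / N%:R) ^+ N.
  by rewrite -expRM_natl mulrC divfK // pnatr_eq0 -lt0n.
by rewrite ler_pXn2r ?nnegrE ?expR_ge0 ?addr_ge0 ?divr_ge0 // expR_ge1Dx.
Qed.

Lemma rn_expB (a b : C) (m : R) N : 1 <= m -> rn a <= m -> rn b <= m ->
  rn (a ^+ N - b ^+ N) <= N%:R * rn (a - b) * m ^+ N.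
Proof.
move=> m1 am bm; have m0 : 0 <= m by exact: le_trans ler01 m1.
elim: N => [|N IH]; first by rewrite subrr rn0 !mul0r.
have -> : a ^+ N.+1 - b ^+ N.+1 = a * (a ^+ N - b ^+ N) + (a - b) * b ^+ N.
  by rewrite !exprS; ring.
rewrite (le_trans (rnD _ _)) // !rnM rnX.
have H1 : rn a * rn (a ^+ N - b ^+ N) <= m * (N%:R * rn (a - b) * m ^+ N).
  by rewrite ler_pM ?rn_ge0.
have H2 : rn (a - b) * rn b ^+ N <= rn (a - b) * m ^+ N.+1.
  rewrite ler_wpM2l ?rn_ge0 // (@le_trans _ _ (m ^+ N)) //.
    by rewrite lerXn2r ?nnegrE ?rn_ge0.
  by rewrite ler_weXn2l.
rewrite (le_trans (lerD H1 H2)) // -natr1 exprS.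
by rewrite le_eqVlt; apply/orP; left; apply/eqP; ring.
Qed.

(** Euler's limit along powers of two: consecutive terms compare through [(1 + t / 2N)^2 - (1 + t /
    N) = (t / 2N)^2]. *)
Definition expn_approx n (t : C) : C := (1 + t / (2 ^ n)%:R) ^+ (2 ^ n).

Let B (r : R) := r ^+ 2 / 4 * expR r.
Let B0 r : 0 <= B r.
Proof. by rewrite /B mulr_ge0 ?expR_ge0 // divr_ge0 // sqr_ge0. Qed.

Let half_pow n : ((2 ^ n)%:R : R)^-1 = 2^-1 ^+ n.
Proof. by rewrite natrX exprVn. Qed.

Lemma expn_approx_bound n (t : C) (r : R) : rn t <= r -> rn (expn_approx n t) <= expR r.
Proof.
move=> tr; have r0 : 0 <= r := le_trans (rn_ge0 _) tr.
have N0 : (0 < 2 ^ n)%N by rewrite expn_gt0.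
rewrite rnX (le_trans _ (one_plus_pow_le r0 N0)) //.
rewrite lerXn2r ?nnegrE ?rn_ge0 ?addr_ge0 ?divr_ge0 //.
by rewrite (le_trans (rnD _ _)) // rn1 lerD2l rnM rnV rn_nat ler_wpM2r ?invr_ge0.
Qed.

Lemma expn_approx_step n (t : C) (r : R) : rn t <= r ->
  rn (expn_approx n.+1 t - expn_approx n t) <= B r * 2^-1 ^+ n.
Proof.
move=> tr; have r0 : 0 <= r := le_trans (rn_ge0 _) tr.
rewrite /expn_approx expnS exprM; set N := (2 ^ n)%N.
have N0 : (0 < N)%N by rewrite expn_gt0.
have NC : (N%:R : C) != 0 by rewrite pnatr_eq0 -lt0n.
have NR : (N%:R : R) != 0 by rewrite pnatr_eq0 -lt0n.
have N2 : (0 < 2 * N)%N by rewrite muln_gt0.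
pose m := (1 + r / (2 * N)%:R) ^+ 2.
have x0 : 0 <= r / (2 * N)%:R by rewrite divr_ge0.
have m1 : 1 <= m by rewrite /m exprn_ege1 // lerDl.
have am : rn ((1 + t / (2 * N)%:R) ^+ 2) <= m.
  rewrite rnX ler_pXn2r ?nnegrE ?rn_ge0 ?addr_ge0 //.
  by rewrite (le_trans (rnD _ _)) // rn1 lerD2l rnM rnV rn_nat ler_wpM2r ?invr_ge0.
have bm : rn (1 + t / N%:R) <= m.
  rewrite (le_trans (rnD _ _)) // rn1 rnM rnV rn_nat.
  rewrite (@le_trans _ _ (1 + r / N%:R)) ?lerD2l ?ler_wpM2r ?invr_ge0 //.
  have -> : m = 1 + r / N%:R + (r / (2 * N)%:R) ^+ 2.
    by rewrite /m natrM; field; rewrite NR.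
  by rewrite lerDl sqr_ge0.
rewrite (le_trans (rn_expB _ m1 am bm)) //.
have -> : (1 + t / (2 * N)%:R) ^+ 2 - (1 + t / N%:R) = (t / (2 * N)%:R) ^+ 2.
  by rewrite natrM; field; rewrite NC.
have mN : m ^+ N <= expR r by rewrite /m -exprM; exact: one_plus_pow_le.
rewrite rnX rnM rnV rn_nat -half_pow -/N /B.
have -> : N%:R * (rn t / (2 * N)%:R) ^+ 2 * m ^+ N = rn t ^+ 2 / 4 * m ^+ N / N%:R.
  by rewrite natrM; field; rewrite NR.
have m0 : 0 <= m ^+ N by rewrite exprn_ge0 // (le_trans ler01 m1).
rewrite ler_wpM2r ?invr_ge0 // ler_pM ?divr_ge0 ?sqr_ge0 //.
by rewrite ler_wpM2r // ler_pXn2r ?nnegrE ?rn_ge0.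
Qed.

Lemma Cexp_exists (t : C) : exists l : C, forall n (r : R), rn t <= r ->
  rn (expn_approx n t - l) <= 2 * B r / (1 - 2^-1) * 2^-1 ^+ n.
Proof.
have h1 : (2^-1 : R) < 1 by lra.
have [|l lP] := geometric_limit (B0 (rn t)) _ h1
  (fun n => expn_approx_step n (lexx (rn t))); first by [].
exists l => n r tr; apply: le_trans (lP n) _.
rewrite ler_wpM2r ?exprn_ge0 // ler_wpM2r ?invr_ge0 ?subr_ge0 ?(ltW h1) //.
rewrite ler_wpM2l // /B ler_pM ?expR_ge0 ?divr_ge0 ?sqr_ge0 ?ler_expR //.
by rewrite ler_wpM2r // ler_pXn2r ?nnegrE ?rn_ge0 // (le_trans (rn_ge0 _) tr).
Qed.

Definition Cexp : C -> C := projT1 (choice Cexp_exists).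

Lemma Cexp_approx (t : C) n (r : R) : rn t <= r ->
  rn (expn_approx n t - Cexp t) <= 2 * B r / (1 - 2^-1) * 2^-1 ^+ n.
Proof. exact: (projT2 (choice Cexp_exists)). Qed.

Lemma Cexp_polynomial (r e : R) : 0 < e -> exists q : {poly C}, forall t,
  rn t <= r -> rn (Cexp t - q.[t]) <= e.
Proof.
move=> e0; have h1 : (2^-1 : R) < 1 by lra.
have [|N /(_ N (leqnn N)) NP] := geometric_small (2 * B r / (1 - 2^-1)) _ h1 e0.
  by [].
exists ((1 + ((2 ^ N)%:R^-1 : C) *: 'X) ^+ (2 ^ N)) => t tr.
rewrite rnBC !hornerE mulrC; apply: le_trans NP; exact: Cexp_approx.
Qed.

Lemma Cexp_le (t : C) : rn (Cexp t) <= expR (rn t).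
Proof.
apply: (@le_geometric _ _ _ (2 * B (rn t) / (1 - 2^-1)) 2^-1) => [||n] //; first by lra.
rewrite (le_trans (rn_leD _ (expn_approx n t))) // addrC lerD //.
  exact: expn_approx_bound.
by rewrite rnBC Cexp_approx.
Qed.

(** [(1 + t / N)(1 - t / N) = 1 - (t / N)^2], whose [N]-th power differs from 1 by [O(1 / N)]. This
    special case of the addition law is what inverts overshears. *)
Lemma CexpNK (t : C) : Cexp t * Cexp (- t) = 1.
Proof.
apply/eqP; rewrite -subr_eq0 -rn_eq0 eq_le rn_ge0 andbT.
pose r := rn t; pose A := 2 * B r / (1 - 2^-1).
apply: (@le_geometric _ _ _ (expR r * A + expR r * A + r ^+ 2 * expR (r ^+ 2)) 2^-1) => //.
  by lra.
move=> n; rewrite add0r.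
have rN : rn (- t) <= r by rewrite rnN.
pose e1 := expn_approx n t; pose e2 := expn_approx n (- t).
have -> : Cexp t * Cexp (- t) - 1 =
  Cexp t * (Cexp (- t) - e2) + (Cexp t - e1) * e2 + (e1 * e2 - 1) by ring.
have H1 : rn (Cexp t * (Cexp (- t) - e2)) <= expR r * (A * 2^-1 ^+ n).
  by rewrite rnM ler_pM ?rn_ge0 ?Cexp_le // rnBC Cexp_approx.
have H2 : rn ((Cexp t - e1) * e2) <= expR r * (A * 2^-1 ^+ n).
  rewrite rnM mulrC ler_pM ?rn_ge0 //; first exact: expn_approx_bound.
  by rewrite rnBC Cexp_approx.
have H3 : rn (e1 * e2 - 1) <= r ^+ 2 * expR (r ^+ 2) * 2^-1 ^+ n.
  set N := (2 ^ n)%N; have N0 : (0 < N)%N by rewrite expn_gt0.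
  have NC : (N%:R : C) != 0 by rewrite pnatr_eq0 -lt0n.
  have NR : (N%:R : R) != 0 by rewrite pnatr_eq0 -lt0n.
  have N1 : (1 : R) <= N%:R by rewrite ler1n.
  pose x := (t / N%:R) ^+ 2.
  have -> : e1 * e2 - 1 = (1 - x) ^+ N - 1 ^+ N.
    rewrite expr1n /e1 /e2 /expn_approx -/N -exprMn; congr (_ ^+ _ - _).
    by rewrite /x; ring.
  have xE : rn x = r ^+ 2 / N%:R / N%:R.
    by rewrite /x rnX rnM rnV rn_nat; field; rewrite NR.
  have x0 : 0 <= rn x by exact: rn_ge0.
  have m1 : 1 <= 1 + rn x by rewrite lerDl.
  have am : rn (1 - x) <= 1 + rn x by rewrite (le_trans (rnB _ _)) // rn1.
  have bm : rn (1 : C) <= 1 + rn x by rewrite rn1.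
  rewrite (le_trans (rn_expB _ m1 am bm)) // -half_pow -/N.
  have -> : rn (1 - x - 1) = rn x by rewrite addrAC subrr add0r rnN.
  have m2 : (1 + rn x) ^+ N <= expR (r ^+ 2).
    have r2 : 0 <= r ^+ 2 / N%:R by rewrite divr_ge0 ?sqr_ge0.
    rewrite xE (le_trans (one_plus_pow_le r2 N0)) // ler_expR ler_pdivrMr ?ltr0n //.
    by rewrite ler_peMr ?sqr_ge0.
  have -> : N%:R * rn x * (1 + rn x) ^+ N = r ^+ 2 / N%:R * (1 + rn x) ^+ N.
    by congr (_ * _); rewrite xE mulrC divfK.
  by rewrite mulrAC ler_wpM2r ?invr_ge0 // ler_wpM2l ?sqr_ge0.
rewrite (le_trans (rnD _ _)) // (le_trans (lerD (rnD _ _) (lexx _))) //.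
by rewrite (le_trans (lerD (lerD H1 H2) H3)) // !mulrDl -!mulrA.
Qed.

Lemma Cexp0 : Cexp 0 = 1.
Proof.
apply/eqP; rewrite eq_sym -subr_eq0 -rn_eq0 eq_le rn_ge0 andbT.
have := @Cexp_approx 0 0 0; rewrite /expn_approx mul0r addr0 expr1n /B rn0.
by rewrite expr0n !mul0r mulr0 !mul0r; exact.
Qed.

Lemma Cexp_neq0 t : Cexp t != 0.
Proof. by apply: contraTneq (oner_neq0 C) => E; rewrite -(CexpNK t) E mul0r eqxx. Qed.

(** Comparison with the real exponential through [1 - 1 / N <= expR (- 1 / N)]. *)
Lemma Cexp_N1_lt1 : rn (Cexp (-1)) < 1.
Proof.
apply: (@le_lt_trans _ _ (expR (-1 : R))); last by rewrite expR_lt1 oppr_lt0.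
apply: (@le_geometric _ _ _ (2 * B 1 / (1 - 2^-1)) 2^-1) => [||n] //; first by lra.
rewrite (le_trans (rn_leD _ (expn_approx n (-1)))) // addrC lerD //; last first.
  by rewrite rnBC Cexp_approx // rnN rn1.
rewrite /expn_approx rnX; set N := (2 ^ n)%N; have N0 : (0 < N)%N by rewrite expn_gt0.
have -> : (1 + -1 / N%:R : C) = ((1 - N%:R^-1 : R)%:C)%C.
  by rewrite rmorphB rmorph1 fmorphV rmorph_nat mulN1r.
have NR : (N%:R : R) != 0 by rewrite pnatr_eq0 -lt0n.
have x0 : 0 <= 1 - N%:R^-1 :> R by rewrite subr_ge0 invf_le1 ?ler1n ?ltr0n.
rewrite rn_real ger0_norm //.
have -> : expR (-1 : R) = expR (- N%:R^-1) ^+ N.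
  by rewrite -expRM_natl mulrN divff.
by rewrite ler_pXn2r ?nnegrE ?expR_ge0 // (le_trans _ (expR_ge1Dx _)).
Qed.

End ComplexExponential.

Lemma entire1_Cexp (R : realType) k (f : Ck R k -> R[i]) :
  polyfun f -> entire1 (fun z => Cexp (f z)).
Proof.
move=> fp; apply: entire1_lim => r e e0.
have [M M0 fM] := polyfun_bounded r fp.
have [q qP] := Cexp_polynomial M e0.
exists (fun z => q.[f z]); first by apply: entire1_polyfun; exact: polyfun_horner.
by move=> z zr; apply: qP; exact: fM.
Qed.

(** * Maps with diagonal differential at the origin *)

Section Tangent.
Variables (R : realType) (k : nat).
Local Notation C := R[i].
Local Notation X := (Ck R k).
Implicit Types (F G : X -> X) (L : 'I_k -> C).

Definition dil L (z : X) : X := \row_j (L j * z 0 j).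

Definition tangent F L := exists c s : R, [/\ 0 <= c, 0 < s &
  forall z, rn z <= s -> rn (F z - dil L z) <= c * rn z ^+ 2].

Lemma dilB L x y : dil L (x - y) = dil L x - dil L y.
Proof. by apply/rowP => j; rewrite !mxE mulrBr. Qed.

Lemma dil_comp L L' z : dil L' (dil L z) = dil (fun j => L' j * L j) z.
Proof. by apply/rowP => j; rewrite !mxE mulrA. Qed.

Lemma dil_le L : exists2 B : R, 0 <= B & forall z, rn (dil L z) <= B * rn z.
Proof.
have B0 : 0 <= \sum_j rn (L j) by rewrite sumr_ge0 // => *; rewrite rn_ge0.
exists (\sum_j rn (L j)) => // z; apply: rn_le_coord => [|j].
  by rewrite mulr_ge0 ?rn_ge0.
rewrite mxE rnM ler_pM ?rn_ge0 ?coord_le_rn // (bigD1 j) //= lerDl.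
by rewrite sumr_ge0 // => *; rewrite rn_ge0.
Qed.

Lemma dil_entire L : entire (dil L).
Proof.
move=> j; apply: entire1_polyfun; rewrite (_ : (fun _ => _) = fun z : X => L j * z 0 j).
  by apply: polyfun_mul; [exact: polyfun_const|exact: polyfun_coord].
by apply/funext => z; rewrite mxE.
Qed.

Lemma tangent_id : tangent id (fun=> 1).
Proof.
exists 0, 1; split=> // z _; rewrite mul0r; have -> : dil (fun=> 1) z = z.
  by apply/rowP => j; rewrite mxE mul1r.
by rewrite subrr rn0.
Qed.

Lemma tangent_comp F G L M : tangent F L -> tangent G M ->
  tangent (G \o F) (fun j => M j * L j).
Proof.
move=> [c [s [c0 s0 FL]]] [c' [s' [c'0 s'0 GM]]].
have [l l0 lP] := dil_le L; have [m m0 mP] := dil_le M.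
pose B := l + c * s.
have B0 : 0 <= B by rewrite addr_ge0 ?mulr_ge0 // ltW.
have FB z : rn z <= s -> rn (F z) <= B * rn z.
  move=> zs; rewrite (le_trans (rn_leD _ (dil L z))) // mulrDl addrC lerD //.
  rewrite (le_trans (FL _ zs)) // expr2 mulrA ler_wpM2r ?rn_ge0 //.
  by rewrite ler_wpM2l.
exists (c' * B ^+ 2 + m * c), (Num.min s (s' / (B + 1))); split.
- by rewrite addr_ge0 ?mulr_ge0 ?exprn_ge0.
- by rewrite lt_min s0 divr_gt0 // ltr_wpDl.
move=> z; rewrite le_min => /andP[zs zs'].
have Fz : rn (F z) <= s'.
  rewrite (le_trans (FB _ zs)) //; move: zs'; rewrite ler_pdivlMr ?ltr_wpDl //.
  by have := rn_ge0 z; nra.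
rewrite -dil_comp /= (le_trans (rn_triB (dil M (F z)) _ _)) // mulrDl lerD //.
  rewrite (le_trans (GM _ Fz)) // -mulrA ler_wpM2l // -exprMn.
  by rewrite lerXn2r ?nnegrE ?rn_ge0 ?mulr_ge0 ?rn_ge0 ?FB.
by rewrite -dilB (le_trans (mP _)) // -mulrA ler_wpM2l // FL.
Qed.

End Tangent.

Section Overshears.
Variables (R : realType) (n : nat).
Local Notation C := R[i].
Local Notation X := (Ck R n.+1).

Definition overshear (s : X -> C) i (c : C) (z : X) : X :=
  upd_coord i z (z 0 i * Cexp (c * s z)).

Lemma overshear_coord s i c z j :
  overshear s i c z 0 j = if j == i then z 0 i * Cexp (c * s z) else z 0 j.
Proof. by rewrite mxE. Qed.

Lemma overshear_entire s i c : polyfun s -> entire (overshear s i c).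
Proof.
move=> sp j.
have [->|ji] := eqVneq j i.
  rewrite (_ : (fun _ => _) = fun z : X => z 0 i * Cexp (c * s z)); last first.
    by apply/funext => z; rewrite overshear_coord eqxx.
  apply: entire1M; first by apply: entire1_polyfun; exact: polyfun_coord.
  apply: (@entire1_Cexp _ _ (fun z => c * s z)).
  by apply: polyfun_mul => //; exact: polyfun_const.
rewrite (_ : (fun _ => _) = fun z : X => z 0 j).
  by apply: entire1_polyfun; exact: polyfun_coord.
by apply/funext => z; rewrite overshear_coord (negbTE ji).
Qed.

Lemma overshearK s i c : (forall z w, s (upd_coord i z w) = s z) ->
  cancel (overshear s i c) (overshear s i (- c)).
Proof.
move=> si z; apply/rowP => j; rewrite overshear_coord overshear_coord eqxx.
rewrite {2}/overshear si; case: eqVneq => [->|ji].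
  by rewrite mulNr -mulrA CexpNK mulr1.
by rewrite overshear_coord (negbTE ji).
Qed.

Lemma overshear_fix s i c z : s z = 0 -> overshear s i c z = z.
Proof.
move=> sz; apply/rowP => j; rewrite overshear_coord sz mulr0 Cexp0 mulr1.
by case: eqVneq => [->|].
Qed.

(** The error is [z_i] times [Cexp (c * s z) - Cexp c]; the second factor vanishes at 0 because
    [s 0 = 1], hence is at most [2 * M * rn z] by the Cauchy estimate on the unit ball. *)
Lemma overshear_tangent s i c : polyfun s -> s 0 = 1 ->
  tangent (overshear s i c) (fun j => if j == i then Cexp c else 1).
Proof.
move=> sp s1; have csp : polyfun (fun z => c * s z).
  by apply: polyfun_mul => //; exact: polyfun_const.
have ea := entire1_Cexp csp.
have [M M0 MP] := approx_bounded (ea 1).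
exists (2 * M), (2^-1); split; rewrite ?mulr_ge0 //.
move=> z z2; apply: rn_le_coord => [|j]; first by rewrite !mulr_ge0 ?exprn_ge0 ?rn_ge0.
rewrite mxE overshear_coord mxE mxE.
case: eqVneq => [->|_]; last first.
  by rewrite mul1r subrr rn0 !mulr_ge0 ?exprn_ge0 ?rn_ge0.
rewrite [Cexp c * _]mulrC -mulrBr rnM expr2 mulrA mulrC.
have z2' : rn z <= 1 / 2 by lra.
have := approx_cauchy1 ltr01 (ea 1) MP z2'; rewrite add0r s1 mulr1 divr1 => H.
by rewrite ler_pM ?rn_ge0 ?coord_le_rn.
Qed.

Variable s : 'I_n.+1 -> X -> C.
Hypothesis sp : forall i, polyfun (s i).
Hypothesis s1 : forall i, s i 0 = 1.
Hypothesis si : forall i z w, s i (upd_coord i z w) = s i z.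

Let shears (l : seq 'I_n.+1) := foldr (fun i G => G \o overshear (s i) i (-1)) id l.
Let shearsV (l : seq 'I_n.+1) := foldr (fun i G => overshear (s i) i 1 \o G) id l.

Let shearsK l : cancel (shears l) (shearsV l).
Proof.
elim: l => //= i l IH z; rewrite /= IH.
by have := overshearK (-1) (si i) z; rewrite opprK.
Qed.

Let shearsVK l : cancel (shearsV l) (shears l).
Proof. by elim: l => //= i l IH z; rewrite /= overshearK ?IH. Qed.

Let shears_entire l : entire (shears l).
Proof.
elim: l => [|i l IH]; first exact: entire_id.
by apply: entire_comp IH; exact: overshear_entire.
Qed.

Let shearsV_entire l : entire (shearsV l).
Proof.
elim: l => [|i l IH]; first exact: entire_id.
by apply: entire_comp IH _; exact: overshear_entire.
Qed.

Let shears_tangent l : tangent (shears l) (fun j => Cexp (-1) ^+ count_mem j l).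
Proof.
elim: l => [|i l IH]; first exact: tangent_id.
rewrite (_ : (fun _ => _) = fun j => Cexp (-1) ^+ count_mem j l *
    if j == i then Cexp (-1) else 1).
  by apply: tangent_comp IH; exact: overshear_tangent.
apply/funext => j /=; rewrite eq_sym; case: eqP => _ /=; last by rewrite mulr1.
by rewrite add1n exprSr.
Qed.

Let shearsV_tangent l : tangent (shearsV l) (fun j => Cexp 1 ^+ count_mem j l).
Proof.
elim: l => [|i l IH]; first exact: tangent_id.
rewrite (_ : (fun _ => _) = fun j => (if j == i then Cexp 1 else 1) *
    Cexp 1 ^+ count_mem j l).
  by apply: tangent_comp IH _; exact: overshear_tangent.
apply/funext => j /=; rewrite eq_sym; case: eqP => _ /=; last by rewrite mul1r.
by rewrite add1n exprS.
Qed.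

Lemma overshear_fb_map : exists (F psi Phi : X -> X) r mu,
  [/\ entire F, fb_map F psi Phi r mu & forall z, (forall i, s i z = 0) -> F z = z].
Proof.
pose l := enum 'I_n.+1.
(* Every axis is sheared exactly once, so all the eigenvalues are equal and the differential is
   scalar. *)
have c1 j : count_mem j l = 1%N by rewrite count_uniq_mem ?enum_uniq // mem_enum.
have tF := shears_tangent l; have tV := shearsV_tangent l.
have E1 (e : C) : (fun j => e ^+ count_mem j l) = fun=> e.
  by apply/funext => j; rewrite c1 expr1.
rewrite !{}E1 in tF tV.
have E11 : Cexp (-1) * Cexp 1 = 1 :> C by have := CexpNK (-1 : C); rewrite opprK.
have [c [r [c0 r0 FA]]] := tF; have [c' [r' [c'0 r'0 VA]]] := tV.
pose lam := rn (Cexp (-1) : C).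
have rn_dil (e : C) (z : X) : rn (dil (fun=> e) z) = rn e * rn z.
  have -> : dil (fun=> e) z = e *: z by apply/rowP => j; rewrite !mxE.
  by rewrite rnZ.
have l0 : 0 < lam by rewrite lt_neqAle rn_ge0 andbT eq_sym rn_eq0 Cexp_neq0.
have cc0 : 0 <= c + c' by rewrite addr_ge0.
have rr0 : 0 < Num.min r r' by rewrite lt_min r0.
have AK : cancel (dil (k := n.+1) (fun=> Cexp (-1) : C)) (dil (fun=> Cexp 1)).
  by move=> z; rewrite dil_comp; apply/rowP => j; rewrite mxE [Cexp 1 * _]mulrC E11 mul1r.
have AiK : cancel (dil (k := n.+1) (fun=> Cexp 1 : C)) (dil (fun=> Cexp (-1))).
  by move=> z; rewrite dil_comp; apply/rowP => j; rewrite mxE E11 mul1r.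
have [||psi [Phi [r1 [mu fb]]]] := fb_map_exists l0 (Cexp_N1_lt1 R) cc0 rr0
  (shears_entire l) (shearsV_entire l) (@dil_entire _ _ _) (@dil_entire _ _ _)
  (@shearsK l) (@shearsVK l) AK AiK (@dilB _ _ _) (@dilB _ _ _) (rn_dil _).
- move=> z; rewrite le_min => /andP[zr _]; rewrite (le_trans (FA _ zr)) //.
  by rewrite ler_wpM2r ?exprn_ge0 ?rn_ge0 // lerDl.
- move=> z; rewrite le_min => /andP[_ zr]; rewrite (le_trans (VA _ zr)) //.
  by rewrite ler_wpM2r ?exprn_ge0 ?rn_ge0 // lerDr.
exists (shears l), psi, Phi, r1, mu; split=> // z sz.
by elim: (l) => //= i l' IH; rewrite overshear_fix.
Qed.

End Overshears.

(** A fixed point of the basin already lies in the ball of radius [r], where [F] strictly shrinks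
    nonzero vectors. *)
Lemma fb_fixed_point (R : realType) k (F psi Phi : Ck R k -> Ck R k) r mu z w :
  fb_map F psi Phi r mu -> F z = z -> z != 0 -> psi w != z.
Proof.
move=> [r0 mu0 mu1 contr _ _ bas _ _] Fz z0; apply/eqP => wz.
have [m] := bas w; rewrite wz.
have -> : iter m F z = z by elim: m => //= m ->.
move=> /ltW /contr; rewrite Fz -subr_ge0 -{2}[rn z]mul1r -mulrBl.
by rewrite nmulr_rge0 ?subr_lt0 // leNgt lt_neqAle rn_ge0 eq_sym rn_eq0 z0.
Qed.

(* A point [p] outside of the hypersurfaces [g i = 0] becomes an attracting fixed
   point of a composition of overshears along the axes, which fixes [V]. *)
Lemma fb_map_avoiding (R : realType) n (V : set (Ck R n.+1)) :
  algebraic_set V -> ~ alg_dim_ge V n ->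
  exists (F psi Phi : Ck R n.+1 -> Ck R n.+1) r mu (p : Ck R n.+1),
    [/\ entire F, fb_map F psi Phi r mu & forall w, ~ V (psi w + p)].
Proof.
move=> Valg Vdim; have [g [p gP]] := codim2_elimination Valg Vdim.
pose s i z := (g i p)^-1 * g i (z + p).
have sp i : polyfun (s i).
  apply: polyfun_mul; first exact: polyfun_const.
  have [gp _ _ _] := gP i.
  apply: (polyfun_comp (p := g i) (F := fun z => z + p)) => // j.
  rewrite (_ : (fun _ => _) = fun z : Ck R n.+1 => z 0 j + p 0 j).
    by apply: polyfun_add; [exact: polyfun_coord|exact: polyfun_const].
  by apply/funext => z; rewrite mxE.
have s1 i : s i 0 = 1 by rewrite /s add0r mulVf //; case: (gP i).
have si i z w : s i (upd_coord i z w) = s i z.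
  have [_ _ _ gi] := gP i; rewrite /s -(gi (z + p) (w + p 0 i)); congr (_ * g i _).
  by apply/rowP => j; rewrite !mxE; case: eqP => [->|].
have [F [psi [Phi [r [mu [Fe fb Fz]]]]]] := overshear_fb_map sp s1 si.
exists F, psi, Phi, r, mu, p; split=> // w Vw.
have s0 i : s i (psi w) = 0.
  by have [_ _ /(_ _ Vw) gw _] := gP i; rewrite /s gw mulr0.
(* The functions [s i] vanish at [psi w] but equal 1 at the origin. *)
have pw0 : psi w != 0.
  by apply/eqP => E; have := s0 ord0; rewrite E s1 => /eqP; rewrite oner_eq0.
by have := fb_fixed_point w fb (Fz _ s0) pw0; rewrite eqxx.
Qed.

(** * The Henon-type automorphism *)

Section Topology.
Variable R : realType.
Local Notation C := R[i].

Lemma open_rnP (V : normedModType C) (A : set V) :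
  open A <-> forall x, A x -> exists2 e : R, 0 < e & forall y, rn (y - x) < e -> A y.
Proof.
rewrite openE; split=> [Ao x /Ao /nbhs_rn //|Ao x /Ao Ax].
exact/nbhs_rn.
Qed.

Lemma open_bigcup_seq (V : normedModType C) (A : nat -> set V) :
  (forall n, open (A n)) -> open (\bigcup_n A n).
Proof. by move=> Ao; apply: bigcup_open => n _. Qed.

Lemma connected_star (V : normedModType C) (A : set V) (a : V) : A a ->
  (forall x (t : R), A x -> 0 <= t <= 1 -> A (a + ((t%:C)%C : C) *: (x - a))) ->
  connected A.
Proof.
move=> Aa Ast.
pose seg x := (fun t : R => a + ((t%:C)%C : C) *: (x - a)) @` `[0, 1].
have -> : A = \bigcup_(x in A) seg x.
  apply/seteqP; split=> [x Ax|_ [x Ax [t t01 <-]]]; last first.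
    by apply: Ast => //; move: t01; rewrite /= in_itv.
  exists x => //; exists 1; first by rewrite /= in_itv /= ler01 lexx.
  by rewrite rmorph1 scale1r addrC subrK.
apply: bigcup_connected.
  exists a => x Ax; exists 0; first by rewrite /= in_itv /= ler01 lexx.
  by rewrite rmorph0 scale0r addr0.
move=> x Ax; apply: connected_continuous_connected.
  exact: segment_connected.
apply: continuous_subspaceT => t P /nbhs_rn [e e0 eP].
apply/nbhs_ballP; exists (e / (rn (x - a) + 1)) => [|s].
  by rewrite /= divr_gt0 // ltr_wpDl ?rn_ge0.
rewrite -ball_normE /= ltr_pdivlMr ?ltr_wpDl ?rn_ge0 // => st.
apply: eP; rewrite opprD addrACA subrr add0r -scalerBl rnZ -rmorphB rn_real distrC.
by apply: le_lt_trans st; rewrite ler_wpM2l // lerDl.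
Qed.

Lemma continuous_connected_image (V W : normedModType C) (f : V -> W) (A : set V) :
  connected A -> continuous f -> connected (f @` A).
Proof.
move=> Ac fc; apply: connected_continuous_connected => //.
exact: continuous_subspaceT.
Qed.

Variable k : nat.

(** The squared Euclidean norm, which defines the unit ball, whereas [rn] is the max norm. *)
Definition en2 (z : Ck R k) : R := \sum_i rn (z 0 i) ^+ 2.

Lemma en2_ge0 z : 0 <= en2 z.
Proof. by rewrite sumr_ge0 // => i _; rewrite sqr_ge0. Qed.

Lemma unit_ballE z : unit_ball R k z <-> en2 z < 1.
Proof.
rewrite /unit_ball /= -ltcR rmorph1 /en2 rmorph_sum /=.
by under eq_bigr do rewrite rnE -rmorphXn.
Qed.

Lemma coord_le_en2 (z : Ck R k) i : rn (z 0 i) ^+ 2 <= en2 z.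
Proof.
by rewrite /en2 (bigD1 i) //= lerDl sumr_ge0 // => j _; rewrite sqr_ge0.
Qed.

Lemma rn_le_en2 (z : Ck R k) (e : R) : 0 <= e -> en2 z <= e ^+ 2 -> rn z <= e.
Proof.
move=> e0 ze; apply: rn_le_coord => // i.
rewrite -(@ler_pXn2r _ 2) ?nnegrE ?rn_ge0 //.
exact: le_trans (coord_le_en2 _ _) ze.
Qed.

Lemma en2_le_rn (z : Ck R k) : en2 z <= k%:R * rn z ^+ 2.
Proof.
rewrite (@le_trans _ _ (\sum_(i < k) rn z ^+ 2)) //.
  by apply: ler_sum => i _; rewrite lerXn2r ?nnegrE ?rn_ge0 ?coord_le_rn.
by rewrite sumr_const card_ord mulr_natl.
Qed.

Lemma en2Z c (z : Ck R k) : en2 (c *: z) = rn c ^+ 2 * en2 z.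
Proof.
by rewrite /en2 mulr_sumr; apply: eq_bigr => i _; rewrite mxE rnM exprMn.
Qed.

Lemma en2D (y z : Ck R k) : en2 (y + z) <= 2 * en2 y + 2 * en2 z.
Proof.
rewrite /en2 !mulr_sumr -big_split /=; apply: ler_sum => i _; rewrite mxE.
have := rnD (y 0 i) (z 0 i); have := rn_ge0 (y 0 i + z 0 i).
by have := sqr_ge0 (rn (y 0 i) - rn (z 0 i)); nra.
Qed.

Lemma open_unit_ball : open (unit_ball R k).
Proof.
apply/open_rnP => z /unit_ballE z1.
have [d d0 dP] : exists2 d : R, 0 < d & forall y, rn (y - z) < d ->
    forall i, rn (y 0 i) ^+ 2 <= rn (z 0 i) ^+ 2 + (1 - en2 z) / (k.+1)%:R.
  pose e := (1 - en2 z) / (k.+1)%:R.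
  have e0 : 0 < e by rewrite divr_gt0 ?subr_gt0.
  have z0 := rn_ge0 z; have zz : 0 < 2 * rn z + 1 by lra.
  exists (Num.min 1 (e / (2 * rn z + 1))); first by rewrite lt_min ltr01 divr_gt0.
  move=> y; rewrite lt_min ltr_pdivlMr // => /andP[y1 ye] i; rewrite -/e.
  have yi : rn (y 0 i) <= rn (y - z) + rn (z 0 i).
    by have := coord_le_rn (y - z) i; have := rn_leD (y 0 i) (z 0 i); rewrite !mxE; lra.
  have := coord_le_rn z i; have := rn_ge0 (y 0 i); have := rn_ge0 (z 0 i).
  by have := rn_ge0 (y - z); nra.
exists d => // y /dP yz; apply/unit_ballE.
apply: (@le_lt_trans _ _ (\sum_(i < k) (rn (z 0 i) ^+ 2 + (1 - en2 z) / (k.+1)%:R))).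
  by apply: ler_sum.
rewrite big_split /= sumr_const card_ord -/(en2 z) -[X in _ + X]mulr_natr.
have k1 : (0 : R) < k.+1%:R by rewrite ltr0n.
rewrite -ltrBrDl -mulrA -[ltRHS]mulr1 ltr_pM2l ?subr_gt0 // mulrC ltr_pdivrMr //.
by rewrite mul1r ltr_nat.
Qed.

Lemma connected_unit_ball : connected (unit_ball R k).
Proof.
apply: (connected_star (a := 0)).
  by apply/unit_ballE; rewrite /en2 big1 ?ltr01 // => i _; rewrite mxE rn0 expr0n.
move=> x t /unit_ballE x1 /andP[t0 t1]; apply/unit_ballE.
rewrite add0r subr0 en2Z rn_real ger0_norm //.
by apply: le_lt_trans x1; rewrite ler_piMl ?en2_ge0 // exprn_ile1.
Qed.

Lemma connected_Ck : connected [set: Ck R k].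
Proof. exact: (connected_star (a := 0)). Qed.

Lemma entire_continuous_fun m (F : Ck R k -> Ck R m) : entire F -> continuous F.
Proof.
by move=> Fe z; apply: differentiable_continuous; exact: entire_differentiable.
Qed.

End Topology.

(** * The automorphism, its linear part and its rescaled iterates *)

Section Henon.
Variables (R : realType) (n : nat).
Local Notation C := R[i].
Local Notation X := (Ck R n.+2).

Definition henon (z : X) : X :=
  \row_j (4^-1 * (z 0 (ord_pred j) + (j == 0)%:R * z 0 0 ^+ 2)).

Definition henon_inv (y : X) : X :=
  \row_j (4 * y 0 (ordS j) - (ordS j == 0)%:R * (4 * y 0 (ordS 0)) ^+ 2).

(** The differential of [henon] at 0, a multiple of an isometry as [fb_map_exists] demands. *)
Definition henon_lin (z : X) : X := \row_j (4^-1 * z 0 (ord_pred j)).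

Definition henon_lin_inv (y : X) : X := \row_j (4 * y 0 (ordS j)).

Let four0 : (4 : C) != 0. Proof. by rewrite pnatr_eq0. Qed.

Let ordS0 : (ordS (0 : 'I_n.+2) == 0) = false.
Proof. by []. Qed.

Lemma henonK : cancel henon henon_inv.
Proof.
move=> z; apply/rowP => j; rewrite !mxE !ordSK ordS0 mul0r addr0.
by rewrite !mulVKf // addrK.
Qed.

Lemma henon_invK : cancel henon_inv henon.
Proof.
move=> y; apply/rowP => j; rewrite !mxE !ord_predK ordS0 mul0r subr0.
by rewrite subrK mulKf.
Qed.

Lemma henon_linK : cancel henon_lin henon_lin_inv.
Proof. by move=> z; apply/rowP => j; rewrite !mxE ordSK mulVKf. Qed.

Lemma henon_lin_invK : cancel henon_lin_inv henon_lin.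
Proof. by move=> z; apply/rowP => j; rewrite !mxE ord_predK mulKf. Qed.

Lemma henon_polyfun j : polyfun (fun z => henon z 0 j).
Proof.
rewrite (_ : (fun _ => _) = fun z : X =>
  4^-1 * (z 0 (ord_pred j) + (j == 0)%:R * z 0 0 ^+ 2)).
  apply: polyfun_mul; first exact: polyfun_const.
  apply: polyfun_add; first exact: polyfun_coord.
  apply: polyfun_mul; first exact: polyfun_const.
  by apply: polyfunX; exact: polyfun_coord.
by apply/funext => z; rewrite mxE.
Qed.

Lemma henon_inv_polyfun j : polyfun (fun z => henon_inv z 0 j).
Proof.
rewrite (_ : (fun _ => _) = fun y : X =>
  4 * y 0 (ordS j) - (ordS j == 0)%:R * (4 * y 0 (ordS 0)) ^+ 2).
  apply: polyfunB.
    by apply: polyfun_mul; [exact: polyfun_const|exact: polyfun_coord].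
  apply: polyfun_mul; first exact: polyfun_const.
  apply: polyfunX; apply: polyfun_mul; [exact: polyfun_const|exact: polyfun_coord].
by apply/funext => z; rewrite mxE.
Qed.

Lemma henon_entire : entire henon.
Proof. by move=> j; apply: entire1_polyfun; exact: henon_polyfun. Qed.

Lemma henon_inv_entire : entire henon_inv.
Proof. by move=> j; apply: entire1_polyfun; exact: henon_inv_polyfun. Qed.

Let lin_entire (c : C) (t : 'I_n.+2 -> 'I_n.+2) :
  entire (fun z : X => \row_j (c * z 0 (t j)) : X).
Proof.
move=> j; apply: entire1_polyfun.
rewrite (_ : (fun _ => _) = fun z : X => c * z 0 (t j)).
  by apply: polyfun_mul; [exact: polyfun_const|exact: polyfun_coord].
by apply/funext => z; rewrite mxE.
Qed.

Lemma henon_lin_rn z : rn (henon_lin z) = 4^-1 * rn z.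
Proof.
have q0 : (0 : R) <= 4^-1 by rewrite invr_ge0.
apply/le_anti/andP; split.
  apply: rn_le_coord => [|j]; first by rewrite mulr_ge0 ?rn_ge0.
  by rewrite mxE rnM rnV rn_nat ler_wpM2l // coord_le_rn.
rewrite ler_pdivrMl // [leRHS]mulrC; apply: rn_le_coord => [|j].
  by rewrite mulr_ge0 ?rn_ge0.
have := coord_le_rn (henon_lin z) (ordS j).
by rewrite mxE ordSK rnM rnV rn_nat ler_pdivrMl // mulrC.
Qed.

Lemma henon_fb_map : exists (psi Phi : X -> X) r mu, fb_map henon psi Phi r mu.
Proof.
have l0 : (0 : R) < 4^-1 by rewrite invr_gt0.
have l1 : (4^-1 : R) < 1 by lra.
(* The 16 is the square of the factor 4 in the quadratic term of [henon_inv]. *)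
apply: (fb_map_exists (c := 16) (s := 1) l0 l1 _ _ henon_entire henon_inv_entire
  (lin_entire _ _) (lin_entire _ _) henonK henon_invK henon_linK henon_lin_invK) => //.
- by move=> x y; apply/rowP => j; rewrite !mxE mulrBr.
- by move=> x y; apply/rowP => j; rewrite !mxE mulrBr.
- exact: henon_lin_rn.
- move=> z _; apply: rn_le_coord => [|j]; first by rewrite mulr_ge0 ?sqr_ge0.
  rewrite !mxE mulrDr addrAC subrr add0r !rnM rnV !rn_nat.
  have := coord_le_rn z 0; have := rn_ge0 (z 0 0); have := rn_ge0 z.
  by case: (j == 0) => /=; nra.
move=> z _; apply: rn_le_coord => [|j]; first by rewrite mulr_ge0 ?sqr_ge0.
rewrite !mxE addrAC subrr add0r rnN !rnM !rn_nat.
have := coord_le_rn z (ordS 0); have := rn_ge0 (z 0 (ordS 0)); have := rn_ge0 z.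
by case: (ordS j == 0) => /=; nra.
Qed.

Definition hscale j : R := 32^-1 ^+ (2 ^ j).

Lemma hscaleS j : hscale j.+1 = hscale j ^+ 2.
Proof. by rewrite /hscale expnSr exprM. Qed.

Lemma hscale_gt0 j : 0 < hscale j.
Proof. by rewrite exprn_gt0 // invr_gt0. Qed.

Lemma hscale_le1 j : hscale j <= 1.
Proof. by rewrite exprn_ile1 // ?invr_ge0 // invf_le1 // ler1n. Qed.

(* After rescaling by [hscale j], the [j]-th iteration becomes
   [p -> (p_0 ^ 2 + b p_max, b p_0, ...) / 4], a contraction of the unit ball. *)
Definition hmap j (s : X) : X := ((hscale j)%:C)%C *: iter j henon s.

Definition hmap_inv j (y : X) : X := iter j henon_inv (((hscale j)^-1%:C)%C *: y).

Let hscaleC j : ((hscale j)%:C)%C != 0 :> C.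
Proof. by rewrite fmorph_eq0 gt_eqF ?hscale_gt0. Qed.

Lemma hmapK j : cancel (hmap j) (hmap_inv j).
Proof.
move=> s; rewrite /hmap_inv /hmap scalerA -rmorphM /= mulVf ?gt_eqF ?hscale_gt0 //.
rewrite scale1r; elim: j => // j IH.
by rewrite iterSr iterS henonK IH.
Qed.

Lemma hmap_invK j : cancel (hmap_inv j) (hmap j).
Proof.
move=> y; rewrite /hmap /hmap_inv.
have -> z : iter j henon (iter j henon_inv z) = z.
  by elim: j z => // j IH z; rewrite iterSr iterS henon_invK IH.
by rewrite scalerA -rmorphM /= mulfV ?gt_eqF ?hscale_gt0 // scale1r.
Qed.

Let scale_entire (c : C) : entire (fun z : X => c *: z).
Proof.
move=> j; apply: entire1_polyfun.
rewrite (_ : (fun _ => _) = fun z : X => c * z 0 j).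
  by apply: polyfun_mul; [exact: polyfun_const|exact: polyfun_coord].
by apply/funext => z; rewrite mxE.
Qed.

Lemma hmap_entire j : entire (hmap j).
Proof. exact: entire_comp (entire_iter j henon_entire) (scale_entire _). Qed.

Lemma hmap_inv_entire j : entire (hmap_inv j).
Proof. exact: entire_comp (scale_entire _) (entire_iter j henon_inv_entire). Qed.

(** The next point is [4^-1] times the sum of a scaled cyclic shift of [p] and of [p_0 ^ 2] on the
    first axis. In the unit ball each summand has [en2] at most that of [p], so the result is at
    most [(2 + 2) / 16] of it. *)
Lemma hmap_contr j s : en2 (hmap j s) <= 1 -> en2 (hmap j.+1 s) <= 2^-1 * en2 (hmap j s).
Proof.
set p := hmap j s => p1.
pose b := hscale j; have b0 : 0 <= b := ltW (hscale_gt0 j).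
have b1 : b <= 1 := hscale_le1 j.
have pE i : p 0 i = ((b%:C)%C : C) * iter j henon s 0 i by rewrite mxE.
pose sh : X := \row_i p 0 (ord_pred i).
have en2sh : en2 sh = en2 p.
  rewrite /en2 (reindex (@ordS n.+2)) /=; last first.
    by exists (@ord_pred n.+2) => i _; [exact: ordSK|exact: ord_predK].
  by apply: eq_bigr => i _; rewrite mxE ordSK.
pose e0 : X := \row_i ((i == 0)%:R * p 0 0 ^+ 2).
have E : hmap j.+1 s = (4^-1 : C) *: ((b%:C)%C *: sh + e0).
  apply/rowP => i; rewrite !mxE -!/(iter j henon s) hscaleS -/b rmorphXn /=.
  by ring.
have e0E : en2 e0 <= en2 p.
  rewrite /en2 (bigD1 0) //= big1 => [|i i0]; last first.
    by rewrite mxE (negbTE i0) mul0r rn0 expr0n.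
  rewrite addr0 mxE eqxx mul1r rnX -/(en2 p).
  have := coord_le_en2 p 0; have := en2_ge0 p; have := sqr_ge0 (rn (p 0 0)); nra.
rewrite E en2Z rnV rn_nat.
have := en2D ((b%:C)%C *: sh) e0; rewrite en2Z en2sh rn_real ger0_norm // => H.
have b2 : b ^+ 2 * en2 p <= en2 p by rewrite ler_piMl ?en2_ge0 // exprn_ile1.
have := en2_ge0 p; nra.
Qed.

Lemma hmap_contrI m j s : en2 (hmap j s) <= 1 ->
  en2 (hmap (j + m) s) <= 2^-1 ^+ m * en2 (hmap j s).
Proof.
move=> s1; elim: m => [|m IH]; first by rewrite addn0 mul1r.
have s1' : en2 (hmap (j + m) s) <= 1.
  apply: le_trans IH _; apply: le_trans s1; rewrite ler_piMl ?en2_ge0 //.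
  by rewrite exprn_ile1 ?invr_ge0 // invf_le1 // ler1n.
by rewrite addnS (le_trans (hmap_contr s1')) // exprS -mulrA ler_wpM2l ?invr_ge0.
Qed.

Lemma hmap_contr1 j s : en2 (hmap j s) < 1 -> en2 (hmap j.+1 s) < 1.
Proof.
by move=> s1; have := hmap_contr (ltW s1); have := en2_ge0 (hmap j s); lra.
Qed.

(** The orbit eventually stays in the ball of radius [r], while [hscale j] tends to 0. *)
Lemma hmap_basin psi Phi r mu s m : fb_map henon psi Phi r mu ->
  rn (iter m henon s) < r -> exists j, en2 (hmap j s) < 1.
Proof.
move=> [r0 mu0 mu1 contr _ _ _ _ _] sr.
have sI i : rn (iter (i + m) henon s) <= r.
  elim: i => [|i IH]; first exact: ltW.
  rewrite addSn iterS (le_trans (contr _ IH)) // (le_trans _ IH) //.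
  by rewrite ler_piMl ?rn_ge0 // ltW.
have e0 : (0 : R) < 2^-1 by rewrite invr_gt0.
have h1 : (32^-1 : R) < 1 by lra.
have h0 : (0 : R) <= 32^-1 by rewrite invr_ge0.
have [N /(_ N (leqnn N)) NP] := geometric_small (n.+2%:R * r ^+ 2) h0 h1 e0.
pose j := (N + m)%N; exists j; rewrite en2Z rn_real ger0_norm ?(ltW (hscale_gt0 _)) //.
have bj : hscale j ^+ 2 <= 32^-1 ^+ N.
  rewrite -exprM ler_wiXn2l ?invr_ge0 ?(ltW h1) //.
  by rewrite (leq_trans _ (leq_pmulr _ _)) // (leq_trans (ltnW (ltn_expl N (ltnSn 1)))) //
     leq_exp2l // leq_addr.
have sj := sI N; rewrite -/j in sj.
have : en2 (iter j henon s) <= n.+2%:R * r ^+ 2.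
  rewrite (le_trans (en2_le_rn _)) // ler_wpM2l // lerXn2r ?nnegrE ?rn_ge0 //.
  exact: ltW.
have := en2_ge0 (iter j henon s); have := sqr_ge0 (hscale j).
have : 0 <= (32^-1 : R) ^+ N by rewrite exprn_ge0 ?invr_ge0.
move: bj NP; set a := hscale j ^+ 2; set bb := 32^-1 ^+ N; set x := en2 _.
set y := n.+2%:R * r ^+ 2 => H1 H2 H3 H4 H5 H6; nra.
Qed.

End Henon.

(** * Jensen's inequality on the unit circle *)

Section CircleMean.
Variable R : realType.
Local Notation C := R[i].
Local Notation mu := (@lebesgue_measure R).
Local Notation I := `[0%R, (2 * pi)%R]%classic.

Definition cis (t : R) : C := (cos t +i* sin t)%C.

Lemma rn_cis t : rn (cis t) = 1.
Proof. by rewrite /rn normc_def /= cos2Dsin2 sqrtr1. Qed.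

Lemma cisD s t : cis (s + t) = cis s * cis t.
Proof.
rewrite /cis cosD sinD; apply/eqP; rewrite eq_complex /= eqxx /=.
by rewrite addrC.
Qed.

Lemma cis_periodic t : cis (t + 2 * pi) = cis t.
Proof. by rewrite /cis mulr_natl cosD2pi sinD2pi. Qed.

Lemma cisMn t n : cis (t *+ n) = cis t ^+ n.
Proof.
elim: n => [|n IH]; first by rewrite mulr0n /cis cos0 sin0.
by rewrite mulrS exprS cisD IH.
Qed.

Lemma cis_pi : cis pi = -1.
Proof. by rewrite /cis cospi sinpi; apply/eqP; rewrite eq_complex /= oppr0 !eqxx. Qed.

(** The integral is not divided by the length of the circle, hence the factors [2 * pi] in the
    statements below. *)
Definition cmean (f : R -> R) : R := (\int[mu]_(t in I) f t)%R.

Let pi2 : 0 < 2 * pi :> R. Proof. by rewrite mulr_gt0 ?pi_gt0. Qed.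

Lemma continuous_integrable (f : R -> R) (a b : R) :
  continuous f -> mu.-integrable `[a, b] (EFin \o f).
Proof.
move=> fc; apply: continuous_compact_integrable; first exact: segment_compact.
exact: continuous_subspaceT.
Qed.

Lemma cmeanD (f g : R -> R) : continuous f -> continuous g ->
  cmean (fun t => f t + g t) = cmean f + cmean g.
Proof. by move=> fc gc; apply: RintegralD => //; exact: continuous_integrable. Qed.

Lemma cmeanZ c (f : R -> R) : continuous f -> cmean (fun t => c * f t) = c * cmean f.
Proof. by move=> fc; apply: RintegralZl => //; exact: continuous_integrable. Qed.

Lemma cmean_cst c : cmean (fun=> c) = 2 * pi * c.
Proof.
rewrite /cmean Rintegral_cst // mulrC; congr (_ * _).
have muI : mu I = (2 * pi)%:E.
  by have := @lebesgue_measure_itv R `[0%R, (2 * pi)%R]%R; rewrite /= lte_fin pi2 oppr0 adde0.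
exact: (congr1 fine muI).
Qed.

Lemma le_cmean (f g : R -> R) : continuous f -> continuous g ->
  (forall t, f t <= g t) -> cmean f <= cmean g.
Proof.
by move=> fc gc fg; apply: le_Rintegral => // *; exact: continuous_integrable.
Qed.

Lemma eq_cmean f g : f =1 g -> cmean f = cmean g.
Proof. by move=> fg; apply: eq_Rintegral => t _; exact: fg. Qed.

(* Both sides have the same primitive [P], and [P (x + 2 pi) - P x] is constant
   by periodicity. *)
Lemma cmean_shift (f : R -> R) a : continuous f -> (forall t, f (t + 2 * pi) = f t) -> 0 < a ->
  cmean (fun t => f (t + a)) = cmean f.
Proof.
move=> fc fper a0.
(* The primitive starts at -1, so that it is differentiable on a neighbourhood of [[0, +oo[], the
   endpoint 0 included. *)
pose P (x : R) : R := (\int[mu]_(t in `[-1, x]) f t)%R.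
have PE (x : R) : -1 < x -> is_derive x 1 P (f x).
  move=> x1; have xx : x < x + 1 by rewrite ltrDl.
  have [dP <-] := continuous_FTC1_closed xx (continuous_integrable _ _ fc) x1 (fc x).
  rewrite derive1E; exact: derivableP.
have Psh (c x : R) : -1 < x + c -> is_derive x 1 (fun t => P (t + c)) (f (x + c)).
  move=> xc; have := PE _ xc => Pd.
  have sh : is_derive x (1 : R) (fun t => t + c) 1.
    by apply: is_derive_eq; rewrite addr0.
  have := @is_derive1_comp _ P (fun t => t + c) x _ _ Pd sh.
  by rewrite mulr1.
have mean (c : R) : 0 <= c -> cmean (fun t => f (t + c)) = P (2 * pi + c) - P c.
  move=> c0; have pos x : 0 <= x -> -1 < x + c by move=> x0; lra.
  have Pc (x : R) : 0 <= x -> {for x, continuous (fun t => P (t + c))}.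
    move=> x0; have [dP _] := Psh c x (pos _ x0).
    by apply: differentiable_continuous; exact/derivable1_diffP.
  have fcc : continuous (fun t => f (t + c)).
    by move=> t; apply: continuous_comp; [apply: cvgD; [exact: cvg_id|exact: cvg_cst]|exact: fc].
  rewrite /cmean /Rintegral (@continuous_FTC2 _ _ (fun t => P (t + c)) _ _ pi2).
  - by rewrite add0r.
  - exact: continuous_subspaceT.
  - split.
    + by move=> x; rewrite in_itv /= => /andP[x0 _]; have [] := Psh c x (pos _ (ltW x0)).
    + by apply: cvg_at_right_filter; exact: Pc.
    + by apply: cvg_at_left_filter; exact: Pc (ltW pi2).
  - move=> x; rewrite in_itv /= => /andP[x0 _].
    by have Pd := Psh c x (pos _ (ltW x0)); rewrite derive1E derive_val.
rewrite (mean a (ltW a0)).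
have -> : cmean f = P (2 * pi + 0) - P 0.
  by rewrite -mean //; apply: eq_cmean => t; rewrite addr0.
pose W (x : R) : R := P (x + 2 * pi) - P (x + 0).
have dW (x : R) : -1 < x -> is_derive x 1 W 0.
  move=> x1; have x2 : -1 < x + 2 * pi by have := pi2; lra.
  have x0 : -1 < x + 0 by rewrite addr0.
  have D1 := Psh (2 * pi) x x2; have D2 := Psh 0 x x0.
  have := is_deriveB D1 D2; rewrite fper addr0 subrr; exact.
have [||c _] := @MVT R W (fun=> 0) 0 a a0.
- by move=> x; rewrite in_itv /= => /andP[x0 _]; apply: dW; lra.
- apply: derivable_within_continuous => x; rewrite in_itv /= => /andP[x0 _].
  by have [] := dW x ltac:(lra).
by rewrite /W mul0r !addr0 !add0r (addrC a) => /eqP; rewrite subr_eq0 => /eqP.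
Qed.

End CircleMean.

(** * Circle means of logarithms of polynomials *)

Section LogMean.
Variable R : realType.
Local Notation C := R[i].

Lemma continuous_realP (f : R -> R) : continuous f <-> forall t (e : R), 0 < e ->
  exists2 d : R, 0 < d & forall s, `|s - t| < d -> `|f s - f t| <= e.
Proof.
split=> [fc t e e0|fP t].
  have /cvgrPdist_le /(_ e e0) /nbhs_ballP [d d0 dP] := fc t.
  exists d => // s st; have := dP s; rewrite -ball_normE /= distrC => /(_ st).
  by rewrite distrC.
apply/cvgrPdist_le => e /(fP t) [d d0 dP]; apply/nbhs_ballP; exists d => // s.
rewrite /ball /= => ts; rewrite distrC; apply: dP; rewrite distrC; exact: ts.
Qed.

Definition ccont (f : R -> C) := forall t (e : R), 0 < e ->
  exists2 d : R, 0 < d & forall s, `|s - t| < d -> rn (f s - f t) <= e.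

Lemma ccont_bounded f t : ccont f -> exists2 d : R, 0 < d &
  forall s, `|s - t| < d -> rn (f s) <= rn (f t) + 1.
Proof.
move=> /(_ t 1 ltr01) [d d0 dP]; exists d => // s /dP H.
by rewrite (le_trans (rn_leD _ (f t))) // addrC lerD2l.
Qed.

Lemma ccontD f g : ccont f -> ccont g -> ccont (fun t => f t + g t).
Proof.
move=> fc gc t e e0; have e2 : 0 < e / 2 by rewrite divr_gt0.
have [d d0 dP] := fc t _ e2; have [d' d'0 d'P] := gc t _ e2.
exists (Num.min d d') => [|s]; first by rewrite lt_min d0.
rewrite lt_min => /andP[/dP H /d'P H'].
by rewrite opprD addrACA (le_trans (rnD _ _)) // [leRHS]splitr lerD.
Qed.

Lemma ccontM f g : ccont f -> ccont g -> ccont (fun t => f t * g t).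
Proof.
move=> fc gc t e e0.
have [d1 d10 d1P] := ccont_bounded t fc.
pose A := rn (f t) + 1; pose B := rn (g t) + 1.
have A0 : 0 < A by rewrite ltr_wpDl ?rn_ge0.
have B0 : 0 < B by rewrite ltr_wpDl ?rn_ge0.
have eA : 0 < e / 2 / A by rewrite !divr_gt0.
have eB : 0 < e / 2 / B by rewrite !divr_gt0.
have [d d0 dP] := fc t _ eB; have [d' d'0 d'P] := gc t _ eA.
exists (Num.min d1 (Num.min d d')) => [|s]; first by rewrite !lt_min d10 d0.
rewrite !lt_min => /andP[/d1P F1 /andP[/dP H /d'P H']].
have -> : f s * g s - f t * g t = f s * (g s - g t) + (f s - f t) * g t by ring.
rewrite (le_trans (rnD _ _)) // !rnM [leRHS]splitr lerD //.
  have -> : e / 2 = A * (e / 2 / A) by rewrite [RHS]mulrC divfK ?gt_eqF.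
  by rewrite ler_pM ?rn_ge0.
have -> : e / 2 = (e / 2 / B) * B by rewrite divfK ?gt_eqF.
by rewrite ler_pM ?rn_ge0 // lerDl.
Qed.

Lemma ccont_cst c : ccont (fun=> c).
Proof. by move=> t e e0; exists 1 => // s _; rewrite subrr rn0 ltW. Qed.

Lemma ccont_cis : ccont (@cis R).
Proof.
move=> t e e0; have e2 : 0 < e / 2 by rewrite divr_gt0.
have /continuous_realP /(_ t _ e2) [d d0 dP] := @continuous_cos R.
have /continuous_realP /(_ t _ e2) [d' d'0 d'P] := @continuous_sin R.
exists (Num.min d d') => [|s]; first by rewrite lt_min d0.
rewrite lt_min => /andP[/dP H /d'P H'].
by rewrite (le_trans (rn_le_ReIm _)) //= [leRHS]splitr lerD.
Qed.

Lemma ccont_horner f (q : {poly C}) : ccont f -> ccont (fun t => q.[f t]).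
Proof.
move=> fc; elim/poly_ind: q => [|q c IH].
  by rewrite (_ : (fun _ => _) = fun=> 0); [exact: ccont_cst|apply/funext => t; rewrite horner0].
rewrite (_ : (fun _ => _) = fun t => q.[f t] * f t + c).
  by apply: ccontD; [exact: ccontM|exact: ccont_cst].
by apply/funext => t; rewrite hornerMXaddC.
Qed.

Lemma ccont_rn f : ccont f -> continuous (fun t => rn (f t)).
Proof.
move=> fc; apply/continuous_realP => t e /(fc t) [d d0 dP]; exists d => // s /dP.
apply: le_trans; rewrite ler_norml.
have := rn_leD (f s) (f t); have := rn_leD (f t) (f s); rewrite (rnBC (f t)).
by move=> H1 H2; apply/andP; split; lra.
Qed.

Lemma continuous_ln_rn f : ccont f -> (forall t, f t != 0) ->
  continuous (fun t => ln (rn (f t))).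
Proof.
move=> fc f0 t; apply: (continuous_comp (f := fun t => rn (f t))).
  exact: ccont_rn.
by apply: continuous_ln; rewrite lt_neqAle rn_ge0 eq_sym rn_eq0 f0.
Qed.

Let pos_rn (z : C) : z != 0 -> rn z \in Num.pos.
Proof. by move=> z0; rewrite posrE lt_neqAle rn_ge0 eq_sym rn_eq0 z0. Qed.

Lemma ln_rnM (x y : C) : x != 0 -> y != 0 -> ln (rn (x * y)) = ln (rn x) + ln (rn y).
Proof. by move=> x0 y0; rewrite rnM lnM ?pos_rn. Qed.

Lemma one_sub_neq0 (x : C) : rn x < 1 -> 1 - x != 0.
Proof.
by move=> x1; rewrite subr_eq0; apply: contraTneq x1 => <-; rewrite rn1 ltxx.
Qed.

Let rn_pow_cis (b : C) n t : rn b < 1 -> rn (b ^+ (2 ^ n) * cis t ^+ (2 ^ n)) <= rn b.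
Proof.
move=> b1; rewrite rnM !rnX rn_cis expr1n mulr1 -[leRHS]expr1.
by rewrite ler_wiXn2l ?rn_ge0 ?(ltW b1) // expn_gt0.
Qed.

(* Rotating by [pi / 2 ^ n] and averaging turns the exponent [2 ^ n] into
   [2 ^ n.+1], so the mean of [ln |1 - b z|] is at most [O (2 ^- n)]. *)
Lemma cmean_ln_one_sub (b : C) : rn b < 1 ->
  cmean (fun t => ln (rn (1 - b * cis t))) = 0.
Proof.
move=> b1.
have [f fE] : exists f : nat -> R -> R, forall n,
    f n = fun t => ln (rn (1 - b ^+ (2 ^ n) * cis t ^+ (2 ^ n))).
  by exists (fun n t => ln (rn (1 - b ^+ (2 ^ n) * cis t ^+ (2 ^ n)))).
have neq0 n t : 1 - b ^+ (2 ^ n) * cis t ^+ (2 ^ n) != 0.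
  by apply: one_sub_neq0; exact: le_lt_trans (rn_pow_cis _ _ b1) b1.
have cc n : ccont (fun t => b ^+ (2 ^ n) * cis t ^+ (2 ^ n)).
  rewrite (_ : (fun _ => _) = fun t => ((b ^+ (2 ^ n)) *: 'X^(2 ^ n)).[cis t]).
    by apply: ccont_horner; exact: ccont_cis.
  by apply/funext => t; rewrite hornerZ hornerXn.
have cc1 n : ccont (fun t => 1 - b ^+ (2 ^ n) * cis t ^+ (2 ^ n)).
  rewrite (_ : (fun _ => _) = fun t => 1 + (-1) * (b ^+ (2 ^ n) * cis t ^+ (2 ^ n))).
    by apply: ccontD; [exact: ccont_cst|apply: ccontM => //; exact: ccont_cst].
  by apply/funext => t; rewrite mulN1r.
have fc n : continuous (f n) by rewrite fE; apply: continuous_ln_rn.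
have step n : cmean (f n.+1) = 2 * cmean (f n).
  have a0 : 0 < pi / (2 ^ n)%:R :> R by rewrite divr_gt0 ?pi_gt0 // ltr0n expn_gt0.
  have fper t : f n (t + 2 * pi) = f n t by rewrite fE cis_periodic.
  have sh := cmean_shift (fc n) fper a0.
  have fsh : continuous (fun t => f n (t + pi / (2 ^ n)%:R)).
    move=> t; apply: continuous_comp; last exact: fc.
    by apply: cvgD; [exact: cvg_id|exact: cvg_cst].
  have -> : 2 * cmean (f n) = cmean (fun t => f n t + f n (t + pi / (2 ^ n)%:R)).
    by rewrite cmeanD // sh mulrDl mul1r.
  apply: eq_cmean => t; rewrite !fE.
  have rot : cis (t + pi / (2 ^ n)%:R) ^+ (2 ^ n) = - cis t ^+ (2 ^ n) :> C.
    rewrite cisD exprMn -[cis (pi / _) ^+ _]cisMn.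
    have -> : (pi / (2 ^ n)%:R) *+ (2 ^ n) = pi :> R.
      by rewrite -[LHS]mulr_natr divfK // pnatr_eq0 -lt0n expn_gt0.
    by rewrite cis_pi mulrN1.
  have := neq0 n (t + pi / (2 ^ n)%:R); rewrite rot mulrN opprK => n1.
  rewrite -ln_rnM // expnSr !exprM; congr (ln (rn _)).
  by rewrite -subr_sqr expr1n -exprMn.
have pow n : cmean (f n) = 2 ^+ n * cmean (f 0).
  by elim: n => [|n IH]; rewrite ?mul1r // step IH exprS mulrA.
have -> : cmean (fun t => ln (rn (1 - b * cis t))) = cmean (f 0%N).
  by apply: eq_cmean => t; rewrite fE !expr1.
have r1 : 0 < 1 - rn b by rewrite subr_gt0.
pose B := ln 2 - ln (1 - rn b) : R.
have ln2 : 0 <= ln 2 :> R by rewrite ln_ge0 // ler1n.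
have lnr : ln (1 - rn b) <= 0.
  by rewrite -ln1 ler_ln ?posrE // lerBlDr lerDl rn_ge0.
have fB n t : - B <= f n t <= B.
  have x1 := rn_pow_cis n t b1; rewrite fE; set x := (_ * _) in x1 *.
  have l1 : 1 - rn b <= rn (1 - x).
    by have := rn_leD 1 x; rewrite rn1; lra.
  have l2 : rn (1 - x) <= 2 by rewrite (le_trans (rnB _ _)) // rn1; lra.
  have p1 : 0 < rn (1 - x) by exact: lt_le_trans l1.
  have : ln (1 - rn b) <= ln (rn (1 - x)) by rewrite ler_ln ?posrE.
  have : ln (rn (1 - x)) <= ln 2 by rewrite ler_ln ?posrE.
  by rewrite /B => H1 H2; apply/andP; split; lra.
have h0 : 0 <= 2^-1 :> R by rewrite invr_ge0.
have h1 : 2^-1 < 1 :> R by lra.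
have cB (c : R) : continuous (fun _ : R => c) by move=> t; exact: cvg_cst.
have bound n : `|cmean (f 0%N)| <= 0 + 2 * pi * B * 2^-1 ^+ n.
  rewrite add0r exprVn ler_pdivlMr ?exprn_gt0 // -[2 ^+ n]ger0_norm ?exprn_ge0 //.
  rewrite -normrM mulrC -pow ler_norml; apply/andP; split.
    rewrite -mulrN -cmean_cst; apply: le_cmean => // t.
    by have /andP[] := fB n t.
  rewrite -cmean_cst; apply: le_cmean => // t.
  by have /andP[] := fB n t.
by apply/eqP; rewrite -normr_le0; exact: le_geometric bound.
Qed.

(** If [rn a < 1], then [|cis t - a| = |1 - conj(a) cis t|] on the circle, so the mean is 0 and
    [ln (rn a)] is negative. If [rn a > 1], factoring out [a] gives equality. *)
Lemma cmean_ln_factor (a : C) : a != 0 -> rn a != 1 ->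
  2 * pi * ln (rn a) <= cmean (fun t => ln (rn (cis t - a))).
Proof.
move=> a0 a1; have pi0 : 0 < 2 * pi :> R by rewrite mulr_gt0 ?pi_gt0.
have conjE (x : C) : rn (conjc x) = rn x.
  by case: x => x y; rewrite /rn !normc_def /= sqrrN.
have [lt1|ge1] := ltP (rn a) 1.
  rewrite (@eq_cmean _ _ (fun t => ln (rn (1 - conjc a * cis t)))).
    rewrite cmean_ln_one_sub ?conjE // pmulr_rle0 // -ln1 ler_ln ?posrE ?(ltW lt1) //.
    by rewrite lt_neqAle rn_ge0 eq_sym rn_eq0 a0.
  move=> t; congr ln.
  have cc : cis t * conjc (cis t) = 1 :> C.
    rewrite /cis; apply/eqP; rewrite eq_complex /=; apply/andP; split; apply/eqP.
      by rewrite mulrN opprK -!expr2 cos2Dsin2.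
    by rewrite mulrN mulrC addNr.
  have -> : cis t - a = cis t * conjc (1 - conjc a * cis t).
    rewrite rmorphB rmorph1 rmorphM /= conjcK mulrBr mulr1 mulrCA cc mulr1 //.
  by rewrite rnM rn_cis mul1r conjE.
have a1' : rn (a^-1) < 1.
  have ra1 : 1 < rn a by rewrite lt_neqAle eq_sym a1.
  by rewrite rnV invf_lt1 // (lt_trans ltr01).
have n0 t : 1 - a^-1 * cis t != 0 by apply: one_sub_neq0; rewrite rnM rn_cis mulr1.
rewrite (@eq_cmean _ _ (fun t => ln (rn a) + ln (rn (1 - a^-1 * cis t)))).
  rewrite cmeanD; last 2 first.
  - by move=> t; exact: cvg_cst.
  - apply: continuous_ln_rn => //.
    rewrite (_ : (fun _ => _) = fun t => (1 + (- a^-1) *: 'X : {poly C}).[cis t]).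
      by apply: ccont_horner; exact: ccont_cis.
    by apply/funext => t; rewrite !hornerE mulNr.
  by rewrite cmean_ln_one_sub // addr0 cmean_cst.
move=> t; rewrite -ln_rnM // -rnN; congr (ln (rn _)).
by rewrite opprB mulrBr mulr1 mulVKf.
Qed.

Lemma cmean_ln_prod (s : seq C) : (forall a, a \in s -> a != 0 /\ rn a != 1) ->
  2 * pi * ln (rn (\prod_(a <- s) ('X - a%:P)).[0]) <=
  cmean (fun t => ln (rn (\prod_(a <- s) ('X - a%:P)).[cis t])).
Proof.
elim: s => [|a s IH] sP.
  have E x : (\prod_(a <- [::]) ('X - a%:P)).[x] = 1 :> C by rewrite big_nil hornerC.
  rewrite E (@eq_cmean _ _ (fun=> ln 1)) => [|t]; last by rewrite E rn1.
  by rewrite cmean_cst rn1.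
have [a0 a1] := sP a (mem_head _ _).
have sP' b : b \in s -> b != 0 /\ rn b != 1 by move=> bs; apply: sP; rewrite inE bs orbT.
have prod0 (S : seq C) x : (forall b, b \in S -> x != b) ->
    (\prod_(b <- S) ('X - b%:P)).[x] != 0.
  elim: S => [|b S IHS] xS; first by rewrite big_nil hornerC oner_neq0.
  rewrite big_cons hornerM hornerXsubC mulf_neq0 ?subr_eq0 ?xS ?mem_head // IHS //.
  by move=> c cS; rewrite xS // inE cS orbT.
have n0 b t : b \in a :: s -> cis t != b.
  by move=> /sP [_]; apply: contraNneq => <-; rewrite rn_cis.
have E x : (forall b, b \in a :: s -> x != b) ->
    ln (rn (\prod_(b <- a :: s) ('X - b%:P)).[x]) =
    ln (rn (x - a)) + ln (rn (\prod_(b <- s) ('X - b%:P)).[x]).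
  move=> xs; rewrite big_cons hornerM hornerXsubC ln_rnM ?subr_eq0 ?xs ?mem_head //.
  by apply: prod0 => b bs; rewrite xs // inE bs orbT.
rewrite E => [|b /sP [b0 _]]; last by rewrite eq_sym.
rewrite (@eq_cmean _ _ (fun t => ln (rn (cis t - a)) +
   ln (rn (\prod_(b <- s) ('X - b%:P)).[cis t]))) => [|t]; last by rewrite E // => b; exact: n0.
rewrite sub0r rnN mulrDr cmeanD.
- by rewrite lerD ?cmean_ln_factor ?IH.
- apply: continuous_ln_rn => [|t]; last by rewrite subr_eq0 n0 ?mem_head.
  rewrite (_ : (fun _ => _) = fun t => ('X - a%:P).[cis t]).
    by apply: ccont_horner; exact: ccont_cis.
  by apply/funext => t; rewrite hornerXsubC.
- apply: continuous_ln_rn => [|t].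
    by apply: ccont_horner; exact: ccont_cis.
  by apply: prod0 => b bs; rewrite n0 // inE bs orbT.
Qed.

End LogMean.

(** * The sub-mean value inequality for log+ *)

Section LogPlus.
Variable R : realType.
Local Notation C := R[i].

(** The function log+, written so that it is continuous also at the zeros of its argument. *)
Definition lnp (x : R) : R := ln (Num.max 1 x).

Lemma max1_gt0 (x : R) : 0 < Num.max 1 x.
Proof. by rewrite lt_max ltr01. Qed.

Lemma lnp_ge0 x : 0 <= lnp x.
Proof. by rewrite ln_ge0 // le_max lexx. Qed.

Lemma le_lnp x y : x <= y -> lnp x <= lnp y.
Proof.
move=> xy; rewrite ler_ln ?posrE ?max1_gt0 // ge_max le_max lexx /=.
by rewrite le_max xy orbT.
Qed.

Lemma ln_le_lnp x : 0 < x -> ln x <= lnp x.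
Proof. by move=> x0; rewrite ler_ln ?posrE ?max1_gt0 // le_max lexx orbT. Qed.

Lemma lnp_le1 x : x <= 1 -> lnp x = 0.
Proof. by move=> x1; rewrite /lnp max_l // ln1. Qed.

Lemma lnp_leP x y : 0 <= y -> (lnp x <= y) = (x <= expR y).
Proof.
move=> y0; rewrite -ler_expR lnK ?posrE ?max1_gt0 // ge_max.
by rewrite -{1}expR0 ler_expR y0.
Qed.

(** [max(1, y) * expR e >= max(1, y) * (1 + e) >= max(1, y) + e]. *)
Lemma lnp_lip x y e : 0 <= e -> x <= y + e -> lnp x <= lnp y + e.
Proof.
move=> e0 xy; rewrite lnp_leP ?addr_ge0 ?lnp_ge0 // expRD.
rewrite [expR (lnp y)]lnK ?posrE ?max1_gt0 //.
have := expR_ge1Dx e; set m := Num.max 1 y.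
have m1 : 1 <= m by rewrite le_max lexx.
have my : y <= m by rewrite le_max lexx orbT.
by nra.
Qed.

Lemma lnp_lipB x y e : `|x - y| <= e -> `|lnp x - lnp y| <= e.
Proof.
move=> xy; have e0 : 0 <= e := le_trans (normr_ge0 _) xy.
move: xy; rewrite !ler_norml => /andP[H1 H2].
have := @lnp_lip x y e e0; have := @lnp_lip y x e e0.
by move=> /(_ ltac:(lra)) H3 /(_ ltac:(lra)) H4; apply/andP; split; lra.
Qed.

Lemma rn_distB (V : normedZmodType C) (x y : V) : `|rn x - rn y| <= rn (x - y).
Proof.
rewrite ler_norml; have := rn_leD x y; have := rn_leD y x; rewrite (rnBC y).
by move=> H1 H2; apply/andP; split; lra.
Qed.

Lemma continuous_lnp (f : R -> R) : continuous f -> continuous (fun t => lnp (f t)).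
Proof.
move/continuous_realP => fP; apply/continuous_realP => t e /(fP t) [d d0 dP].
by exists d => // s /dP /lnp_lipB.
Qed.

Lemma lnp_horner_continuous (h : {poly C}) : continuous (fun t => lnp (rn h.[cis t])).
Proof.
apply: continuous_lnp; apply: ccont_rn; apply: ccont_horner; exact: ccont_cis.
Qed.

Let pi2 : 0 < 2 * pi :> R. Proof. by rewrite mulr_gt0 ?pi_gt0. Qed.

(** When [rn h.[0] <= 1] the left side is 0. Otherwise 0 is no root, [h] splits into linear factors
    covered by [cmean_ln_prod], and [ln <= lnp] on the circle. *)
Lemma submean_circle (h : {poly C}) : (forall a, root h a -> rn a != 1) ->
  2 * pi * lnp (rn h.[0]) <= cmean (fun t => lnp (rn h.[cis t])).
Proof.
move=> h1.
have mean_ge0 : 0 <= cmean (fun t => lnp (rn h.[cis t])).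
  rewrite -[leLHS](mulr0 (2 * pi)) -cmean_cst; apply: le_cmean => [t||t].
  - exact: cvg_cst.
  - exact: lnp_horner_continuous.
  - exact: lnp_ge0.
have [h01|h01] := leP (rn h.[0]) 1; first by rewrite lnp_le1 ?mulr0.
have h0 : h != 0 by apply: contraTneq h01 => ->; rewrite horner0 rn0 -leNgt.
have [s hE] := closed_field_poly_normal (h : {poly (C : numClosedFieldType)}).
have l0 : lead_coef h != 0 by rewrite lead_coef_eq0.
have sroot a : a \in s -> root h a by move=> sa; rewrite hE rootZ // root_prod_XsubC.
have sP a : a \in s -> a != 0 /\ rn a != 1.
  move=> /sroot ra; split; last exact: h1.
  by apply: contraTneq ra => ->; rewrite rootE -rn_eq0 gt_eqF // (lt_trans ltr01).
set g := \prod_(a <- s) _ in hE.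
have gcis t : g.[cis t] != 0.
  rewrite -rootE root_prod_XsubC; apply/negP => /sP [_].
  by rewrite rn_cis eqxx.
have g00 : g.[0] != 0.
  by rewrite -rootE root_prod_XsubC; apply/negP => /sP [/eqP].
have E x : g.[x] != 0 -> ln (rn h.[x]) = ln (rn (lead_coef h)) + ln (rn g.[x]).
  by move=> gx; rewrite {1}hE hornerZ ln_rnM.
have gc : continuous (fun t => ln (rn g.[cis t])).
  by apply: continuous_ln_rn => //; apply: ccont_horner; exact: ccont_cis.
have cc (c : R) : continuous (fun _ : R => c) by move=> t; exact: cvg_cst.
have -> : lnp (rn h.[0]) = ln (rn h.[0]) by rewrite /lnp max_r // ltW.
rewrite E // mulrDr.
apply: (@le_trans _ _ (cmean (fun t => ln (rn (lead_coef h)) + ln (rn g.[cis t])))).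
  by rewrite cmeanD // cmean_cst lerD2l; exact: cmean_ln_prod.
apply: le_cmean => [||t].
- by move=> t; apply: cvgD; [exact: cvg_cst|exact: gc].
- exact: lnp_horner_continuous.
- rewrite -E // ln_le_lnp // lt_neqAle rn_ge0 eq_sym rn_eq0 {1}hE hornerZ.
  by rewrite mulf_neq0.
Qed.

Definition disc_approx (H : C -> C) := forall e : R, 0 < e ->
  exists h : {poly C}, forall t, rn t <= 1 -> rn (H t - h.[t]) <= e.

Lemma disc_approx_ccont H : disc_approx H -> ccont (fun t => H (cis t)).
Proof.
move=> HP t e e0; have e3 : 0 < e / 3 by rewrite divr_gt0.
have [h hP] := HP _ e3; have [d d0 dP] := ccont_horner h (@ccont_cis R) t e3.
have hc s : rn (H (cis s) - h.[cis s]) <= e / 3 by rewrite hP ?rn_cis.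
exists d => // s /dP hst; have := hc s; have := hc t; rewrite rnBC => H1 H2.
have := rn_triB h.[cis s] (H (cis s)) (H (cis t)).
have := rn_triB h.[cis t] h.[cis s] (H (cis t)); lra.
Qed.

Lemma disc_approx_continuous H : disc_approx H ->
  continuous (fun t => lnp (rn (H (cis t)))).
Proof. by move=> HP; apply: continuous_lnp; apply: ccont_rn; exact: disc_approx_ccont. Qed.

Lemma submean_approx (g : C -> R) (H : C -> C) (e : R) : 0 <= e ->
  continuous (fun t => g (cis t)) -> continuous (fun t => lnp (rn (H (cis t)))) ->
  2 * pi * lnp (rn (H 0)) <= cmean (fun t => lnp (rn (H (cis t)))) ->
  (forall t, rn t <= 1 -> `|lnp (rn (H t)) - g t| <= e) ->
  2 * pi * g 0 <= cmean (fun t => g (cis t)) + 2 * pi * (2 * e).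
Proof.
move=> e0 gc Hc sub near.
have /andP[n1 n2] : - e <= lnp (rn (H 0)) - g 0 <= e by rewrite -ler_norml near ?rn0.
have cc (c : R) : continuous (fun _ : R => c) by move=> t; exact: cvg_cst.
have : cmean (fun t => lnp (rn (H (cis t)))) <= cmean (fun t => g (cis t) + e).
  apply: le_cmean => // [t|t]; first by apply: cvgD; [exact: gc|exact: cvg_cst].
  by have := near (cis t); rewrite rn_cis lexx => /(_ isT); rewrite ler_norml => /andP[]; lra.
rewrite cmeanD // cmean_cst => H2.
have H3 : 2 * pi * g 0 <= 2 * pi * (lnp (rn (H 0)) + e) by rewrite ler_pM2l //; lra.
by apply: le_trans H3 _; rewrite mulrDr; lra.
Qed.

(** Finitely many moduli of roots against the infinitely many radii [1 - d / (i + 2)]; the moduli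
    are encoded as roots of a real polynomial. *)
Lemma radius_avoiding (h : {poly C}) (d : R) : h != 0 -> 0 < d -> d <= 1 ->
  exists rho : R, [/\ 1 - d <= rho, rho < 1, 0 < rho & forall a, root h a -> rn a != rho].
Proof.
move=> h0 d0 d1.
have [s hE] := closed_field_poly_normal (h : {poly (C : numClosedFieldType)}).
pose q : {poly R} := \prod_(x <- map (@rn R C) s) ('X - x%:P).
have q0 : q != 0 by rewrite monic_neq0 // monic_prod_XsubC.
pose pt i : R := 1 - d / (i.+2)%:R.
have [i ri] : exists i, ~~ root q (pt i).
  apply/not_existsP => H.
  have := @max_poly_roots R q [seq pt i | i <- iota 0 (size q)] q0.
  rewrite size_map size_iota ltnn => /(_ _ _)/negP []//.
    by apply/allP => _ /mapP [i _ ->]; apply: contra_notT (H i).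
  rewrite map_inj_uniq ?iota_uniq // => i j /eqP.
  rewrite /pt (inj_eq (addrI _)) eqr_opp => /eqP /(mulfI (lt0r_neq0 d0)) /invr_inj /eqP.
  by rewrite eqr_nat => /eqP [].
have i2 : (0 : R) < i.+2%:R by rewrite ltr0n.
have di : d / i.+2%:R <= d / 2 by rewrite ler_pM2l // lef_pV2 ?posrE // ler_nat.
have x0 : 0 < d / i.+2%:R by rewrite divr_gt0.
exists (pt i); split.
- by rewrite /pt; move: (_ / _) di => x di; lra.
- by rewrite /pt ltrBlDr ltrDl.
- by rewrite /pt; move: (_ / _) di => x di; lra.
move=> a; rewrite hE rootZ ?lead_coef_eq0 // root_prod_XsubC => sa.
apply: contraNneq ri => <-; rewrite root_prod_XsubC; exact: map_f.
Qed.

Lemma horner_lip (h : {poly C}) : exists2 L : R, 0 <= L &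
  forall x y, rn x <= 1 -> rn y <= 1 -> rn (h.[x] - h.[y]) <= L * rn (x - y).
Proof.
have hp : polyfun (fun z : Ck R 1 => h.[z 0 0]).
  by apply: polyfun_horner; exact: polyfun_coord.
have [L L0 LP] := polyfun_lip 1 hp; exists L => // x y x1 y1.
pose c (x : C) : Ck R 1 := const_mx x.
have cE (z : C) : rn (c z) = rn z.
  apply/le_anti/andP; split.
    by apply: rn_le_coord => [|i]; rewrite ?rn_ge0 // mxE.
  by have := coord_le_rn (c z) 0; rewrite mxE.
have := LP (c x) (c y); rewrite !cE !mxE => /(_ x1 y1).
by rewrite (_ : c x - c y = c (x - y)) ?cE //; apply/rowP => i; rewrite !mxE.
Qed.

(** Roots on the unit circle are avoided by a circle of slightly smaller radius [rho]; the Lipschitz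
    bound on [h] makes the change of both sides arbitrarily small. *)
Lemma submean_poly (h : {poly C}) :
  2 * pi * lnp (rn h.[0]) <= cmean (fun t => lnp (rn h.[cis t])).
Proof.
have [->|h0] := eqVneq h 0.
  rewrite horner0 rn0 lnp_le1 // mulr0.
  rewrite (@eq_cmean _ _ (fun=> 0)) ?cmean_cst ?mulr0 // => t.
  by rewrite horner0 rn0 lnp_le1.
have [L L0 LP] := horner_lip h.
apply/ler_addgt0Pr => e e0.
pose e' := e / (2 * pi * 2); have e'0 : 0 < e' by rewrite divr_gt0 // mulr_gt0.
pose d := Num.min 1 (e' / (L + 1)).
have d0 : 0 < d by rewrite lt_min ltr01 divr_gt0 // ltr_wpDl.
have d1 : d <= 1 by rewrite ge_min lexx.
have dL : L * d <= e'.
  have : d <= e' / (L + 1) by rewrite ge_min lexx orbT.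
  by rewrite ler_pdivlMr ?ltr_wpDl //; have := ltW d0; nra.
have [rho [r1 r2 r0 rP]] := radius_avoiding h0 d0 d1.
pose c : C := (rho%:C)%C.
have rc : rn c = rho by rewrite rn_real gtr0_norm.
have c0 : c != 0 by rewrite -rn_eq0 rc gt_eqF.
pose hr := h \Po (c *: 'X).
have hrE t : hr.[t] = h.[c * t] by rewrite horner_comp hornerZ hornerX.
have hr1 a : root hr a -> rn a != 1.
  rewrite rootE hrE -rootE => /rP; rewrite rnM rc; apply: contraNneq => ->.
  by rewrite mulr1.
have := @submean_approx (fun t => lnp (rn h.[t])) (fun t => hr.[t]) e' (ltW e'0)
  (@lnp_horner_continuous _) (@lnp_horner_continuous _) (submean_circle hr1).
have pi4 : 2 * pi * 2 != 0 :> R by rewrite lt0r_neq0 // mulr_gt0.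
have -> : 2 * pi * (2 * e') = e by rewrite mulrA mulrC /e' divfK.
apply=> t t1; apply: lnp_lipB; apply: le_trans (rn_distB _ _) _; rewrite hrE.
have ct : rn (c * t) <= 1 by rewrite rnM rc; have := rn_ge0 t; nra.
rewrite (le_trans (LP _ _ ct t1)) // (le_trans _ dL) // ler_wpM2l //.
have -> : c * t - t = ((rho - 1)%:C)%C * t by rewrite rmorphB rmorph1 mulrBl mul1r.
rewrite rnM rn_real ler0_norm; last by lra.
by have := rn_ge0 t; nra.
Qed.

Lemma submean_disc (H : C -> C) : disc_approx H ->
  2 * pi * lnp (rn (H 0)) <= cmean (fun t => lnp (rn (H (cis t)))).
Proof.
move=> HP; apply/ler_addgt0Pr => e e0.
pose e' := e / (2 * pi * 2); have e'0 : 0 < e' by rewrite divr_gt0 // mulr_gt0.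
have [h hP] := HP _ e'0.
have := @submean_approx (fun t => lnp (rn (H t))) (fun t => h.[t]) e' (ltW e'0)
  (disc_approx_continuous HP) (@lnp_horner_continuous _) (submean_poly h).
have pi4 : 2 * pi * 2 != 0 :> R by rewrite lt0r_neq0 // mulr_gt0.
have -> : 2 * pi * (2 * e') = e by rewrite mulrA mulrC /e' divfK.
apply=> t t1; apply: lnp_lipB; apply: le_trans (rn_distB _ _) _.
by rewrite rnBC hP.
Qed.

(** Each coordinate obeys the scalar inequality, and passing to the max norm only enlarges its right
    side; the resulting common bound then holds for the maximum on the left. *)
Lemma submean_vector k (H : C -> Ck R k) :
  (forall i, disc_approx (fun t => H t 0 i)) ->
  continuous (fun t => lnp (rn (H (cis t)))) ->
  2 * pi * lnp (rn (H 0)) <= cmean (fun t => lnp (rn (H (cis t)))).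
Proof.
move=> HP Hc; rewrite -ler_pdivlMl //; set Y := cmean _.
have Y0 : 0 <= (2 * pi)^-1 * Y.
  rewrite mulr_ge0 ?invr_ge0 ?(ltW pi2) // -[leLHS](mulr0 (2 * pi)) -cmean_cst.
  by apply: le_cmean => [t||t]; [exact: cvg_cst|exact: Hc|exact: lnp_ge0].
rewrite lnp_leP //; apply: rn_le_coord => [|i]; first exact: expR_ge0.
rewrite -lnp_leP // ler_pdivlMl //; apply: le_trans (submean_disc (HP i)) _.
apply: le_cmean => [||t]; [exact: (disc_approx_continuous (HP i))|exact: Hc|].
by apply: le_lnp; exact: coord_le_rn.
Qed.

End LogPlus.

(** * The Green function *)

Section GreenFunction.
Variables (R : realType) (n : nat).
Local Notation C := R[i].
Local Notation X := (Ck R n.+2).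

Definition green_approx m (s : X) : R := 2^-1 ^+ m * lnp (rn (iter m (@henon R n) s)).

(** [green_approx] decreases in [m], since [|H z| <= max(1, |z|)^2], so the infimum is the limit. As
    an infimum of continuous functions it is upper semicontinuous. *)
Definition green (s : X) : R := inf (range (green_approx ^~ s)).

Lemma green_approx_ge0 m s : 0 <= green_approx m s.
Proof. by rewrite mulr_ge0 ?exprn_ge0 ?invr_ge0 // lnp_ge0. Qed.

Lemma henon_le (z : X) : rn (henon z) <= Num.max 1 (rn z) ^+ 2.
Proof.
set m := Num.max 1 (rn z); have m1 : 1 <= m by rewrite le_max lexx.
have zm : rn z <= m by rewrite le_max lexx orbT.
apply: rn_le_coord => [|j]; first by rewrite sqr_ge0.
rewrite mxE rnM rnV rn_nat ler_pdivrMl //.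
have := coord_le_rn z (ord_pred j); have := coord_le_rn z 0.
have := rnD (z 0 (ord_pred j)) ((j == 0)%:R * z 0 0 ^+ 2).
rewrite rnM rn_nat rnX; have := rn_ge0 (z 0 0); have := rn_ge0 z.
by case: (j == 0) => /=; nra.
Qed.

Lemma green_approxS m s : green_approx m.+1 s <= green_approx m s.
Proof.
rewrite /green_approx exprS -mulrA mulrCA ler_wpM2l ?exprn_ge0 ?invr_ge0 //.
rewrite ler_pdivrMl // iterS; set z := iter m _ _.
have m0 : 0 < Num.max 1 (rn z) by exact: max1_gt0.
have -> : 2 * lnp (rn z) = ln (Num.max 1 (rn z) ^+ 2) by rewrite lnXn // mulr_natl.
rewrite /lnp ler_ln ?posrE ?max1_gt0 ?exprn_gt0 // ge_max henon_le andbT.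
by rewrite exprn_ege1 // le_max lexx.
Qed.

Lemma green_approx_le m m' s : (m <= m')%N -> green_approx m' s <= green_approx m s.
Proof.
elim: m' => [|m' IH]; first by rewrite leqn0 => /eqP ->.
rewrite leq_eqVlt => /orP[/eqP -> //|]; rewrite ltnS => /IH; apply: le_trans.
exact: green_approxS.
Qed.

Lemma green_has_inf s : has_inf (range (green_approx ^~ s)).
Proof.
split; first by exists (green_approx 0 s), 0%N.
by exists 0 => _ [m _ <-]; exact: green_approx_ge0.
Qed.

Lemma green_le m s : green s <= green_approx m s.
Proof. by apply: ge_inf; [exact: (green_has_inf s).2|exists m]. Qed.

Lemma green_ge (c : R) s : (forall m, c <= green_approx m s) -> c <= green s.
Proof.
move=> H; apply: lb_le_inf; first by exists (green_approx 0 s), 0%N.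
by move=> _ [m _ <-].
Qed.

Lemma green_lt (c : R) s : green s < c -> exists m, green_approx m s < c.
Proof.
move=> gc; apply/not_existsP => H; move: gc; rewrite ltNge => /negP; apply.
by apply: green_ge => m; have /negP := H m; rewrite -leNgt.
Qed.

Lemma green_cvg s : (fun m => green_approx m s) @ \oo --> green s.
Proof.
apply/cvgrPdist_le => e e0.
have [|N NP] := @green_lt (green s + e) s; first by rewrite ltrDl.
exists N => // m /= Nm; rewrite ler0_norm; last by rewrite subr_le0 green_le.
by have := green_approx_le s Nm; lra.
Qed.

Lemma green0 : green 0 = 0.
Proof.
apply/le_anti/andP; split; last by apply: green_ge => m; exact: green_approx_ge0.
by apply: le_trans (green_le 0 0) _; rewrite /green_approx rn0 lnp_le1 // mulr0.
Qed.

(** In the ball of index [j] the iterate [H^j s] has norm at most [32 ^ (2 ^ j)]. *)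
Lemma green_bounded j s : en2 (hmap j s) < 1 -> green s <= ln 32.
Proof.
move=> s1; apply: le_trans (green_le j s) _.
have b0 := hscale_gt0 R j.
have l32 : 0 <= ln 32 :> R by rewrite ln_ge0 // ler1n.
rewrite /green_approx exprVn ler_pdivrMl ?exprn_gt0 //.
rewrite lnp_leP ?mulr_ge0 ?exprn_ge0 //.
have -> : expR (2 ^+ j * ln 32) = (hscale R j)^-1.
  by rewrite -natrX expRM_natl lnK ?posrE // /hscale exprVn invrK.
have : rn (hmap j s) <= 1 by apply: rn_le_en2 => //; rewrite expr1n ltW.
by rewrite /hmap rnZ rn_real gtr0_norm // -ler_pdivlMl // mulr1.
Qed.

(** Small enough for the ball of index 0, where it is divided by 32, and large enough for the square
    in [henon] to outweigh the shift. *)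
Definition escaping : X := \row_j ((j == 0)%:R * 16).

(** While [z_0] dominates and is at least 16, the new first coordinate is at least [rn z_0 ^ 2 / 8]:
    the quantity [rn z_0 / 8], initially 2, is at least squared at each step. *)
Lemma escaping_grows m : let z := iter m (@henon R n) escaping in
  [/\ forall j, rn (z 0 j) <= rn (z 0 0), 8 * 2 ^+ (2 ^ m) <= rn (z 0 0) &
      2 * rn (z 0 0) <= rn (henon z 0 0)].
Proof.
have pow2 l : 2 <= 2 ^+ (2 ^ l) :> R.
  by rewrite -{1}[2]expr1 ler_weXn2l ?ler1n ?expn_gt0.
move=> z; suff [zj zm] : (forall j, rn (z 0 j) <= rn (z 0 0)) /\
    8 * 2 ^+ (2 ^ m) <= rn (z 0 0).
  split=> //; rewrite mxE eqxx mul1r rnM rnV rn_nat ler_pdivlMl //.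
  have z16 : 16 <= rn (z 0 0).
    by have := pow2 m; lra.
  have := rn_leD (z 0 0 ^+ 2) (- z 0 (ord_pred 0)); rewrite opprK rnN rnX addrC.
  by have := zj (ord_pred 0); rewrite [z 0 0 ^+ 2 + _]addrC; nra.
rewrite {}/z; elim: m => [|m [zj zm]].
  split=> [j|]; rewrite /= !mxE !rnM !rn_nat eqxx ?mul1r.
    by rewrite ler_piMl //; case: (j == 0); rewrite ?ler01.
  by rewrite expr1; lra.
rewrite iterS; set z := iter m _ _ in zj zm *.
have z16 : 16 <= rn (z 0 0).
  by have := pow2 m; lra.
have H0 : rn (z 0 0) ^+ 2 / 8 <= rn (henon z 0 0).
  rewrite mxE eqxx mul1r rnM rnV rn_nat ler_pdivlMl //.
  have := rn_leD (z 0 0 ^+ 2) (- z 0 (ord_pred 0)); rewrite opprK rnN rnX addrC.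
  by have := zj (ord_pred 0); rewrite [z 0 0 ^+ 2 + _]addrC; nra.
split=> [j|].
  have [->//|j0] := eqVneq j 0; apply: le_trans H0.
  rewrite mxE (negbTE j0) mul0r addr0 rnM rnV rn_nat.
  by have := zj (ord_pred j); nra.
apply: le_trans H0; rewrite ler_pdivlMr // expnSr exprM.
have : (8 * 2 ^+ (2 ^ m)) ^+ 2 <= rn (z 0 0) ^+ 2.
  by rewrite lerXn2r ?nnegrE ?rn_ge0 ?mulr_ge0 ?exprn_ge0.
by apply: le_trans; rewrite exprMn; set x := _ ^+ 2; lra.
Qed.

Lemma green_escaping : ln 2 <= green escaping.
Proof.
apply: green_ge => m; rewrite /green_approx exprVn ler_pdivlMl ?exprn_gt0 //.
have [_ zm _] := escaping_grows m; set z := iter m _ _ in zm *.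
rewrite -natrX mulr_natl -lnXn // /lnp ler_ln ?posrE ?exprn_gt0 ?max1_gt0 //.
rewrite le_max; apply/orP; right; apply: le_trans (coord_le_rn z 0).
by apply: le_trans zm; rewrite ler_peMl ?exprn_ge0 // ler1n.
Qed.

Lemma escaping_in : en2 (hmap 0 escaping) < 1.
Proof.
rewrite en2Z rn_real /hscale expr1 /en2 (bigD1 0) //= big1 => [|j j0].
  rewrite mxE eqxx mul1r rn_nat addr0 gtr0_norm ?invr_gt0 //; lra.
by rewrite mxE (negbTE j0) mul0r rn0 expr0n.
Qed.

(** In the ball of radius [r] the map shrinks the norm, but on this orbit it doubles the dominating
    coordinate. *)
Lemma escaping_notin_basin psi Phi r mu m : fb_map (@henon R n) psi Phi r mu ->
  ~ rn (iter m (@henon R n) escaping) < r.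
Proof.
move=> [r0 mu0 mu1 contr _ _ _ _ _] er; have := contr _ (ltW er).
have [zj zm z2] := escaping_grows m; set z := iter m _ _ in zj zm z2 er *.
have zE : rn z <= rn (z 0 0) by apply: rn_le_coord; rewrite ?rn_ge0.
have := coord_le_rn (henon z) 0 => H1 H2.
have z0 : 0 < rn (z 0 0) by apply: lt_le_trans zm; rewrite mulr_gt0 ?exprn_gt0.
by have := rn_ge0 z; nra.
Qed.

End GreenFunction.

(** * Closed discs in exhausted domains *)

Section Disc.
Variables (R : realType) (k : nat).
Local Notation C := R[i].
Local Notation X := (Ck R k).

(** Compactness of the closed disc, run on the square [[-1, 1]^2]: the predicate [P] accepts
    parameters outside of the disc for every [m]. *)
Lemma closed_disc_exhaustion (U : nat -> set X) (a b : X) :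
  (forall m, open (U m)) -> (forall m, U m `<=` U m.+1) ->
  (forall t : C, rn t <= 1 -> exists m, U m (a + t *: b)) ->
  exists m, forall t : C, rn t <= 1 -> U m (a + t *: b).
Proof.
move=> Uo Uinc Ut.
have Ule m m' : (m <= m')%N -> U m `<=` U m'.
  elim: m' => [|m' IH]; first by rewrite leqn0 => /eqP ->.
  rewrite leq_eqVlt => /orP[/eqP -> //|]; rewrite ltnS => /IH H z /H; exact: Uinc.
pose pt (x : R * R) : C := (x.1 +i* x.2)%C.
have ptE (x y : R * R) : rn (pt x - pt y) <= `|x.1 - y.1| + `|x.2 - y.2|.
  exact: le_trans (rn_le_ReIm _) _.
pose P (m : nat) (x : R * R) : Prop := 1 < rn (pt x) \/ U m (a + pt x *: b).
have K : compact (`[(-1 : R), 1]%classic `*` `[(-1 : R), 1]%classic).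
  by apply: compact_setX; exact: segment_compact.
have /compact_near_coveringP/(_ _ \oo P) := K.
have loc (x : R * R) (d : R) : 0 < d -> (\forall y \near x, rn (pt y - pt x) < d).
  move=> d0; have d2 : 0 < d / 2 by rewrite divr_gt0.
  have H1 : nbhs x.1 (ball x.1 (d / 2)) by exact: nbhsx_ballx.
  have H2 : nbhs x.2 (ball x.2 (d / 2)) by exact: nbhsx_ballx.
  exists (ball x.1 (d / 2), ball x.2 (d / 2)); first by split.
  move=> y [/= y1 y2]; apply: le_lt_trans (ptE _ _) _; rewrite [ltRHS]splitr.
  by apply: ltrD; rewrite distrC.
case=> [x _|M _ MP].
  have [x1|x1] := ltP 1 (rn (pt x)).
    have d0 : 0 < rn (pt x) - 1 by rewrite subr_gt0.
    exists ([set y | rn (pt y - pt x) < rn (pt x) - 1], setT).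
      by split; [exact: loc|exact: filterT].
    move=> [y m] /= [yx _]; left.
    by have := rn_leD (pt x) (pt y); rewrite (rnBC (pt x)); lra.
  have [m Um] := Ut _ x1; have /open_rnP /(_ _ Um) [e e0 eP] := Uo m.
  have b1 : 0 < rn b + 1 by rewrite ltr_wpDl ?rn_ge0.
  have d0 : 0 < e / (rn b + 1) by rewrite divr_gt0.
  exists ([set y | rn (pt y - pt x) < e / (rn b + 1)], [set m' | (m <= m')%N]).
    by split; [exact: loc|exact: nbhs_infty_ge].
  move=> [y m'] /= [yx mm]; right; apply: (Ule m m' mm).
  apply: eP; rewrite opprD addrACA subrr add0r -scalerBl rnZ.
  move: yx; rewrite ltr_pdivlMr //; have := rn_ge0 (pt y - pt x); nra.
exists M => t t1; have [] := MP M (leqnn M) (complex.Re t, complex.Im t).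
- have := le_trans (rn_Re t) t1; have := le_trans (rn_Im t) t1.
  by rewrite !ler_norml => H1 H2; split; rewrite /= in_itv.
- by rewrite /pt; case: (t) t1 => x y /= H; rewrite ltNge H.
- by rewrite /pt; case: (t).
Qed.

Lemma disc_approx_line (F : X -> C) (a b : X) (B : set X) :
  (forall t : C, rn t <= 1 -> B (a + t *: b)) ->
  (forall e : R, 0 < e -> exists2 g, entire1 g & forall z, B z -> rn (F z - g z) <= e) ->
  disc_approx (fun t => F (a + t *: b)).
Proof.
move=> Bt FB e e0; have e2 : 0 < e / 2 by rewrite divr_gt0.
have [g ge Fg] := FB _ e2; have [p pp gp] := ge (rn a + rn b) _ e2.
have [q qE] := polyfun_line a b pp; exists q => t t1.
rewrite -qE (le_trans (rn_triB (g (a + t *: b)) _ _)) // [leRHS]splitr.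
apply: lerD; first by apply: Fg; exact: Bt.
apply: gp; rewrite cball0 (le_trans (rnD _ _)) // lerD2l rnZ.
by rewrite ler_piMl ?rn_ge0.
Qed.

End Disc.

(** * The sub-mean value inequality for the Green function *)

Section GreenSubmean.
Variables (R : realType) (n : nat).
Local Notation C := R[i].
Local Notation X := (Ck R n.+2).
Local Notation mu := (@lebesgue_measure R).
Local Notation I := `[0%R, (2 * pi)%R]%classic.

(** The disc is viewed as the unit ball of [Ck R 1], where [approx_comp] applies. *)
Lemma disc_approx_comp k (phi : C -> Ck R k) (f : Ck R k -> C) :
  (forall i, disc_approx (fun t => phi t 0 i)) -> entire1 f ->
  disc_approx (fun t => f (phi t)).
Proof.
move=> phiP fe e e0.
have ap i : approx (cball (0 : Ck R 1) 1) (fun z : Ck R 1 => phi (z 0 0) 0 i).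
  move=> d /(phiP i) [h hP]; exists (fun z : Ck R 1 => h.[z 0 0]).
    by apply: polyfun_horner; exact: polyfun_coord.
  by move=> z; rewrite cball0 => z1; apply: hP; apply: le_trans z1; exact: coord_le_rn.
have [q qp qP] := approx_comp ap fe e0.
have [h hE] := polyfun_line 0 (const_mx 1) qp; exists h => t t1.
have := qP (const_mx t); rewrite cball0 mxE.
have -> : const_mx t = 0 + t *: const_mx 1 :> Ck R 1.
  by apply/rowP => j; rewrite !mxE add0r mulr1.
rewrite hE; apply; apply: rn_le_coord => // i.
by rewrite !mxE add0r mulr1.
Qed.

Lemma ccont_rn_vector k (G : R -> Ck R k) : (forall i, ccont (fun t => G t 0 i)) ->
  continuous (fun t => rn (G t)).
Proof.
move=> Gc; apply/continuous_realP => t e e0.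
have : \forall s \near t, forall i, rn (G s 0 i - G t 0 i) <= e.
  apply: (filter_forall (F := nbhs t)) => i; have [d d0 dP] := Gc i t e e0.
  apply/nbhs_ballP; by exists d => //= s; rewrite /ball /= distrC => /dP.
move=> /nbhs_ballP [d d0 dP]; exists d => // s st.
apply: le_trans (rn_distB _ _) _; apply: rn_le_coord => [|i]; first exact: ltW.
by rewrite !mxE; apply: dP; rewrite /ball /= distrC.
Qed.

(** Each [green_approx m] satisfies the inequality by [submean_vector]. The sequence is nonnegative
    and decreasing, so its term of index 0 dominates it and the integrals converge. *)
Lemma green_submean (phi : C -> X) : (forall i, disc_approx (fun t => phi t 0 i)) ->
  ((green (phi 0))%:E <=
    ((2 * pi)^-1)%:E * \int[mu]_(t in I) (green (phi (cis t)))%:E)%E.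
Proof.
move=> phiP; have pi2 : 0 < 2 * pi :> R by rewrite mulr_gt0 ?pi_gt0.
pose f m (t : R) := green_approx m (phi (cis t)).
have hphi m i : disc_approx (fun t => iter m (@henon R n) (phi t) 0 i).
  exact: disc_approx_comp (entire_iter m (@henon_entire R n) i).
have lc m : continuous (fun t => lnp (rn (iter m (@henon R n) (phi (cis t))))).
  apply: continuous_lnp; apply: ccont_rn_vector => i; exact: (disc_approx_ccont (hphi m i)).
have fc m : continuous (f m).
  move=> t; apply: (cvgM (F := nbhs t) (f := fun=> 2^-1 ^+ m)); first exact: cvg_cst.
  exact: (lc m t).
have fi m : mu.-integrable I (EFin \o f m) by exact: (continuous_integrable _ _ (fc m)).
have mI : measurable (I : set (measurableTypeR R)) by exact: measurable_itv.
have mf m := measurable_int mu (fi m).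
have lim t : I t -> (EFin \o f m) t @[m --> \oo] --> (green (phi (cis t)))%:E.
  by move=> _; apply: cvg_EFin; [apply: nearW|exact: green_cvg].
have bnd m t : I t -> (`|(EFin \o f m) t| <= (EFin \o f 0%N) t)%E.
  move=> _; rewrite /= lee_fin ger0_norm ?green_approx_ge0 //.
  exact: green_approx_le.
have fing t : I t -> (EFin \o f 0%N) t \is a fin_num by [].
have cv := dominated_cvg mI mf lim fing (fi 0%N) bnd.
rewrite -lee_pdivrMl ?invr_gt0 // invrK -EFinM.
apply: (cvge_ge _ cv); apply: nearW => m.
have -> : (\int[mu]_(x in I) (EFin \o f m) x = (cmean (f m))%:E)%E.
  have fin := integrable_fin_num mI (fi m).
  exact/esym/fineK.
rewrite lee_fin; apply: (@le_trans _ _ (2 * pi * green_approx m (phi 0))).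
  by rewrite ler_pM2l // green_le.
rewrite /f /green_approx cmeanZ // mulrCA ler_pM2l ?exprn_gt0 ?invr_gt0 //.
exact: (submean_vector (H := fun t => iter m (@henon R n) (phi t))).
Qed.

End GreenSubmean.

(** * Transport to the complement of the variety *)

Section DerivativeBounds.
Variable R : realType.
Local Notation C := R[i].

Lemma diff_le (V W : normedModType C) (f : V -> W) (a : V) (L d : R) :
  differentiable f a -> 0 < d ->
  (forall h, rn h <= d -> rn (f (a + h) - f a) <= L * rn h) ->
  forall v, rn ('d f a v) <= L * rn v.
Proof.
move=> fa d0 fL v; have [->|v0] := eqVneq v 0.
  by rewrite linear0 !rn0 mulr0.
have vn : 0 < rn v by rewrite lt_neqAle rn_ge0 eq_sym rn_eq0 v0.
rewrite -ler_pdivrMr //; apply/ler_addgt0Pr => e e0; rewrite ler_pdivrMr //.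
have [d' d'0 H] := diff_rn fa e0.
pose t := Num.min d (d' / 2) / rn v.
have m0 : 0 < Num.min d (d' / 2) by rewrite lt_min d0 divr_gt0.
have t0 : 0 < t by rewrite divr_gt0.
pose c : C := (t%:C)%C.
have cv : rn (c *: v) = Num.min d (d' / 2).
  by rewrite rnZ rn_real gtr0_norm // divfK // gt_eqF.
have cvd : rn (c *: v) <= d by rewrite cv ge_min lexx.
have cvd' : rn (c *: v) < d'.
  by rewrite cv (le_lt_trans (y := d' / 2)) ?ge_min ?lexx ?orbT //; lra.
have H1 := H _ cvd'; have H2 := fL _ cvd.
have : rn ('d f a (c *: v)) <= (L + e) * rn (c *: v).
  rewrite (le_trans (rn_leD _ (f (a + c *: v) - f a))) // rnBC mulrDl addrC.
  exact: lerD.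
rewrite linearZ /= rnZ [rn (c *: v)]rnZ rn_real gtr0_norm // mulrCA.
by rewrite ler_pM2l.
Qed.

Lemma diff_left_inverse (V W : normedModType C) (f : V -> W) (g : W -> V) (a v : V) :
  differentiable f a -> differentiable g (f a) -> (\forall x \near a, g (f x) = x) ->
  'd g (f a) ('d f a v) = v.
Proof.
move=> fa ga gf.
have dgf : differentiable (g \o f) a by exact: differentiable_comp.
have -> : 'd g (f a) ('d f a v) = 'd (g \o f) a v by rewrite (diff_comp fa ga).
have -> : 'd (g \o f) a v = 'D_v (g \o f) a by rewrite deriveE.
by rewrite (near_eq_derive v (g := id) gf) derive_id.
Qed.

Lemma derive1_affine (V W : normedModType C) (f : V -> W) (q w : V) :
  (fun t : Cplx R => f (q + (t : C) *: w))^`() 0 = 'D_w f q.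
Proof.
rewrite /derive1 /derive.
suff -> : (fun h : C => h^-1 *: (f (q + (h + 0) *: w) - f (q + (0 : C) *: w))) =
  (fun h : C => h^-1 *: ((f \o shift q) (h *: w) - f q)) by [].
by apply/funext => h; rewrite /= addr0 scale0r addr0 [q + _]addrC.
Qed.

End DerivativeBounds.

(** * The two domains in the complement of the variety *)

Section Transport.
Variables (R : realType) (n : nat).
Local Notation C := R[i].
Local Notation X := (Ck R n.+2).
Local Notation henon := (@henon R n).
Variables (F psi Phi0 : X -> X) (r mu : R) (p : X).
Hypothesis fb : fb_map F psi Phi0 r mu.

Let Psi (w : X) : X := psi w + p.
Let Phi (z : X) : X := Phi0 (z - p).
Let U m : set X := [set z | rn (iter m F (z - p)) < r].
Let D1 : set X := \bigcup_m U m.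

Hypothesis Fe : entire F.

Let sub_entire (c : X) : entire (fun z : X => z - c).
Proof.
apply: entireB; first exact: entire_id.
by move=> i; apply: entire1_polyfun; exact: polyfun_const.
Qed.

Let U_open m : open (U m).
Proof.
apply/open_rnP => z zr; have d0 : 0 < r - rn (iter m F (z - p)) by rewrite subr_gt0.
have e1 : entire (fun z => iter m F (z - p)).
  exact: (entire_comp (sub_entire p) (entire_iter m Fe)).
have [d d1 dP] := entire_continuous z e1 d0; exists d => // y /dP H.
by rewrite /U /= (le_lt_trans (rn_leD _ (iter m F (z - p)))) // -ltrBrDr.
Qed.

Let U_inc m : U m `<=` U m.+1.
Proof.
case: fb => r0 mu0 mu1 contr _ _ _ _ _ z zr; rewrite /U /= -[F _]/(iter m.+1 F (z - p)) iterS.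
apply: le_lt_trans (contr _ (ltW zr)) _; apply: le_lt_trans zr.
by rewrite ler_piMl ?rn_ge0 // ltW.
Qed.

Let D1_open : open D1. Proof. exact: (open_bigcup_seq U_open). Qed.

Let Psi_entire : entire Psi.
Proof.
rewrite (_ : Psi = (fun z => z - (- p)) \o psi).
  exact: (entire_comp (fb_entire fb) (sub_entire _)).
by apply/funext => w; rewrite /= opprK.
Qed.

Let PsiD w : D1 (Psi w).
Proof. by have [m mw] := fb_basin fb w; exists m => //; rewrite /U /= addrK. Qed.

Let PhiK w : Phi (Psi w) = w.
Proof. by rewrite /Phi /Psi addrK (fb_PhiK fb). Qed.

Let PsiK z : D1 z -> Psi (Phi z) = z.
Proof. by case=> m _ zm; rewrite /Phi /Psi (fb_psiK fb zm) subrK. Qed.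

Let Phi_approx m (e : R) : 0 < e -> exists2 G : X -> X, entire G &
  forall z, U m z -> rn (Phi z - G z) <= e.
Proof.
move=> e0; have [G Ge GP] := fb_approx fb m e0.
exists (fun z => G (z - p)) => [|z zm]; last exact: GP.
exact: (entire_comp (sub_entire p) Ge).
Qed.

Let Phi_approxi m i (e : R) : 0 < e -> exists2 g : X -> C, entire1 g &
  forall z, U m z -> rn (Phi z 0 i - g z) <= e.
Proof.
move=> e0; have [G Ge GP] := Phi_approx m e0.
exists (fun z => G z 0 i) => // z /GP; apply: le_trans.
by have := coord_le_rn (Phi z - G z) i; rewrite !mxE.
Qed.

Let Phi_local a : D1 a -> exists2 s : R, 0 < s &
  cball a s `<=` D1 /\ forall i, approx (cball a s) (fun z => Phi z 0 i).
Proof.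
case=> m _ am; have /open_rnP /(_ _ am) [e e0 eP] := @U_open m.
have near y : cball a (e / 2) y -> U m y.
  by move=> ya; apply: eP; apply: le_lt_trans ya _; lra.
exists (e / 2); first by rewrite divr_gt0.
split=> [y /near ym|i]; first by exists m.
apply: approx_lim => d /(Phi_approxi m i) [g ge gP]; exists g => [|y /near /gP //].
by apply: approx_sub (ge (e / 2 + rn a)) => y; rewrite cball0; exact: cball_bounded.
Qed.

Let Phi_diff a : D1 a -> differentiable Phi a.
Proof. by move=> /Phi_local [s s0 [_ sa]]; exact: approx_differentiable sa. Qed.

Let G_open (G : X -> X) (B : set X) : entire G -> open B ->
  open [set z | D1 z /\ B (G (Phi z))].
Proof.
move=> Ge Bo; apply/open_rnP => z [zD zB].
have /open_rnP /(_ _ zD) [e e0 eP] := D1_open.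
have /open_rnP /(_ _ zB) [d d0 dP] := Bo.
have GP : differentiable (G \o Phi) z.
  by apply: differentiable_comp; [exact: Phi_diff|exact: entire_differentiable].
have /continuous_rnP /(_ _ d0) [d' d'0 d'P] := differentiable_continuous GP.
exists (Num.min e d'); first by rewrite lt_min e0.
move=> y; rewrite lt_min => /andP[/eP yD /d'P yB]; split=> //; exact: dP.
Qed.

Let Om j : set X := [set z | D1 z /\ unit_ball R n.+2 (hmap j (Phi z))].
Let O : set X := \bigcup_j Om j.

Let Om_open j : open (Om j).
Proof. by apply: G_open; [exact: hmap_entire|exact: open_unit_ball]. Qed.

Let Om_inc j : Om j `<=` Om j.+1.
Proof.
by move=> z [zD /unit_ballE zb]; split=> //; apply/unit_ballE; exact: hmap_contr1.
Qed.

Let Om_le i j : (i <= j)%N -> Om i `<=` Om j.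
Proof.
elim: j => [|j IH]; first by rewrite leqn0 => /eqP ->.
rewrite leq_eqVlt => /orP[/eqP -> //|]; rewrite ltnS => /IH H z /H; exact: Om_inc.
Qed.

(** As the image of the ball under an entire map, [Om j] is connected and receives discs from the
    ball. *)
Let OmE j : Om j = (Psi \o @hmap_inv R n j) @` unit_ball R n.+2.
Proof.
apply/seteqP; split=> [z [zD zb]|_ [w wb <-]].
  by exists (hmap j (Phi z)) => //=; rewrite hmapK PsiK.
by split; [exact: PsiD|rewrite /= PhiK hmap_invK].
Qed.

Let Psi_hinv_entire j : entire (Psi \o @hmap_inv R n j).
Proof. exact: entire_comp (@hmap_inv_entire R n j) Psi_entire. Qed.

Let O_sup j : Om j `<=` O.
Proof. exact: bigcup_sup. Qed.

Let Om0 j : Om j (Psi 0).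
Proof.
have henon0 : henon 0 = 0 by apply/rowP => i; rewrite !mxE expr0n mulr0 addr0 mulr0.
split; first exact: PsiD.
apply/unit_ballE; rewrite PhiK /hmap.
have -> : iter j henon 0 = 0 by elim: j => //= j ->.
by rewrite scaler0 /en2 big1 // => i _; rewrite mxE rn0 expr0n.
Qed.

Let O_domain : domain O.
Proof.
split.
- exact: (open_bigcup_seq Om_open).
- apply: bigcup_connected; first by exists (Psi 0) => j _; exact: Om0.
  move=> j _; rewrite OmE; apply: continuous_connected_image.
    exact: connected_unit_ball.
  exact: (entire_continuous_fun (Psi_hinv_entire j)).
- exists (Psi 0); exact: (O_sup (Om0 0%N)).
Qed.

Let Om_ball j : biholomorphic (Om j) (unit_ball R n.+2).
Proof.
exists (@hmap R n j \o Phi), (Psi \o @hmap_inv R n j); split.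
- split; first exact: Om_open.
  move=> z [zD _]; apply: differentiable_comp; first exact: Phi_diff.
  by apply: entire_differentiable; exact: hmap_entire.
- split; first exact: open_unit_ball.
  by move=> z _; exact: (entire_differentiable _ (Psi_hinv_entire j)).
- by move=> z [zD zb] /=; rewrite hmapK PsiK.
- move=> y yb /=; rewrite PhiK hmap_invK; split=> //; split; first exact: PsiD.
  by rewrite PhiK hmap_invK.
Qed.

(* Near [s] the maps [hmap m] tend to [0] uniformly, hence so do their
   differentials, by the Cauchy estimate. *)
Let small_differentials z (v : X) (al : R) : O z -> 0 < al -> exists m,
  [/\ Om m z, en2 (hmap m (Phi z)) <= 8^-1 &
      en2 ('d (@hmap R n m) (Phi z) v) <= al ^+ 2 / 4].
Proof.
case=> j _ [zD /unit_ballE zb] al0; set s := Phi z in zb *.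
have W_open : open [set w : X | en2 (hmap j w) < 1].
  have /open_rnP bo := @open_unit_ball R n.+2.
  apply/open_rnP => w wb; have /unit_ballE/bo [e e0 eP] := wb.
  have [d d0 dP] := entire_continuous w (@hmap_entire R n j) e0.
  by exists d => [//|y /dP /eP /unit_ballE].
have /open_rnP /(_ _ zb) [e e0 eP] := W_open.
pose d := e / 2; have d0 : 0 < d by rewrite divr_gt0.
have near y : cball s d y -> en2 (hmap j y) < 1.
  by move=> ys; apply: eP; apply: le_lt_trans ys _; rewrite /d; lra.
have k0 : (0 : R) < n.+2%:R by rewrite ltr0n.
(* With [K = n + 2], the Cauchy estimate bounds the differential at [v] by
   [2 * M / d * rn v <= al / (2 * K)], whence [en2] is at most
   [K * (al / (2 * K)) ^ 2 <= al ^ 2 / 4]. *)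
pose M := al * d / (4 * n.+2%:R * (rn v + 1)).
have v1 : 0 < rn v + 1 by rewrite ltr_wpDl ?rn_ge0.
have M0 : 0 < M by rewrite divr_gt0 ?mulr_gt0.
have m0 : 0 < Num.min (M ^+ 2) 8^-1 by rewrite lt_min (exprn_gt0 _ M0) invr_gt0 ltr0n.
have h0 : (0 : R) <= 2^-1 by rewrite invr_ge0.
have h1 : (2^-1 : R) < 1 by lra.
have [N /(_ N (leqnn N))] := geometric_small 1 h0 h1 m0.
rewrite mul1r le_min => /andP[NM N8].
have small y : cball s d y -> en2 (hmap (j + N) y) <= 2^-1 ^+ N.
  move=> /near /ltW yj; apply: le_trans (hmap_contrI N yj) _.
  by rewrite ler_piMr ?exprn_ge0.
exists (j + N)%N; split.
- by apply: (Om_le (leq_addr N j)); split=> //; apply/unit_ballE.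
- by apply: le_trans N8; apply: small; rewrite /cball /= subrr rn0 ltW.
have fM y : cball s d y -> rn (hmap (j + N) y) <= M.
  by move=> /small yN; apply: rn_le_en2 (ltW M0) _; exact: le_trans NM.
have ha := @hmap_entire R n (j + N).
have L0 : 0 <= 2 * M / d by rewrite ltW // divr_gt0 // mulr_gt0.
have lip h : rn h <= d / 2 -> rn (hmap (j + N) (s + h) - hmap (j + N) s) <= 2 * M / d * rn h.
  move=> hd; apply: rn_le_coord => [|i].
    by rewrite mulr_ge0 ?rn_ge0.
  have ai : approx (cball s d) (fun y => hmap (j + N) y 0 i).
    by apply: approx_sub (ha i (d + rn s)) => y; rewrite cball0; exact: cball_bounded.
  rewrite !mxE; have := approx_cauchy1 d0 ai (M := M) _ hd; rewrite !mxE; apply.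
  by move=> y /fM; apply: le_trans; exact: coord_le_rn.
have hs := entire_differentiable s ha.
have d2 : 0 < d / 2 by rewrite divr_gt0.
have dv := diff_le hs d2 lip v.
apply: le_trans (en2_le_rn _) _.
have B0 : 0 <= 2 * M / d * rn v.
  by rewrite mulr_ge0 ?rn_ge0.
apply: (@le_trans _ _ (n.+2%:R * (2 * M / d * rn v) ^+ 2)).
  by rewrite ler_wpM2l // lerXn2r ?nnegrE ?rn_ge0.
have -> : 2 * M / d * rn v = al / (2 * n.+2%:R) * (rn v / (rn v + 1)).
  by rewrite /M; field; rewrite !gt_eqF.
have q1 : rn v / (rn v + 1) <= 1 by rewrite ler_pdivrMr // mul1r lerDl.
have q0 : 0 <= rn v / (rn v + 1) by rewrite divr_ge0 ?rn_ge0 // ltW.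
have k1 : (1 : R) <= n.+2%:R by rewrite ler1n.
set q := rn v / _ in q0 q1 *; set K := n.+2%:R in k0 k1 *.
have -> : K * (al / (2 * K) * q) ^+ 2 = al ^+ 2 / 4 * (q ^+ 2 / K).
  by field; rewrite gt_eqF.
rewrite ler_piMr ?divr_ge0 ?sqr_ge0 // ler_pdivrMr // mul1r.
by apply: le_trans k1; rewrite exprn_ile1.
Qed.

(** The differential of [hmap m] at [Phi z] sends ['d Phi z v] to a vector [w] so short that the
    affine disc [q + t * w / al] stays in the ball: its [en2] is at most
    [2 * (1 / 8) + 2 * (1 / 4)]. Carried back by [Th], it is a disc in [O] through [z] with
    derivative [v / al], for every [al > 0]. *)
Let O_kobayashi z v : O z -> kobayashi O z v = 0%E.
Proof.
move=> zO; apply/le_anti/andP; split; last first.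
  by apply: le_ereal_inf_tmp => _ [a [a0 _] <-]; rewrite lee_fin ltW.
apply/lee_addgt0Pr => al al0; rewrite add0e; apply: ereal_inf_lbound.
exists al => //; split=> //.
have zD : D1 z by case: zO => j _ [].
have [m [zm q8 w4]] := small_differentials ('d Phi z v) zO al0.
set q := hmap m (Phi z) in q8 *; set w := 'd (@hmap R n m) (Phi z) _ in w4.
pose Th := Psi \o @hmap_inv R n m.
have The : entire Th by exact: Psi_hinv_entire.
pose w' := ((al^-1)%:C)%C *: w.
pose aff (t : Cplx R) : X := q + (t : C) *: w'.
have affd (t : Cplx R) : differentiable aff t.
  apply: (differentiableD (f := cst q) (g := fun t : Cplx R => (t : C) *: w')).
    exact: differentiable_cst.
  by apply: (differentiableZl (k := fun t : Cplx R => (t : C))).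
have ballE (t : C) : rn t < 1 -> unit_ball R n.+2 (aff t).
  move=> t1; apply/unit_ballE; apply: le_lt_trans (en2D _ _) _.
  rewrite [en2 (t *: w')]en2Z [en2 w']en2Z rn_real ger0_norm ?invr_ge0 ?(ltW al0) //.
  rewrite exprVn.
  have w5 : (al ^+ 2)^-1 * en2 w <= 4^-1.
    by rewrite ler_pdivrMl ?exprn_gt0.
  have t2 : rn t ^+ 2 <= 1 by rewrite exprn_ile1 ?rn_ge0 // ltW.
  have w6 : 0 <= (al ^+ 2)^-1 * en2 w by rewrite mulr_ge0 ?invr_ge0 ?sqr_ge0 ?en2_ge0.
  have : rn t ^+ 2 * ((al ^+ 2)^-1 * en2 w) <= 4^-1.
    by rewrite -[leRHS]mul1r ler_pM ?sqr_ge0.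
  by move: q8; lra.
have discE (t : C) : unit_disc R t -> rn t < 1.
  by rewrite /unit_disc /= -ltcR -rnE.
exists (Th \o aff); split.
- split.
    apply/open_rnP => t /discE t1; exists (1 - rn t); first by rewrite subr_gt0.
    move=> y yt; rewrite /unit_disc /= rnE -[ltRHS]/((1 : R)%:C)%C ltcR.
    by have := rn_leD y t; move: yt; set a := rn _; set b := rn _; set c := rn _; lra.
  move=> t _; apply: differentiable_comp; first exact: affd.
  exact: entire_differentiable.
- move=> _ [t /discE /ballE tb <-].
  have thO : Om m (Th (aff t)) by rewrite OmE; exists (aff t).
  exact: O_sup thO.
- by rewrite /= /aff scale0r addr0 /Th /= hmapK PsiK.
- have -> : (Th \o aff)^`() 0 = 'D_w' Th q.
    exact: derive1_affine.
  rewrite deriveE; last exact: entire_differentiable.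
  rewrite linearZ /=; congr (_ *: _).
  pose Xi := @hmap R n m \o Phi.
  have Phid := Phi_diff zD.
  have hd := entire_differentiable (Phi z) (@hmap_entire R n m).
  have Xid : differentiable Xi z := differentiable_comp Phid hd.
  have XiE : 'd Xi z v = w.
    rewrite /w -[RHS]/(('d (@hmap R n m) (Phi z) \o 'd Phi z) v).
    by rewrite -(diff_comp Phid hd).
  have Thd : differentiable Th (Xi z) := entire_differentiable (Xi z) The.
  have ThX : \forall y \near z, Th (Xi y) = y.
    have /open_rnP /(_ _ zD) [e e0 eP] := D1_open.
    apply/nbhs_rn; exists e; first exact: e0.
    by move=> y /eP yD; rewrite /Th /Xi /= hmapK PsiK.
  rewrite -XiE; exact: diff_left_inverse Xid Thd ThX.
Qed.

Let O_psh : plurisubharmonic O (fun z => (green (Phi z))%:E).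
Proof.
split.
- by move=> z _; exact: ltry.
- move=> z zO c gc.
  (* One index already lies below [c], and [green_approx m], which is continuous, bounds [green]
     from above nearby. *)
  have [m mc] : exists m, green_approx m (Phi z) < c.
    by apply: green_lt; rewrite -lte_fin.
  have zD : D1 z by case: zO => j _ [].
  pose h (y : X) := iter m henon (Phi y).
  have he := entire_iter m (@henon_entire R n).
  have hd : differentiable h z.
    exact: (differentiable_comp (Phi_diff zD) (entire_differentiable (Phi z) he)).
  have d0 : 0 < c - green_approx m (Phi z) by rewrite subr_gt0.
  have /continuous_rnP /(_ _ d0) [d d1 dP] := differentiable_continuous hd.
  apply/nbhs_rn; exists d; first exact: d1.
  move=> y /dP hy; suff : green (Phi y) < c by rewrite -lte_fin.
  apply: le_lt_trans (green_le m _) _.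
  have q0 : 0 < 2^-1 ^+ m :> R by rewrite exprn_gt0 // invr_gt0.
  have q1 : 2^-1 ^+ m <= 1 :> R by rewrite exprn_ile1 ?invr_ge0 // invf_le1 // ler1n.
  have B : lnp (rn (h y)) <= lnp (rn (h z)) + rn (h y - h z).
    apply: lnp_lip; first exact: rn_ge0.
    by rewrite addrC; exact: rn_leD.
  move: hy mc.
  rewrite -[green_approx m (Phi y)]/(2^-1 ^+ m * lnp (rn (h y))).
  rewrite -[green_approx m (Phi z)]/(2^-1 ^+ m * lnp (rn (h z))).
  move: B q0 q1 (rn_ge0 (h y - h z)); set a := lnp (rn (h y)).
  set b := lnp (rn (h z)); set q := (2^-1 : R) ^+ m; set t := rn (h y - h z).
  by move: a b q t => a b q t; nra.
- move=> a b abO.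
  (* By compactness the closed disc lies in a single [U m], on which [Phi] is a uniform limit of
     entire maps. *)
  have abU : exists m, forall t : C, rn t <= 1 -> U m (a + t *: b).
    apply: closed_disc_exhaustion U_open U_inc _ => t t1.
    have [] : O (a + t *: b); last by move=> j _ [[m _ tm] _]; exists m.
    by apply: abO; rewrite rnE -[leRHS]/((1 : R)%:C)%C lecR.
  have [m abm] := abU.
  pose phi (t : C) := Phi (a + t *: b).
  have phiP i : disc_approx (fun t => phi t 0 i).
    apply: (disc_approx_line (F := fun z => Phi z 0 i) abm) => e e0.
    exact: Phi_approxi.
  have := green_submean phiP.
  by rewrite {1}/phi scale0r addr0.
Qed.

Let esc_O : O (Psi (escaping R n)).
Proof.
have e : Om 0 (Psi (escaping R n)).
  by split; [exact: PsiD|rewrite PhiK; apply/unit_ballE; exact: escaping_in].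
exact: O_sup e.
Qed.

Let O_short : short_Ck O.
Proof.
split; first exact: O_domain.
- by exists Om; split; [exact: Om_inc|by []|exact: Om_ball].
- by move=> z v; exact: O_kobayashi.
exists (fun z => (green (Phi z))%:E); split; first exact: O_psh.
  exists (ln 32) => z [j _ [_ /unit_ballE zb]]; rewrite lee_fin.
  exact: green_bounded zb.
exists (Psi 0), (Psi (escaping R n)); split.
- exact: (O_sup (Om0 0%N)).
- exact: esc_O.
rewrite !PhiK green0 => -[E]; have := green_escaping R n.
by rewrite -E leNgt ln_gt0 ?ltr1n.
Qed.

Variables (psi1 Phi1 : X -> X) (r1 mu1 : R).
Hypothesis fb1 : fb_map henon psi1 Phi1 r1 mu1.

Let V m : set X := [set z | D1 z /\ rn (iter m henon (Phi z)) < r1].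
Let D : set X := \bigcup_m V m.

Let ball_open : open [set w : X | rn w < r1].
Proof.
apply/open_rnP => z zr; exists (r1 - rn z); first by rewrite subr_gt0.
by move=> y yz; apply: le_lt_trans (rn_leD _ z) _; rewrite -ltrBrDr.
Qed.

Let D_open : open D.
Proof.
apply: open_bigcup_seq => m.
exact: (G_open (entire_iter m (@henon_entire R n)) ball_open).
Qed.

Let D_Psi w : D (Psi (psi1 w)).
Proof.
have [m mw] := fb_basin fb1 w; exists m => //; split; first exact: PsiD.
by rewrite PhiK.
Qed.

Let Psi1_entire : entire (Psi \o psi1).
Proof. exact: entire_comp (fb_entire fb1) Psi_entire. Qed.

Let D_PsiK z : D z -> Psi (psi1 (Phi1 (Phi z))) = z.
Proof. by case=> m _ [zD zm]; rewrite (fb_psiK fb1 zm) PsiK. Qed.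

Let Phi1_diff s m : rn (iter m henon s) < r1 -> differentiable Phi1 s.
Proof.
move=> sm; have he := entire_iter m (@henon_entire R n).
have /open_rnP /(_ _ sm) [d d0 dP] := ball_open.
have [d' d'0 d'P] := entire_continuous s he d0.
have near y : cball s (d' / 2) y -> rn (iter m henon y) < r1.
  by move=> ys; apply: dP; apply: d'P; apply: le_lt_trans ys _; lra.
apply: (approx_differentiable (s := d' / 2)); first by rewrite divr_gt0.
move=> i; apply: approx_lim => e /(fb_approx fb1 m) [G Ge GP].
exists (fun z => G z 0 i).
  by apply: approx_sub (Ge i (d' / 2 + rn s)) => y; rewrite cball0; exact: cball_bounded.
move=> y /near /GP; apply: le_trans.
by have := coord_le_rn (Phi1 y - G y) i; rewrite !mxE.
Qed.

Let D_fb : fatou_bieberbach D.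
Proof.
split.
- split; [exact: D_open| |by exists (Psi (psi1 0)); exact: D_Psi].
  have -> : D = (Psi \o psi1) @` setT.
    apply/seteqP; split=> [z zD|_ [w _ <-]]; last exact: D_Psi.
    by exists (Phi1 (Phi z)) => //=; exact: D_PsiK.
  apply: continuous_connected_image; first exact: connected_Ck.
  exact: (entire_continuous_fun Psi1_entire).
(* The image of the escaping point is missing from [D], since its orbit never enters the ball of
   radius [r1]. *)
- move=> DT; have [m _ [_]] : D (Psi (escaping R n)) by rewrite DT.
  by rewrite PhiK; exact: (escaping_notin_basin fb1).
- exists (Psi \o psi1), (Phi1 \o Phi); split.
  + split; first exact: openT.
    by move=> w _; exact: (entire_differentiable _ Psi1_entire).
  + split; first exact: D_open.
    move=> z [m _ [zD zm]].
    exact: (differentiable_comp (Phi_diff zD) (Phi1_diff zm)).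
  + move=> w _; split; first exact: D_Psi.
    by rewrite /= PhiK (fb_PhiK fb1).
  + by move=> z zD; split=> //=; exact: D_PsiK.
Qed.

Let D_sub : D `<=` O.
Proof.
move=> z [m _ [zD zm]]; have [j zj] := hmap_basin fb1 zm.
by exists j; [|split=> //; apply/unit_ballE].
Qed.

Lemma transported_domains : exists O D : set X,
  [/\ short_Ck O, fatou_bieberbach D, D `<=` O &
      forall z, O z -> exists w, z = psi w + p].
Proof.
exists O, D; split; [exact: O_short|exact: D_fb|exact: D_sub|].
by move=> z [j _ [zD _]]; exists (Phi z); rewrite -[RHS]/(Psi (Phi z)) PsiK.
Qed.

End Transport.

Theorem theorem1p4 (R : realType) (k : nat) (V : set (Ck R k)) :
  (3 <= k)%N -> algebraic_set V -> alg_dim V (k - 2) ->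
  exists (O D : set (Ck R k)),
    [/\ short_Ck O, fatou_bieberbach D, D `<=` O & O `<=` ~` V].
Proof.
case: k V => [|[|n]] // V _ Valg [_]; rewrite subSS subSS subn0 => Vdim.
have [F [psi [Phi [r [mu [p [Fe fb pV]]]]]]] := fb_map_avoiding Valg Vdim.
have [psi1 [Phi1 [r1 [mu1 fb1]]]] := henon_fb_map R n.
have [W [D [Ws Df DW WP]]] := transported_domains p fb Fe fb1.
exists W, D; split=> // z /WP [w ->]; exact: pV.
Qed.
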